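(* In the system with active measurement ($\alpha=1$), the data set $\mathcal M_2(\omega)=\{u^\infty(\hat x,k,d,\omega)\,;\,\hat x\in\mathbb S^2,\ k\in\mathbb R_+,\ d\in\mathbb S^2\}$, for a single fixed realization $\omega$, uniquely recovers the potential $V$, without knowledge of $\sigma$ and $f$. That is: there is a map $\mathcal T$, defined on functions $\mathbb S^2\times\mathbb R_+\times\mathbb S^2\to\mathbb C$ and not depending on $\sigma,V,f$, such that for every admissible triple $(\sigma,V,f)$ and every $\omega\in\Omega$ for which the far-field data are defined, $$\mathcal T\big(u^\infty(\cdot,\cdot,\cdot,\omega)\big)=V\quad\text{a.e. in }\mathbb R^3 .$$
   Context: Setting. $D\subset\mathbb R^3$ is a fixed bounded domain containing the origin. A triple $(\sigma,V,f)$ of real-valued measurable functions on $\mathbb R^3$ is admissible if $\sigma^2,V,f\in L^\infty(\mathbb R^3;\mathbb R)$ and all are supported in $D$. $(\Omega,\mathcal F,\mathbb P)$ is a complete probability space and $\mathbb R_+=(0,\infty)$. $\dot B=\dot B_x(\omega)$ is Gaussian white noise: $\varphi\mapsto\langle\dot B(\cdot,\omega),\varphi\rangle$ is linear on real $L^2(D)$, each $\langle\dot B,\varphi\rangle$ is a zero-mean real Gaussian random variable, $\mathbb E(\langle\dot B,\varphi\rangle\langle\dot B,\psi\rangle)=\int_D\varphi\psi\,dx$; it is extended complex-linearly to complex $\varphi$. The system considered (formally), with $k=\sqrt E>0$, $d\in\mathbb S^2$, $\alpha\in\{0,1\}$, is $(-\Delta-k^2+V)u=f+\sigma\dot B_x(\omega)$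 in $\mathbb R^3$, $u=\alpha u^i+u^{sc}$ with $u^i(x)=e^{\mathrm i k x\cdot d}$, and $u^{sc}$ satisfying the Sommerfeld radiation condition. Its far-field pattern is defined as follows. Let $\Phi_k(x,y)=\frac{e^{\mathrm i k|x-y|}}{4\pi|x-y|}$, $(\mathcal R_k\varphi)(x)=\int_{\operatorname{supp}\varphi}\Phi_k(x,y)\varphi(y)\,dy$, and $\mathcal R_k(\sigma\dot B)(x)=\langle\dot B(\cdot,\omega),\sigma(\cdot)\Phi_k(x,\cdot)\rangle$. Then $$u^\infty(\hat x,k,d,\omega)=\frac1{4\pi}\int_D e^{-\mathrm i k\hat x\cdot y}\,(I-V\mathcal R_k)^{-1}(\alpha Vu^i-f-\sigma\dot B_y)\,dy,\qquad \hat x\in\mathbb S^2,$$ where $(I-V\mathcal R_k)^{-1}$ is the inverse on $L^2(D)$ and the noise contribution $\int_D e^{-\mathrm i k\hat x\cdot y}(I-V\mathcal R_k)^{-1}(\sigma\dot B_y)\,dy$ means the random variable $$\langle\dot B,\sigma e^{-\mathrm i k\hat x\cdot(\cdot)}\rangle+\int_D e^{-\mathrm i k\hat x\cdot y}\,\big[(I-V\mathcal R_k)^{-1}V\mathcal R_k(\sigma\dot B)\big](y)\,dy .$$ One fixed version of this noise contribution, as a function of $(\hat x,k,\omega)$ (it does not involve $d$), is used. Here $\alpha=1$ (active measurement). *)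

(* Defs.v *)
From HB Require Import structures.
From mathcomp Require Import all_boot all_order all_algebra.
From mathcomp Require Import all_classical all_reals all_analysis.
From mathcomp Require Import complex.
Import Order.TTheory GRing.Theory Num.Theory.
Import numFieldNormedType.Exports.

Set Implicit Arguments.
Unset Strict Implicit.
Unset Printing Implicit Defensive.

Local Open Scope classical_set_scope.
Local Open Scope ring_scope.
Local Open Scope complex_scope.

(* [R3] carries the product topology, [mR3] (convertible to it) the product of
   the Borel sigma-algebras on which the library defines Lebesgue measure. *)
Notation R3 R := (Real.sort R * Real.sort R * Real.sort R)%type.
Notation mR3 R :=
  (measurableTypeR R * measurableTypeR R * measurableTypeR R)%type.

Definition leb3 (R : realType) : set (mR3 R) -> \bar R :=
  ((@lebesgue_measure R \x @lebesgue_measure R) \x @lebesgue_measure R)%E.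
Arguments leb3 {R}.
HB.instance Definition _ (R : realType) := Measure.on (@leb3 R).

(* The library's norm on a product type is the sup norm, hence the explicit
   Euclidean one. *)
Definition dot (R : realType) (x y : R3 R) : R :=
  x.1.1 * y.1.1 + x.1.2 * y.1.2 + x.2 * y.2.
Definition enorm (R : realType) (x : R3 R) : R := Num.sqrt (dot x x).
Definition sphere2 (R : realType) : Type := {x : R3 R | enorm x = 1}.

Definition expi (R : realType) (t : R) : R[i] := cos t +i* sin t.

Definition Cintegral (R : realType) (A : set (R3 R)) (g : R3 R -> R[i]) : R[i] :=
  (\int[leb3]_(x in A) complex.Re (g x)) +i* (\int[leb3]_(x in A) complex.Im (g x)).

Section scattering.
Variables (R : realType) (D : set (R3 R)).

Definition bounded_domain_with_origin : Prop :=
  [/\ open D, connected D, bounded_set D & D 0].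

Definition supported_in (f : R3 R -> R) : Prop :=
  {ae leb3, forall x : R3 R, ~ D x -> f x = 0}.

Definition admissible (sigma V f : R3 R -> R) : Prop :=
  [/\ measurable_fun [set: mR3 R] sigma,
      (fun x => sigma x ^+ 2) \in Lfun (@leb3 R) +oo,
      V \in Lfun (@leb3 R) +oo, f \in Lfun (@leb3 R) +oo &
      [/\ supported_in (fun x => sigma x ^+ 2), supported_in V & supported_in f]].

(* L^2(D), each element being represented by its extension by zero. *)
Definition L2 (phi : R3 R -> R) : Prop :=
  phi \in Lfun (@leb3 R) 2%:E /\ supported_in phi.
Definition CL2 (phi : R3 R -> R[i]) : Prop :=
  L2 (fun x => complex.Re (phi x)) /\ L2 (fun x => complex.Im (phi x)).

Definition csupp (phi : R3 R -> R[i]) : set (R3 R) :=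
  closure [set y | phi y != 0].

Definition Phi (k : R) (x y : R3 R) : R[i] :=
  expi (k * enorm (x - y)) / (4 * pi * enorm (x - y))%:C.

Definition Rk (k : R) (phi : R3 R -> R[i]) (x : R3 R) : R[i] :=
  Cintegral (csupp phi) (fun y => Phi k x y * phi y).

(* [resolvent k V h] is (I - V R_k)^{-1} h for the inverse on L^2(D): the
   element g of L^2(D) with g - V R_k g = h a.e. in D. It is determined up to
   null sets since, for admissible V and k > 0, I - V R_k is a bijection of
   L^2(D). *)
Definition resolvent (k : R) (V : R3 R -> R) (h : R3 R -> R[i]) : R3 R -> R[i] :=
  xget (fun=> 0) [set g | CL2 g /\
    {ae leb3, forall x : R3 R, D x -> g x - (V x)%:C * Rk k g x = h x}].

Definition plane_wave (k : R) (d : sphere2 R) (x : R3 R) : R[i] :=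
  expi (k * dot x (sval d)).

Definition far_kernel (k : R) (xhat : sphere2 R) (y : R3 R) : R[i] :=
  expi (- (k * dot (sval xhat) y)).

Section noise.
Variables (dO : measure_display) (Omega : measurableType dO).
Variable P : probability Omega R.

(* The degenerate case is separate because [normal_prob 0 0] is not a Dirac
   mass in the library. *)
Definition centered_gaussian (X : {RV P >-> R}) : Prop :=
  exists s : R, forall A : set R, measurable A ->
    distribution P X A = if s == 0 then \d_(0 : R) A else normal_prob 0 s A.

(* Random variables are considered up to almost sure equality; only the values
   of [B] on L^2(D) are meaningful. *)
Record white_noise (B : (R3 R -> R) -> {RV P >-> R}) : Prop := {
  white_noise_linear : forall (a : R) (phi psi : R3 R -> R), L2 phi -> L2 psi ->
    {ae P, forall w, B (fun x => a * phi x + psi x) w = a * B phi w + B psi w};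
  white_noise_gaussian : forall phi, L2 phi -> centered_gaussian (B phi);
  white_noise_covariance : forall phi psi, L2 phi -> L2 psi ->
    ('E_P[(fun w => B phi w * B psi w)%R])%E = (\int[leb3]_(x in D) (phi x * psi x))%:E
}.

Variable B : (R3 R -> R) -> {RV P >-> R}.

Definition Cnoise (phi : R3 R -> R[i]) (w : Omega) : R[i] :=
  B (fun x => complex.Re (phi x)) w +i* B (fun x => complex.Im (phi x)) w.

(* [Z] is a jointly measurable version of the random field
   x |-> R_k (sigma B)(x); joint measurability is what gives a meaning to
   operators acting on x for fixed w. *)
Definition noise_potential (k : R) (sigma : R3 R -> R)
    (Z : R3 R -> Omega -> R[i]) : Prop :=
  [/\ measurable_fun [set: mR3 R * Omega]
        (fun p : mR3 R * Omega => complex.Re (Z p.1 p.2)),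
      measurable_fun [set: mR3 R * Omega]
        (fun p : mR3 R * Omega => complex.Im (Z p.1 p.2)) &
      forall x, {ae P, forall w,
        Z x w = Cnoise (fun y => (sigma y)%:C * Phi k x y) w}].

(* [N] is a version of the noise contribution
   \int_D e^{-ik xhat.y} (I - V R_k)^{-1} (sigma B_y) dy. *)
Definition noise_contribution (sigma V : R3 R -> R)
    (N : sphere2 R -> {posnum R} -> Omega -> R[i]) : Prop :=
  forall k : {posnum R}, exists2 Z, noise_potential k%:num sigma Z &
    forall xhat, {ae P, forall w,
      N xhat k w =
        Cnoise (fun y => (sigma y)%:C * far_kernel k%:num xhat y) w +
        Cintegral D (fun y => far_kernel k%:num xhat y *
          resolvent k%:num V (fun x => (V x)%:C * Z x w) y)}.

Definition far_field (alpha : bool) (V f : R3 R -> R)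
    (N : sphere2 R -> {posnum R} -> Omega -> R[i])
    (xhat : sphere2 R) (k : {posnum R}) (d : sphere2 R) (w : Omega) : R[i] :=
  ((4 * pi)^-1)%:C *
  (Cintegral D (fun y => far_kernel k%:num xhat y *
     resolvent k%:num V (fun x =>
       alpha%:R * (V x)%:C * plane_wave k%:num d x - (f x)%:C) y)
   - N xhat k w).

End noise.
End scattering.

(* Main.v *)
Require Import Defs.
From HB Require Import structures.
From mathcomp Require Import all_boot all_order all_algebra.
From mathcomp Require Import all_classical all_reals all_analysis.
From mathcomp Require Import complex.
From mathcomp Require Import measurable_realfun ess_sup_inf.
From mathcomp Require Import zify ring lra.
Import Order.TTheory GRing.Theory Num.Theory.
Import numFieldNormedType.Exports.
Set Implicit Arguments.
Unset Strict Implicit.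
Unset Printing Implicit Defensive.
Local Open Scope classical_set_scope.
Local Open Scope ring_scope.
Local Open Scope complex_scope.

(** Two far fields with the same observation direction xhat and the same wave
number k, for the incident directions d and xhat, contain the same noise
contribution and the same response to the source f. Their difference is
therefore deterministic, and it depends on the potential alone:
up to the factor 1/(4 pi) it is the integral over D of
exp(- i k xhat . y) (I - V R_k)^-1 (V (u_d - u_xhat)) (y), where u_d is the
plane wave of direction d. If R_k were negligible at high frequency, this
would be the integral of V(y) (exp(- i xi . y) - 1) with xi = k (xhat - d).
Every xi is of this form for every k with 2 k >= |xi| (momentum_transfer), so
letting k grow along the right sequence determines the Fourier transform of V
up to an additive constant.

High frequency. The operator R_k has kernel kap(x,y) exp(i k rho(x,y)), with
kap = 1 / (4 pi |x - y|) and rho = |x - y|. For a bounded g, the integral of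
|R_k g|^2 is by Fubini a quadratic form in g, whose coefficients are the
correlations of two columns of the kernel, that is, the cosine and sine
coefficients at frequency k of rho(x,y) - rho(x,y') against
kap(x,y) kap(x,y') dx. They need not be estimated at each k: by an argument
of Wiener, the mean over k = 0, ..., n of their squares tends to 0 as soon as
the level sets of x |-> rho(x,y) - rho(x,y') are null
(mean_cos_sin_coefficients, edist_levels). Hence the mean square of the
correlations, called the energy, is small for arbitrarily large integers k
(energy_small). For such k the operator R_k maps bounded functions to
functions that are small in mean, and R_k V R_k is small in the supremum norm.
This gives the Neumann series for (I - V R_k)^-1 (neumann_solution) and the
Born approximation in mean (born_error, radiated_difference).

Conclusion. If the same data come from V and V', then W = V - V' has a
constant Fourier transform, although W is bounded with bounded support. The
product of W with 1 - cos (eta . x) has zero transform, hence vanishes almost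
everywhere (fourier_uniqueness), and the second factor is nonzero off a null
plane when eta is small; so W = 0 (constant_transform_zero). The recovery map
picks any potential that realizes the data. *)

Local Notation integ mu f := (mu.-integrable setT (EFin \o f)).
Local Notation Re := complex.Re.
Local Notation Im := complex.Im.

(** * Real integrals and products of finite measures *)

Section real_integrals.
Context d (T : measurableType d) (R : realType).
Variable mu : {measure set T -> \bar R}.
Implicit Types f g : T -> R.

Lemma integ_le f g : measurable_fun setT f -> (forall x, `|f x| <= g x) ->
  integ mu g -> integ mu f.
Proof.
move=> mf fg ig; apply: (le_integrable measurableT _ _ ig) => /=.
  exact/measurable_EFinP.
by move=> x _ /=; rewrite lee_fin (le_trans (fg x))// ler_norm.
Qed.

Lemma abs_Rint_le f g : measurable_fun setT f -> (forall x, `|f x| <= g x) ->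
  integ mu g -> `|\int[mu]_x f x| <= \int[mu]_x g x.
Proof.
move=> mf fg ig; have jf := integ_le mf fg ig.
apply: (le_trans (le_normr_Rintegral measurableT jf)).
apply: le_Rintegral => //.
by apply: (integ_le _ _ ig) => [|x]; [exact: measurableT_comp|rewrite normr_id].
Qed.

Lemma Rint_ae f g : measurable_fun setT f -> measurable_fun setT g ->
  {ae mu, forall x, f x = g x} -> \int[mu]_x f x = \int[mu]_x g x.
Proof.
move=> mf mg fg; congr fine; apply: ae_eq_integral => //;
  [exact/measurable_EFinP|exact/measurable_EFinP|].
by apply: filterS fg => x /= -> _.
Qed.

Lemma Rint_dct (f_ : nat -> T -> R) f g :
  (forall n, measurable_fun setT (f_ n)) -> measurable_fun setT f ->
  {ae mu, forall x, f_ ^~ x @ \oo --> f x} -> integ mu g ->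
  (forall n x, `|f_ n x| <= g x) ->
  (fun n => \int[mu]_x f_ n x) @ \oo --> \int[mu]_x f x.
Proof.
move=> mf_ mf cf ig fg.
have [| | |//| |jf _ cvf] := @dominated_convergence _ T R mu setT measurableT
  (fun n => EFin \o f_ n) (EFin \o f) (EFin \o g).
- by move=> n; exact/measurable_EFinP.
- exact/measurable_EFinP.
- by apply: filterS cf => x cx _; apply: cvg_EFin; [exact: nearW|exact: cx].
- by apply: nearW => x n _ /=; rewrite lee_fin.
apply: fine_cvg; rewrite fineK //.
exact: integrable_fin_num.
Qed.

Lemma Rint_sum n (f : nat -> T -> R) : (forall j, integ mu (f j)) ->
  integ mu (fun x => \sum_(j < n) f j x) /\
  \int[mu]_x (\sum_(j < n) f j x) = \sum_(j < n) \int[mu]_x f j x.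
Proof.
move=> jf; elim: n => [|n [IH1 IH2]].
  have -> : (fun x => \sum_(j < 0) f j x) = cst 0.
    by apply/funext => x; rewrite big_ord0.
  by rewrite Rintegral_cst// mul0r big_ord0; split => //; exact: integrable0.
have E : (fun x => \sum_(j < n.+1) f j x) = (fun x => \sum_(j < n) f j x + f n x).
  by apply/funext => x; rewrite big_ord_recr.
by rewrite E big_ord_recr /= -IH2 -RintegralD//; split => //; exact: (integrableD _ IH1 (jf n)).
Qed.

End real_integrals.

Section finite_measure_integrals.
Context d1 (T1 : measurableType d1) (R : realType).
Variable m1 : {finite_measure set T1 -> \bar R}.

Lemma integ_cst (c : R) : integ m1 (cst c).
Proof. by apply: finite_measure_integrable_cst. Qed.

Lemma integ_bounded (f : T1 -> R) B : measurable_fun setT f ->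
  (forall x, `|f x| <= B) -> integ m1 f.
Proof. by move=> mf fB; apply: (integ_le mf fB); exact: integ_cst. Qed.

End finite_measure_integrals.

Section finite_product.
Context d1 d2 (T1 : measurableType d1) (T2 : measurableType d2) (R : realType).
Variable m1 : {finite_measure set T1 -> \bar R}.
Variable m2 : {finite_measure set T2 -> \bar R}.

(** The product measure under a constant of its own, so that it carries a
    finite measure structure and can be a factor of a further product. *)
Definition fprod : set (T1 * T2) -> \bar R := (m1 \x m2)%E.

HB.instance Definition _ := Measure.on fprod.

Let fprod_fin : fin_num_fun fprod.
Proof.
move=> A mA; rewrite ge0_fin_numE ?measure_ge0//.
apply: (@le_lt_trans _ _ (fprod setT)).
  by apply: le_measure => //; rewrite inE.
rewrite -setXTT /fprod product_measure1E//.
by rewrite ltey_eq fin_numM// fin_num_measure.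
Qed.

HB.instance Definition _ := Measure_isFinite.Build _ _ _ fprod fprod_fin.

End finite_product.

Section fiber_bound.
Context d1 d2 (T1 : measurableType d1) (T2 : measurableType d2) (R : realType).
Variable m1 : {finite_measure set T1 -> \bar R}.
Variable m2 : {finite_measure set T2 -> \bar R}.

(** A uniform bound on the fibres suffices, by Tonelli, because the measure on
    the base is finite; this is how joint integrability of singular kernels is
    obtained. *)
Lemma integ_of_fiber_bound (f : T1 * T2 -> R) C : measurable_fun setT f ->
  (forall y, (\int[m1]_x `|f (x, y)|%:E <= C%:E)%E) -> integ (fprod m1 m2) f.
Proof.
move=> mf fC; apply/(integrable21ltyP m1 m2); first exact/measurable_EFinP.
apply: (@le_lt_trans _ _ (\int[m2]_y C%:E)%E).
  apply: ge0_le_integral => //.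
  - by move=> y _; apply: integral_ge0.
  - apply: (@measurable_fun_fubini_tonelli_G _ _ _ _ _ _ (fun z => `|f z|%:E)%E) => //.
    by apply/measurable_EFinP; exact: measurableT_comp.
  - by move=> y _; rewrite (le_trans _ (fC y))// integral_ge0.
by rewrite ltey_eq (integrable_fin_num _ (integ_cst m2 C)).
Qed.

End fiber_bound.

Section fubini.
Context d1 d2 (T1 : measurableType d1) (T2 : measurableType d2) (R : realType).
Variable m1 : {finite_measure set T1 -> \bar R}.
Variable m2 : {finite_measure set T2 -> \bar R}.
Variable f : T1 * T2 -> R.
Hypothesis jf : integ (fprod m1 m2) f.

Lemma Rfubini1 : \int[fprod m1 m2]_z f z = \int[m1]_x \int[m2]_y f (x, y).
Proof.
rewrite /Rintegral -integral12_prod_meas1//=; congr fine.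
have jF := integrable_fubini_F jf.
apply: ae_eq_integral => //; first exact: measurable_int jF.
  have /measurable_int mF := jF.
  by apply/measurable_EFinP; apply: measurableT_comp.
apply: filterS (integrable_ae measurableT jF) => x /= h _; rewrite fineK //.
exact: h.
Qed.

Lemma Rfubini2 : \int[fprod m1 m2]_z f z = \int[m2]_y \int[m1]_x f (x, y).
Proof.
rewrite /Rintegral -integral21_prod_meas1//=; congr fine.
have mG := measurable_fubini_G jf.
apply: ae_eq_integral => //.
  by apply/measurable_EFinP; apply: measurableT_comp.
apply: filterS (ae_integrable2 jf) => y /= h _; rewrite fineK //.
exact: integrable_fin_num.
Qed.

Lemma Rfubini : \int[m1]_x \int[m2]_y f (x, y) = \int[m2]_y \int[m1]_x f (x, y).
Proof. by rewrite -Rfubini1 Rfubini2. Qed.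

Lemma measurable_Rfubini1 : measurable_fun setT (fun x => \int[m2]_y f (x, y)).
Proof.
by have /measurable_int mF := integrable_fubini_F jf; exact: measurableT_comp.
Qed.

Lemma measurable_Rfubini2 : measurable_fun setT (fun y => \int[m1]_x f (x, y)).
Proof.
by have mG := measurable_fubini_G jf; exact: measurableT_comp.
Qed.

End fubini.

Section measurable_coordinates.

Lemma measurable_comp_fst d1 d2 d3 (A : measurableType d1) (B : measurableType d2)
  (E : measurableType d3) (f : A -> B) :
  measurable_fun setT f -> measurable_fun setT (fun z : A * E => f z.1).
Proof. by move=> mf; apply: (measurableT_comp mf); exact: measurable_fst. Qed.

Lemma measurable_comp_snd d1 d2 d3 (A : measurableType d1) (B : measurableType d2)
  (E : measurableType d3) (f : A -> B) :
  measurable_fun setT f -> measurable_fun setT (fun z : E * A => f z.2).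
Proof. by move=> mf; apply: (measurableT_comp mf); exact: measurable_snd. Qed.

Lemma measurable_sectionl d1 d2 d3 (A : measurableType d1) (B : measurableType d2)
  (E : measurableType d3) (f : A -> B -> E) (y : B) :
  measurable_fun setT (fun p : A * B => f p.1 p.2) -> measurable_fun setT (f ^~ y).
Proof.
move=> mf; apply: (measurableT_comp mf (g := fun x => (x, y))).
by apply: measurable_fun_pair => //; exact: measurable_cst.
Qed.

Lemma measurable_sectionr d1 d2 d3 (A : measurableType d1) (B : measurableType d2)
  (E : measurableType d3) (f : A -> B -> E) (x : A) :
  measurable_fun setT (fun p : A * B => f p.1 p.2) -> measurable_fun setT (f x).
Proof.
move=> mf; apply: (measurableT_comp mf (g := fun y => (x, y))).
by apply: measurable_fun_pair => //; exact: measurable_cst.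
Qed.

End measurable_coordinates.

(** * The Riemann-Lebesgue lemma in the mean *)

Section product_integral.
Context d1 d2 (T1 : measurableType d1) (T2 : measurableType d2) (R : realType).
Variable m1 : {finite_measure set T1 -> \bar R}.
Variable m2 : {finite_measure set T2 -> \bar R}.
Variables (a : T1 -> R) (b : T2 -> R).
Hypotheses (ja : integ m1 a) (jb : integ m2 b).

Lemma integ_tensor : integ (fprod m1 m2) (fun z => a z.1 * b z.2).
Proof.
have /measurable_int/measurable_EFinP ma := ja.
have /measurable_int/measurable_EFinP mb := jb.
apply/(integrable12ltyP m1 m2).
  apply/measurable_EFinP; apply: measurable_funM.
    by apply: measurableT_comp => //; exact: measurable_fst.
  by apply: measurableT_comp => //; exact: measurable_snd.
have mb' : measurable_fun setT (fun y => (`|b y|%:E)%E).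
  by apply/measurable_EFinP; exact: measurableT_comp.
have inner x : (\int[m2]_y `|((a x * b y)%:E)| = `|a x|%:E * \int[m2]_y `|b y|%:E)%E.
  rewrite -ge0_integralZl//.
  by apply: eq_integral => y _; rewrite -EFinM -normrM.
under eq_integral do rewrite inner.
rewrite ge0_integralZr//; last 2 first.
- by apply/measurable_EFinP; exact: measurableT_comp.
- by apply: integral_ge0.
rewrite lte_mul_pinfty//.
- by apply: integral_ge0.
- rewrite ge0_fin_numE ?integral_ge0//.
  by move/integrableP : ja => -[].
- by move/integrableP : jb => -[].
Qed.

Lemma Rint_tensor : \int[fprod m1 m2]_z (a z.1 * b z.2) =
  (\int[m1]_x a x) * (\int[m2]_y b y).
Proof.
rewrite (Rfubini1 integ_tensor) /= -RintegralZr//.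
by apply: eq_Rintegral => x _; rewrite RintegralZl.
Qed.

End product_integral.

Section sine_zeros.
Variable R : realType.
Implicit Types x : R.

Lemma norm_sinDpin x n : `|sin (x + pi *+ n)| = `|sin x|.
Proof.
elim: n => [|n IH]; first by rewrite mulr0n addr0.
by rewrite mulrSr addrA sinDpi normrN.
Qed.

(** Subtracting the multiple of pi given by the floor of x / pi reduces the
    question to the interval from 0 to pi, inside which the sine is positive. *)
Lemma sin_eq0_int x : sin x = 0 -> exists m : int, x = m%:~R * pi.
Proof.
move=> sx; have pi0 := pi_gt0 R.
pose m := Num.floor (x / pi).
have /andP[m1 m2] := floor_itv (x / pi).
pose t := x - m%:~R * pi.
have t0 : 0 <= t by rewrite subr_ge0 -ler_pdivlMr.
have t1 : t < pi.
  rewrite ltrBlDl -[X in _ + X]mul1r -mulrDl -ltr_pdivrMr//.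
  by rewrite (lt_le_trans m2)// intrD.
have st : `|sin t| = 0.
  rewrite /t; case: (m) => n.
    rewrite -(norm_sinDpin _ n) -pmulrn mulr_natl subrK sx normr0 //.
  by rewrite NegzE mulrNz mulNr opprK mulr_natl norm_sinDpin sx normr0.
have [t00|t00] := eqVneq t 0.
  by exists m; apply/eqP; rewrite -subr_eq0 -/t t00.
have := sin_gt0_pi (x := t); rewrite t1 andbT lt_neqAle eq_sym t00 t0 => /(_ isT).
by move/eqP: st; rewrite normr_eq0 => /eqP ->; rewrite ltxx.
Qed.

End sine_zeros.

Section mean_riemann_lebesgue.
Variable R : realType.

Definition dirichlet_mean (n : nat) (t : R) : R :=
  n.+1%:R^-1 * \sum_(j < n.+1) cos (j%:R * t).

Lemma dirichlet_mean_le1 n t : `|dirichlet_mean n t| <= 1.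
Proof.
rewrite normrM ger0_norm// ler_pdivrMl// mulr1.
apply: (le_trans (ler_norm_sum _ _ _)).
apply: (le_trans (ler_sum _ (fun i _ => cos_max _))).
by rewrite sumr_const card_ord.
Qed.

(** The Dirichlet kernel: each product 2 sin (t/2) cos (j t) is a difference of
    two consecutive sines, so the sum telescopes. *)
Lemma sum_cosE n (t : R) : 2 * sin (t / 2) * (\sum_(j < n) cos (j%:R * t)) =
  sin ((n%:R - 2^-1) * t) + sin (t / 2).
Proof.
elim: n => [|n IH].
  by rewrite big_ord0 mulr0 sub0r mulNr sinN mulrC addrC subrr.
rewrite big_ord_recr /= mulrDr IH.
have -> : (n.+1%:R - 2^-1) * t = n%:R * t + t / 2.
  by rewrite -natr1; field.
have -> : (n%:R - 2^-1) * t = n%:R * t - t / 2 by field.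
rewrite !sinD cosN sinN; ring.
Qed.

(** Away from the resonances, where sin (t/2) = 0, the sums of cosines stay
    bounded by 1 / |sin (t/2)|, so that their means vanish in the limit. *)
Lemma cvg_dirichlet_mean t : sin (t / 2) != 0 ->
  dirichlet_mean ^~ t @ \oo --> 0.
Proof.
move=> st; set s := `|sin (t / 2)|.
have s0 : 0 < s by rewrite normr_gt0.
apply/norm_cvg0P.
apply: (@squeeze_cvgr _ _ _ _ (cst 0) (fun n => s^-1 * n.+1%:R^-1)).
- apply: nearW => n; rewrite normr_ge0/=.
  rewrite /dirichlet_mean normrM ger0_norm// [leRHS]mulrC.
  rewrite ler_pM2l ?invr_gt0// -(ler_pM2l s0) mulfV ?gt_eqF//.
  have := sum_cosE n.+1 t; move/(congr1 (fun x => `|x|)).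
  rewrite !normrM ger0_norm// -/s.
  set S := `|\sum__ _|; move=> h.
  have : `|sin ((n.+1%:R - 2^-1) * t) + sin (t / 2)| <= 2.
    apply: (le_trans (ler_normD _ _)).
    by rewrite [leRHS](_ : _ = 1 + 1)// lerD// sin_max.
  rewrite -h -mulrA; lra.
- exact: cvg_cst.
- rewrite -[X in _ --> X](mulr0 s^-1); apply: cvgMr; exact: cvg_harmonic.
Qed.

Context d (X : measurableType d).
Variable nu : {finite_measure set X -> \bar R}.
Variables (a psi : X -> R).
Hypothesis ja : integ nu a.
Hypothesis mpsi : measurable_fun setT psi.
Hypothesis psi_levels : forall c, nu [set x | psi x = c] = 0%E.

Let Z := (X * X)%type.
Local Notation nu2 := (fprod nu nu).

Lemma measurable_sin_comp d' (Y : measurableType d') (f : Y -> R) :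
  measurable_fun setT f -> measurable_fun setT (fun y => sin (f y)).
Proof.
move=> mf; apply: (measurableT_comp _ mf).
by apply: continuous_measurable_fun; exact: continuous_sin.
Qed.

Lemma measurable_cos_comp d' (Y : measurableType d') (f : Y -> R) :
  measurable_fun setT f -> measurable_fun setT (fun y => cos (f y)).
Proof.
move=> mf; apply: (measurableT_comp _ mf).
by apply: continuous_measurable_fun; exact: continuous_cos.
Qed.

Let phase (z : Z) := psi z.1 - psi z.2.

Let mphase : measurable_fun setT phase.
Proof.
apply: measurable_funB.
  by apply: measurableT_comp => //; exact: measurable_fst.
by apply: measurableT_comp => //; exact: measurable_snd.
Qed.

(** For fixed x, resonance confines psi y to countably many values, and each of
    them is taken on a null set. *)
Lemma ae_phase_nonresonant : {ae nu2, forall z, sin (phase z / 2) != 0}.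
Proof.
pose N := [set z | sin (phase z / 2) = 0].
have mN : measurable N.
  have mh : measurable_fun setT (fun z => sin (phase z / 2)).
    by apply: measurable_sin_comp; exact: measurable_funM.
  by rewrite -[N]setTI; exact: (mh measurableT _ (measurable_set1 0)).
have N0 : nu2 N = 0%E.
  rewrite /fprod /product_measure1 integral0_eq// => x _ /=.
  apply/negligibleP; first exact: measurable_xsection.
  (* resonance forces psi y to differ from psi x by a multiple of 2 pi *)
  have cover : xsection N x `<=` \bigcup_n
      [set y | exists2 m : int, unpickle n = Some m & psi y = psi x - 2 * (m%:~R * pi)].
    move=> y; rewrite /xsection/= inE => /sin_eq0_int[m e].
    exists (pickle m) => //; exists m; first by rewrite pickleK.
    rewrite -e /phase /=; lra.
  apply: negligibleS cover _; apply: negligible_bigcup => n.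
  case: (unpickle n : option int) => [m|]; last first.
    by apply: negligibleS (negligible_set0 _) => y [].
  apply: (@negligibleS _ _ _ _ [set y | psi y = psi x - 2 * (m%:~R * pi)]).
    by move=> y /= [m' [<-] ->].
  apply/negligibleP; last exact: psi_levels.
  have := mpsi measurableT (measurable_set1 (psi x - 2 * (m%:~R * pi))).
  by rewrite setTI.
exists N; split => // z /= /negP; rewrite negbK => /eqP; exact.
Qed.

(** Wiener's lemma: the sum of the squares of the two coefficients is the
    integral of a(x) a(y) cos (j (psi x - psi y)) over the product measure. The
    mean over j replaces the cosine by a Dirichlet mean, which tends to 0 almost
    everywhere and is bounded by 1; dominated convergence concludes. *)
Lemma mean_cos_sin_coefficients :
  (fun n => n.+1%:R^-1 * \sum_(j < n.+1)
     ((\int[nu]_x (a x * cos (j%:R * psi x))) ^+ 2 +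
      (\int[nu]_x (a x * sin (j%:R * psi x))) ^+ 2)) @ \oo --> 0.
Proof.
have /measurable_int/measurable_EFinP ma := ja.
have ja1 : integ nu (fun x => `|a x|).
  exact: (integrable_abse ja).
have jcs (c : R -> R) (j : nat) : (forall t, `|c t| <= 1) -> continuous c ->
    integ nu (fun x => a x * c (j%:R * psi x)).
  move=> c1 cc; apply: (integ_le _ _ ja1) => [|x].
    apply: measurable_funM => //; apply: (measurableT_comp (continuous_measurable_fun cc)).
    exact: measurable_funM.
  by rewrite normrM ler_piMr.
have ja2 : integ nu2 (fun z => `|a z.1| * `|a z.2|) by exact: (integ_tensor ja1 ja1).
have ma2 : measurable_fun setT (fun z : Z => a z.1 * a z.2).
  apply: measurable_funM.
    by apply: measurableT_comp => //; exact: measurable_fst.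
  by apply: measurableT_comp => //; exact: measurable_snd.
have mcosj (j : nat) : measurable_fun setT (fun z : Z => cos (j%:R * phase z)).
  by apply: measurable_cos_comp; exact: measurable_funM.
have jj (j : nat) : integ nu2 (fun z => a z.1 * a z.2 * cos (j%:R * phase z)).
  apply: (integ_le _ _ ja2) => [|z]; first exact: measurable_funM.
  by rewrite !normrM ler_piMr ?mulr_ge0// cos_max.
have step (j : nat) : (\int[nu]_x (a x * cos (j%:R * psi x))) ^+ 2 +
      (\int[nu]_x (a x * sin (j%:R * psi x))) ^+ 2 =
      \int[nu2]_z (a z.1 * a z.2 * cos (j%:R * phase z)).
  have jc := jcs _ j (@cos_max R) (@continuous_cos R).
  have js := jcs _ j (@sin_max R) (@continuous_sin R).
  rewrite !expr2 -(Rint_tensor jc jc) -(Rint_tensor js js) -RintegralD//; [|exact: (integ_tensor jc jc)|exact: (integ_tensor js js)].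
  apply: eq_Rintegral => z _; rewrite /phase mulrBr cosB; ring.
have sumE n : n.+1%:R^-1 * \sum_(j < n.+1)
     ((\int[nu]_x (a x * cos (j%:R * psi x))) ^+ 2 +
      (\int[nu]_x (a x * sin (j%:R * psi x))) ^+ 2) =
     \int[nu2]_z (a z.1 * a z.2 * dirichlet_mean n (phase z)).
  under eq_bigr do rewrite step.
  have [js <-] := Rint_sum n.+1 jj.
  rewrite -RintegralZl//; apply: eq_Rintegral => z _.
  by rewrite /dirichlet_mean mulrCA -mulr_sumr.
rewrite (funext sumE).
have <- : \int[nu2]_z 0 = 0 by rewrite Rintegral_cst// mul0r.
apply: (Rint_dct _ _ _ ja2) => //.
- move=> n; apply: measurable_funM => //.
  apply: measurable_funM => //; apply: measurable_sum => j.
  exact: mcosj.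
- apply: filterS ae_phase_nonresonant => z nr.
  rewrite -[X in _ --> X](mulr0 (a z.1 * a z.2)).
  by apply: cvgMr; exact: cvg_dirichlet_mean.
- move=> n z; rewrite normrM [X in X * _]normrM ler_piMr ?mulr_ge0//.
  exact: dirichlet_mean_le1.
Qed.

End mean_riemann_lebesgue.

(** * Complex-valued functions *)

Section complex_values.
Variable R : realType.
Implicit Types z w : R[i].

Lemma ReM z w : Re (z * w) = Re z * Re w - Im z * Im w.
Proof. by case: z => a b; case: w. Qed.

Lemma ImM z w : Im (z * w) = Re z * Im w + Im z * Re w.
Proof. by case: z => a b; case: w. Qed.

Lemma ReD z w : Re (z + w) = Re z + Re w.
Proof. by case: z => a b; case: w. Qed.

Lemma ImD z w : Im (z + w) = Im z + Im w.
Proof. by case: z => a b; case: w. Qed.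

Lemma ReN z : Re (- z) = - Re z. Proof. by case: z. Qed.
Lemma ImN z : Im (- z) = - Im z. Proof. by case: z. Qed.

Lemma ReZ (a : R) z : Re (a%:C * z) = a * Re z.
Proof. by rewrite ReM /= mul0r subr0. Qed.

Lemma ImZ (a : R) z : Im (a%:C * z) = a * Im z.
Proof. by rewrite ImM /= mul0r addr0. Qed.

Lemma complex_eqP z w : Re z = Re w -> Im z = Im w -> z = w.
Proof. by case: z => a b; case: w => c d /= -> ->. Qed.

(** The l^1 norm of the pair of coordinates: it is submultiplicative, and it
    spares square roots and the measurability of the modulus. *)
Definition cabs z : R := `|Re z| + `|Im z|.
Definition sqmod z : R := Re z ^+ 2 + Im z ^+ 2.

Lemma cabs_ge0 z : 0 <= cabs z. Proof. by rewrite addr_ge0. Qed.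

Lemma cabs0 : cabs 0 = 0. Proof. by rewrite /cabs /= normr0 addr0. Qed.

Lemma cabsD z w : cabs (z + w) <= cabs z + cabs w.
Proof.
rewrite /cabs ReD ImD addrACA; apply: lerD; exact: ler_normD.
Qed.

Lemma cabsN z : cabs (- z) = cabs z.
Proof. by rewrite /cabs ReN ImN !normrN. Qed.

Lemma cabsB z w : cabs (z - w) <= cabs z + cabs w.
Proof. by rewrite (le_trans (cabsD _ _))// cabsN. Qed.

Lemma cabsM z w : cabs (z * w) <= cabs z * cabs w.
Proof.
rewrite /cabs ReM ImM.
have h1 := ler_normB (Re z * Re w) (Im z * Im w).
have h2 := ler_normD (Re z * Im w) (Im z * Re w).
rewrite !normrM in h1 h2; apply: (le_trans (lerD h1 h2)).
rewrite mulrDl !mulrDr; lra.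
Qed.

Lemma cabsZ (a : R) z : cabs (a%:C * z) = `|a| * cabs z.
Proof. by rewrite /cabs ReZ ImZ !normrM mulrDr. Qed.

Lemma cabs_eq0 z : cabs z <= 0 -> z = 0.
Proof.
rewrite /cabs => h; have h1 := normr_ge0 (Re z); have h2 := normr_ge0 (Im z).
by apply: complex_eqP => /=; apply/eqP; rewrite -normr_eq0; apply/eqP; lra.
Qed.

Lemma normRe_le z : `|Re z| <= cabs z. Proof. by rewrite lerDl. Qed.
Lemma normIm_le z : `|Im z| <= cabs z. Proof. by rewrite lerDr. Qed.

Lemma sqmod_ge0 z : 0 <= sqmod z. Proof. by rewrite addr_ge0// sqr_ge0. Qed.

Lemma sqr_cabs_le z : cabs z ^+ 2 <= 2 * sqmod z.
Proof.
rewrite /cabs /sqmod -(real_normK (num_real (Re z))) -(real_normK (num_real (Im z))).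
have := sqr_ge0 (`|Re z| - `|Im z|); rewrite !expr2; lra.
Qed.

Lemma cabs_expi (t : R) : cabs (expi t) <= 2.
Proof.
by rewrite /cabs /= [leRHS](_ : _ = 1 + 1)// lerD ?cos_max ?sin_max.
Qed.

End complex_values.

Section complex_integral.
Context d (X : measurableType d) (R : realType).
Variable nu : {measure set X -> \bar R}.
Implicit Types g h : X -> R[i].

Definition cmeas g :=
  measurable_fun setT (fun x => Re (g x)) /\ measurable_fun setT (fun x => Im (g x)).

Definition cinteg g :=
  integ nu (fun x => Re (g x)) /\ integ nu (fun x => Im (g x)).

Definition Cint g : R[i] := (\int[nu]_x Re (g x)) +i* (\int[nu]_x Im (g x)).

Lemma cmeasM g h : cmeas g -> cmeas h -> cmeas (fun x => g x * h x).
Proof.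
move=> [g1 g2] [h1 h2]; split.
  under eq_fun do rewrite ReM; apply: measurable_funB; exact: measurable_funM.
under eq_fun do rewrite ImM; apply: measurable_funD; exact: measurable_funM.
Qed.

Lemma cmeasD g h : cmeas g -> cmeas h -> cmeas (fun x => g x + h x).
Proof.
move=> [g1 g2] [h1 h2]; split.
  under eq_fun do rewrite ReD; exact: measurable_funD.
under eq_fun do rewrite ImD; exact: measurable_funD.
Qed.

Lemma cmeasN g : cmeas g -> cmeas (fun x => - g x).
Proof.
move=> [g1 g2]; split.
  under eq_fun do rewrite ReN; exact: measurable_funN.
under eq_fun do rewrite ImN; exact: measurable_funN.
Qed.

Lemma cmeasR (f : X -> R) : measurable_fun setT f -> cmeas (fun x => (f x)%:C).
Proof. by move=> mf; split => //=; exact: measurable_cst. Qed.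

Lemma cmeas_expi (f : X -> R) : measurable_fun setT f -> cmeas (fun x => expi (f x)).
Proof.
by move=> mf; split => /=; [exact: measurable_cos_comp|exact: measurable_sin_comp].
Qed.

Lemma measurable_cabs g : cmeas g -> measurable_fun setT (fun x => cabs (g x)).
Proof. by move=> [g1 g2]; apply: measurable_funD; exact: measurableT_comp. Qed.

Lemma cinteg_le g (F : X -> R) : cmeas g -> (forall x, cabs (g x) <= F x) ->
  integ nu F -> cinteg g.
Proof.
move=> [g1 g2] gF jF; split; apply: (integ_le _ _ jF) => // x.
  exact: le_trans (normRe_le _) (gF x).
exact: le_trans (normIm_le _) (gF x).
Qed.

Lemma cabs_Cint g (F : X -> R) : cmeas g -> (forall x, cabs (g x) <= F x) ->
  integ nu F -> cabs (Cint g) <= \int[nu]_x F x.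
Proof.
move=> mg gF jF; have [jr ji] := cinteg_le mg gF jF.
have ar := integrable_abse jr; have ai := integrable_abse ji.
apply: (@le_trans _ _ (\int[nu]_x `|Re (g x)| + \int[nu]_x `|Im (g x)|)).
  by apply: lerD; exact: le_normr_Rintegral.
rewrite -RintegralD//; apply: le_Rintegral => //.
- exact: (integrableD _ ar ai).
- by move=> x _; exact: gF.
Qed.

Lemma CintD g h : cinteg g -> cinteg h -> Cint (fun x => g x + h x) = Cint g + Cint h.
Proof.
move=> [g1 g2] [h1 h2]; apply: complex_eqP => /=; rewrite -RintegralD//.
  by apply: eq_Rintegral => x _; rewrite ReD.
by apply: eq_Rintegral => x _; rewrite ImD.
Qed.

Lemma CintN g : cinteg g -> Cint (fun x => - g x) = - Cint g.
Proof.
move=> [g1 g2]; apply: complex_eqP => /=; rewrite -[RHS]mulN1r -RintegralZl//.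
  by apply: eq_Rintegral => x _; rewrite ReN mulN1r.
by apply: eq_Rintegral => x _; rewrite ImN mulN1r.
Qed.

Lemma cintegN g : cinteg g -> cinteg (fun x => - g x).
Proof.
move=> [g1 g2]; split.
  under [X in integ nu X]eq_fun do rewrite ReN; exact: (integrableN g1).
under [X in integ nu X]eq_fun do rewrite ImN; exact: (integrableN g2).
Qed.

Lemma Cint_ae g h : cmeas g -> cmeas h -> {ae nu, forall x, g x = h x} ->
  Cint g = Cint h.
Proof.
move=> [g1 g2] [h1 h2] gh; congr Complex; apply: Rint_ae => //;
  by apply: filterS gh => x ->.
Qed.

End complex_integral.

(** * Oscillatory integral operators *)

(** The volume potential enters the high frequency analysis only through its
    form kap exp(i k rho), a uniform bound on the squares of the rows of kap, and
    the fact that the phase differences rho(.,y) - rho(.,y') have null level sets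
    for almost all y and y'. *)
Section oscillatory_operator.
Context d (X : measurableType d) (R : realType).
Variable nu : {finite_measure set X -> \bar R}.
Variables (kap rho : X -> X -> R) (C : R).
Hypothesis C0 : 0 <= C.
Hypothesis mkap : measurable_fun setT (fun p : X * X => kap p.1 p.2).
Hypothesis mrho : measurable_fun setT (fun p : X * X => rho p.1 p.2).
Hypothesis kap0 : forall x y, 0 <= kap x y.
Hypothesis kapC : forall x y, kap x y = kap y x.
Hypothesis kap_sq : forall x, (\int[nu]_y (kap x y ^+ 2)%:E <= C%:E)%E.
Hypothesis rho_levels : {ae (fprod nu nu), forall z,
  forall c, nu [set x | rho x z.1 - rho x z.2 = c] = 0%E}.

Local Notation nu2 := (fprod nu nu).
Definition mass : R := \int[nu]_x 1.

Lemma mass_ge0 : 0 <= mass. Proof. exact: Rintegral_ge0. Qed.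

Lemma integ_kap2 x : integ nu (fun y => kap x y ^+ 2).
Proof.
apply/integrableP; split.
  by apply/measurable_EFinP; apply: measurable_funX; exact: measurable_sectionr.
rewrite (le_lt_trans _ (ltry C))//= (le_trans _ (kap_sq x))//.
by under eq_integral do rewrite ger0_norm ?sqr_ge0//.
Qed.

Lemma Rint_kap2 x : \int[nu]_y kap x y ^+ 2 <= C.
Proof.
by rewrite -lee_fin /Rintegral fineK// integrable_fin_num//; exact: integ_kap2.
Qed.

Lemma measurable_kapl y : measurable_fun setT (kap ^~ y).
Proof. exact: measurable_sectionl. Qed.

Lemma measurable_rhol y : measurable_fun setT (rho ^~ y).
Proof. exact: measurable_sectionl. Qed.

Lemma kapM_le x y z : kap x y * kap x z <= kap y x ^+ 2 / 2 + kap z x ^+ 2 / 2.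
Proof.
rewrite (kapC y) (kapC z); have := sqr_ge0 (kap x y - kap x z); rewrite !expr2; lra.
Qed.

Lemma integ_kap2half y : integ nu (fun x => kap y x ^+ 2 / 2).
Proof. exact: (integrableZr measurableT 2^-1 (integ_kap2 y)). Qed.

Lemma integ_kapM (y z : X) : integ nu (fun x => kap x y * kap x z).
Proof.
apply: (integ_le _ _ (integrableD measurableT (integ_kap2half y) (integ_kap2half z))).
  by apply: measurable_funM; exact: measurable_kapl.
by move=> x; rewrite ger0_norm ?mulr_ge0//; exact: kapM_le.
Qed.

Lemma Rint_kapM_le (y z : X) : \int[nu]_x (kap x y * kap x z) <= C.
Proof.
have jh := integ_kap2half.
apply: (@le_trans _ _ (\int[nu]_x (kap y x ^+ 2 / 2 + kap z x ^+ 2 / 2))).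
  apply: le_Rintegral => //; first exact: integ_kapM.
  - exact: (integrableD _ (jh y) (jh z)).
  - by move=> x _; exact: kapM_le.
rewrite RintegralD// !RintegralZr//; [|exact: integ_kap2..].
have := Rint_kap2 y; have := Rint_kap2 z; lra.
Qed.

Lemma measurable_proj12 (f : X -> X -> R) : measurable_fun setT (fun p : X * X => f p.1 p.2) ->
  measurable_fun setT (fun p : X * (X * X) => f p.1 p.2.1).
Proof.
move=> mf; apply: (measurableT_comp mf (g := fun p : X * (X * X) => (p.1, p.2.1))).
apply: measurable_fun_pair; first exact: measurable_fst.
by apply: measurable_comp_snd; exact: measurable_fst.
Qed.

Lemma measurable_proj13 (f : X -> X -> R) : measurable_fun setT (fun p : X * X => f p.1 p.2) ->
  measurable_fun setT (fun p : X * (X * X) => f p.1 p.2.2).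
Proof.
move=> mf; apply: (measurableT_comp mf (g := fun p : X * (X * X) => (p.1, p.2.2))).
apply: measurable_fun_pair; first exact: measurable_fst.
by apply: measurable_comp_snd; exact: measurable_snd.
Qed.

Lemma integ_kapM3 : integ (fprod nu nu2) (fun p => kap p.1 p.2.1 * kap p.1 p.2.2).
Proof.
apply: (@integ_of_fiber_bound _ _ _ _ _ _ _ _ C); last first.
- move=> z /=; have := Rint_kapM_le z.1 z.2.
  rewrite -lee_fin /Rintegral fineK; last by apply: integrable_fin_num => //; exact: integ_kapM.
  apply: le_trans; rewrite le_eqVlt; apply/predU1P; left.
  by apply: eq_integral => x _; rewrite ger0_norm ?mulr_ge0.
- by apply: measurable_funM; [exact: measurable_proj12|exact: measurable_proj13].
Qed.

(** For c = cos and c = sin, the real and imaginary parts of the inner product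
    of the columns z.1 and z.2 of the kernel. *)
Definition corr (c : R -> R) (k : R) (z : X * X) : R :=
  \int[nu]_x (kap x z.1 * kap x z.2 * c (k * (rho x z.1 - rho x z.2))).

Section corr_trig.
Variables (c : R -> R).
Hypotheses (cc : continuous c) (c1 : forall t, `|c t| <= 1).

Lemma measurable_corr_integrand k : measurable_fun setT (fun p : X * (X * X) =>
  kap p.1 p.2.1 * kap p.1 p.2.2 * c (k * (rho p.1 p.2.1 - rho p.1 p.2.2))).
Proof.
apply: measurable_funM.
  by apply: measurable_funM; [exact: measurable_proj12|exact: measurable_proj13].
apply: (measurableT_comp (continuous_measurable_fun cc)).
by apply: measurable_funM => //; apply: measurable_funB;
  [exact: measurable_proj12|exact: measurable_proj13].
Qed.

Lemma integ_corr_integrand k : integ (fprod nu nu2) (fun p : X * (X * X) =>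
  kap p.1 p.2.1 * kap p.1 p.2.2 * c (k * (rho p.1 p.2.1 - rho p.1 p.2.2))).
Proof.
apply: (integ_le _ _ integ_kapM3); first exact: measurable_corr_integrand.
by move=> p; rewrite !normrM !(ger0_norm (kap0 _ _)) ler_piMr ?mulr_ge0.
Qed.

Lemma measurable_corr k : measurable_fun setT (corr c k).
Proof. exact: (measurable_Rfubini2 (integ_corr_integrand k)). Qed.

Lemma corr_le k z : `|corr c k z| <= C.
Proof.
apply: (le_trans (abs_Rint_le _ _ (integ_kapM z.1 z.2))); last exact: Rint_kapM_le.
  exact: (@measurable_sectionl _ _ _ _ _ _ (fun x z => kap x z.1 * kap x z.2 * c (k * (rho x z.1 - rho x z.2))) z (measurable_corr_integrand k)).
by move=> x; rewrite !normrM !(ger0_norm (kap0 _ _)) ler_piMr ?mulr_ge0.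
Qed.

End corr_trig.

(** The squared Hilbert-Schmidt norm of the adjoint of cop k times cop k, the
    operator with kernel cker k. *)
Definition energy (k : R) : R :=
  \int[nu2]_z (corr (@cos R) k z ^+ 2 + corr (@sin R) k z ^+ 2).

Let mcos := measurable_corr (@continuous_cos R) (@cos_max R).
Let msin := measurable_corr (@continuous_sin R) (@sin_max R).
Let cos_le := corr_le (@continuous_cos R) (@cos_max R).
Let sin_le := corr_le (@continuous_sin R) (@sin_max R).

Lemma corr_sq_le k z : 0 <= corr (@cos R) k z ^+ 2 + corr (@sin R) k z ^+ 2 <= 2 * C ^+ 2.
Proof.
rewrite addr_ge0 ?sqr_ge0//=.
have h (c : R) : `|c| <= C -> c ^+ 2 <= C ^+ 2.
  by move=> cC; rewrite -(real_normK (num_real c)) ler_pXn2r// nnegrE.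
have := h _ (cos_le k z); have := h _ (sin_le k z); lra.
Qed.

Lemma measurable_corr_sq k : measurable_fun setT
  (fun z => corr (@cos R) k z ^+ 2 + corr (@sin R) k z ^+ 2).
Proof. by apply: measurable_funD; apply: measurable_funX. Qed.

Lemma integ_corr_sq k : integ nu2 (fun z => corr (@cos R) k z ^+ 2 + corr (@sin R) k z ^+ 2).
Proof.
apply: (@integ_bounded _ _ _ _ _ (2 * C ^+ 2)); first exact: measurable_corr_sq.
by move=> z; have /andP[h1 h2] := corr_sq_le k z; rewrite ger0_norm.
Qed.

Lemma energy_ge0 k : 0 <= energy k.
Proof. by apply: Rintegral_ge0 => z _; have /andP[] := corr_sq_le k z. Qed.

(** The lemma on means of cosine and sine coefficients applies to almost every
    pair of columns, with the product of the two amplitudes as density and the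
    difference of the two phases as phase. *)
Lemma cvg_mean_energy :
  (fun n => n.+1%:R^-1 * \sum_(j < n.+1) energy j%:R) @ \oo --> 0.
Proof.
pose F n z := n.+1%:R^-1 *
  \sum_(j < n.+1) (corr (@cos R) j%:R z ^+ 2 + corr (@sin R) j%:R z ^+ 2).
have E n : n.+1%:R^-1 * \sum_(j < n.+1) energy j%:R = \int[nu2]_z F n z.
  have [js <-] := Rint_sum n.+1 (fun j : nat => integ_corr_sq j%:R).
  by rewrite -RintegralZl.
rewrite (funext E).
have <- : \int[nu2]_z 0 = 0 by rewrite Rintegral_cst// mul0r.
apply: (Rint_dct (g := cst (2 * C ^+ 2))) => //.
- move=> n; apply: measurable_funM => //; apply: measurable_sum => j.
  exact: measurable_corr_sq.
- apply: filterS rho_levels => z lev.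
  exact: (mean_cos_sin_coefficients (integ_kapM z.1 z.2)
    (measurable_funB (measurable_rhol z.1) (measurable_rhol z.2)) lev).
- exact: integ_cst.
- move=> n z; have h : 0 <= \sum_(j < n.+1)
      (corr (@cos R) j%:R z ^+ 2 + corr (@sin R) j%:R z ^+ 2).
    by apply: sumr_ge0 => j _; have /andP[] := corr_sq_le j%:R z.
  rewrite ger0_norm ?mulr_ge0// ler_pdivrMl//.
  apply: (@le_trans _ _ (\sum_(j < n.+1) (2 * C ^+ 2))).
    by apply: ler_sum => j _; have /andP[] := corr_sq_le j%:R z.
  by rewrite sumr_const card_ord -[leLHS]mulr_natl.
Qed.

(** Otherwise all energies from some index on would exceed a positive constant,
    and their means would stay above a fraction of it. *)
Lemma energy_small eps J : 0 < eps -> exists2 j, (J <= j)%N & energy j%:R <= eps.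
Proof.
move=> e0; apply: contrapT => H.
have big j : (J <= j)%N -> eps < energy j%:R.
  by move=> Jj; rewrite ltNge; apply/negP => h; apply: H; exists j.
have e2 : 0 < eps / 2 by lra.
have /cvgrPdist_lt/(_ _ e2)[N _ HN] := cvg_mean_energy.
(* at least half of the indices 0, ..., n are at least J *)
pose n := (N + J.*2)%N.
have /HN : (N <= n)%N by rewrite leq_addr.
rewrite /= sub0r normrN => /(le_lt_trans (ler_norm _)).
apply/negP; rewrite -leNgt ler_pdivlMl//.
apply: (@le_trans _ _ (\sum_(J <= j < n.+1) energy j%:R)); last first.
  rewrite [leRHS](_ : _ = \sum_(0 <= j < n.+1) energy j%:R); last by rewrite big_mkord.
  have Jn : (J <= n.+1)%N by rewrite /n; lia.
  rewrite (big_cat_nat (leq0n J) Jn)/=.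
  by rewrite lerDr sumr_ge0// => j _; exact: energy_ge0.
apply: (@le_trans _ _ (\sum_(J <= j < n.+1) eps)).
  have h : n.+1%:R <= (n.+1 - J)%:R * 2 :> R by rewrite -natrM ler_nat /n; lia.
  rewrite sumr_const_nat -[leRHS]mulr_natl.
  have := ler_wpM2r (ltW e2) h; lra.
rewrite [leLHS]big_nat_cond [leRHS]big_nat_cond; apply: ler_sum => j.
by rewrite andbT => /andP[Jj _]; exact/ltW/big.
Qed.

Definition cker k x y : R[i] := (kap x y)%:C * expi (k * rho x y).

(** For the amplitude 1 / (4 pi |x - y|) and the phase |x - y| this is the
    volume potential R_k. *)
Definition cop k (g : X -> R[i]) (x : X) : R[i] := Cint nu (fun y => cker k x y * g y).

Definition sqinteg (g : X -> R[i]) := cmeas g /\ integ nu (fun x => cabs (g x) ^+ 2).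

Lemma cmeas_cker k : cmeas (fun p : X * X => cker k p.1 p.2).
Proof.
apply: cmeasM; first exact: cmeasR.
by apply: cmeas_expi; exact: measurable_funM.
Qed.

Lemma cabs_cker k x y : cabs (cker k x y) <= 2 * kap x y.
Proof.
rewrite /cker cabsZ ger0_norm// mulrC ler_wpM2r//; exact: cabs_expi.
Qed.

Lemma sqinteg_bounded (g : X -> R[i]) B : cmeas g -> (forall x, cabs (g x) <= B) -> sqinteg g.
Proof.
move=> mg gB; split => //; apply: (@integ_bounded _ _ _ _ _ (B ^+ 2)).
  by apply: measurable_funX; exact: measurable_cabs.
move=> x; rewrite ger0_norm ?sqr_ge0// ler_pXn2r ?nnegrE ?cabs_ge0//.
exact: le_trans (cabs_ge0 _) (gB x).
Qed.

Lemma cabs_cker_mul k (g : X -> R[i]) x y :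
  cabs (cker k x y * g y) <= kap x y ^+ 2 + cabs (g y) ^+ 2.
Proof.
apply: (le_trans (cabsM _ _)).
apply: (@le_trans _ _ (2 * kap x y * cabs (g y))).
  by rewrite ler_wpM2r ?cabs_ge0// cabs_cker.
have := sqr_ge0 (kap x y - cabs (g y)); rewrite !expr2; lra.
Qed.

Lemma cmeas_cker_mul2 k (g : X -> R[i]) : cmeas g ->
  cmeas (fun p : X * X => cker k p.1 p.2 * g p.2).
Proof.
move=> [g1 g2]; apply: cmeasM; first exact: cmeas_cker.
by split; [exact: (measurable_comp_snd g1)|exact: (measurable_comp_snd g2)].
Qed.

Lemma cmeas_cker_mul k (g : X -> R[i]) x : cmeas g -> cmeas (fun y => cker k x y * g y).
Proof.
move=> /(cmeas_cker_mul2 k)[m1 m2]; split.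
  exact: (@measurable_sectionr _ _ _ _ _ _ (fun x y => Re (cker k x y * g y)) x m1).
exact: (@measurable_sectionr _ _ _ _ _ _ (fun x y => Im (cker k x y * g y)) x m2).
Qed.

Lemma cinteg_cker_mul k (g : X -> R[i]) x : sqinteg g -> cinteg nu (fun y => cker k x y * g y).
Proof.
move=> [mg jg]; apply: (cinteg_le (cmeas_cker_mul k x mg) (cabs_cker_mul k g x)).
exact: (integrableD measurableT (integ_kap2 x) jg).
Qed.

Lemma integ_kap2_prod : integ nu2 (fun p => kap p.1 p.2 ^+ 2).
Proof.
apply: (@integ_of_fiber_bound _ _ _ _ _ _ _ _ C); first exact: measurable_funX.
move=> y /=; apply: le_trans (kap_sq y); rewrite le_eqVlt; apply/predU1P; left.
by apply: eq_integral => x _; rewrite ger0_norm ?sqr_ge0// kapC.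
Qed.

Lemma cmeas_cop k (g : X -> R[i]) : sqinteg g -> cmeas (cop k g).
Proof.
move=> [mg jg]; have mm := cmeas_cker_mul2 k mg.
have jj : cinteg nu2 (fun p => cker k p.1 p.2 * g p.2).
  apply: (cinteg_le mm (fun p => cabs_cker_mul k g p.1 p.2)).
  have jg2 : integ nu2 (fun p => cabs (g p.2) ^+ 2).
    have := integ_tensor (integ_cst nu 1) jg.
    by apply: eq_integrable => // p _ /=; rewrite mul1r.
  exact: (integrableD measurableT integ_kap2_prod jg2).
by split; [exact: (measurable_Rfubini1 jj.1)|exact: (measurable_Rfubini1 jj.2)].
Qed.

Lemma integ_kap2_sqinteg (g : X -> R[i]) x : sqinteg g ->
  integ nu (fun y => kap x y ^+ 2 + cabs (g y) ^+ 2).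
Proof. by move=> [_ jg]; exact: (integrableD measurableT (integ_kap2 x) jg). Qed.

(** The operator maps square integrable functions to bounded ones, by the bound
    on the rows of the amplitude. This is what turns a square integrable solution
    of the integral equation into a bounded one. *)
Lemma cop_sqinteg_sup k (g : X -> R[i]) : sqinteg g ->
  forall x, cabs (cop k g x) <= C + \int[nu]_y cabs (g y) ^+ 2.
Proof.
move=> gs x; have [mg jg] := gs.
apply: (le_trans (cabs_Cint (cmeas_cker_mul k x mg) (cabs_cker_mul k g x) (integ_kap2_sqinteg x gs))).
by rewrite RintegralD//; [rewrite lerD2r; exact: Rint_kap2|exact: integ_kap2].
Qed.

Lemma sqintegB (g h : X -> R[i]) : sqinteg g -> sqinteg h -> sqinteg (fun x => g x - h x).
Proof.
move=> [mg jg] [mh jh].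
have mgh : cmeas (fun x => g x - h x) by apply: cmeasD => //; exact: cmeasN.
split => //; have j := integrableZl measurableT 2 (integrableD measurableT jg jh).
apply: (integ_le _ _ j); first by apply: measurable_funX; exact: measurable_cabs.
move=> x /=; rewrite ger0_norm ?sqr_ge0//.
apply: (@le_trans _ _ ((cabs (g x) + cabs (h x)) ^+ 2)).
  by rewrite ler_pXn2r ?nnegrE ?addr_ge0 ?cabs_ge0//; exact: cabsB.
have := sqr_ge0 (cabs (g x) - cabs (h x)); rewrite !expr2; lra.
Qed.

Lemma copB k (g h : X -> R[i]) x : sqinteg g -> sqinteg h ->
  cop k (fun y => g y - h y) x = cop k g x - cop k h x.
Proof.
move=> gs hs; have jg := cinteg_cker_mul k x gs; have jh := cinteg_cker_mul k x hs.
rewrite /cop -CintN// -CintD//; last exact: cintegN.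
by congr Cint; apply/funext => y; rewrite mulrBr.
Qed.

Lemma cop_sup k (g : X -> R[i]) B : cmeas g -> (forall x, cabs (g x) <= B) ->
  forall x, cabs (cop k g x) <= B * (C + mass).
Proof.
move=> mg gB x; have B0 : 0 <= B := le_trans (cabs_ge0 _) (gB x).
have jF : integ nu (fun y => B * (kap x y ^+ 2 + 1)).
  exact: (integrableZl measurableT B (integrableD measurableT (integ_kap2 x) (integ_cst nu 1))).
apply: (le_trans (cabs_Cint (cmeas_cker_mul k x mg) _ jF)).
  move=> y; apply: (le_trans (cabsM _ _)).
  apply: (@le_trans _ _ (2 * kap x y * B)).
    by apply: ler_pM; rewrite ?cabs_ge0 ?cabs_cker.
  rewrite mulrC ler_wpM2l//.
  have := sqr_ge0 (kap x y - 1); rewrite !expr2; lra.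
rewrite RintegralZl//; last exact: (integrableD measurableT (integ_kap2 x) (integ_cst nu 1)).
rewrite ler_wpM2l// RintegralD//; [|exact: integ_kap2|exact: (integ_cst nu 1)].
by rewrite lerD2r; exact: Rint_kap2.
Qed.

Section quadratic_form.
Variables (k : R) (g : X -> R[i]) (B : R).
Hypotheses (mg : cmeas g) (gB : forall x, cabs (g x) <= B).

Let A (z : X * X) := Re (g z.1) * Re (g z.2) + Im (g z.1) * Im (g z.2).
Let A' (z : X * X) := Re (g z.1) * Im (g z.2) - Im (g z.1) * Re (g z.2).
Let F (c : R -> R) (x : X) (z : X * X) :=
  kap x z.1 * kap x z.2 * c (k * (rho x z.1 - rho x z.2)).

Let A_le z : `|A z| <= B ^+ 2.
Proof.
apply: (@le_trans _ _ (cabs (g z.1) * cabs (g z.2))); last first.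
  by rewrite expr2 ler_pM ?cabs_ge0.
rewrite /A (le_trans (ler_normD _ _))// !normrM /cabs mulrDl !mulrDr.
have := mulr_ge0 (normr_ge0 (Re (g z.1))) (normr_ge0 (Im (g z.2))).
have := mulr_ge0 (normr_ge0 (Im (g z.1))) (normr_ge0 (Re (g z.2))).
lra.
Qed.

Let A'_le z : `|A' z| <= B ^+ 2.
Proof.
apply: (@le_trans _ _ (cabs (g z.1) * cabs (g z.2))); last first.
  by rewrite expr2 ler_pM ?cabs_ge0.
rewrite /A' (le_trans (ler_normB _ _))// !normrM /cabs mulrDl !mulrDr.
have := mulr_ge0 (normr_ge0 (Re (g z.1))) (normr_ge0 (Re (g z.2))).
have := mulr_ge0 (normr_ge0 (Im (g z.1))) (normr_ge0 (Im (g z.2))).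
lra.
Qed.

Let mA : measurable_fun setT A.
Proof.
have [g1 g2] := mg; apply: measurable_funD; apply: measurable_funM;
  [exact: (measurable_comp_fst g1)|exact: (measurable_comp_snd g1)|exact: (measurable_comp_fst g2)|exact: (measurable_comp_snd g2)].
Qed.

Let mA' : measurable_fun setT A'.
Proof.
have [g1 g2] := mg; apply: measurable_funB; apply: measurable_funM;
  [exact: (measurable_comp_fst g1)|exact: (measurable_comp_snd g2)|exact: (measurable_comp_fst g2)|exact: (measurable_comp_snd g1)].
Qed.

(** The squared modulus of an integral is a double integral; the real part of
    exp(i k (rho(x,y) - rho(x,y'))) g(y) times the conjugate of g(y') splits into
    a cosine and a sine term, with coefficients A and A'. *)
Lemma sqmod_cop x : sqmod (cop k g x) =
  \int[nu2]_z (F (@cos R) x z * A z + F (@sin R) x z * A' z).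
Proof.
have gs := sqinteg_bounded mg gB.
have [jr ji] := cinteg_cker_mul k x gs.
rewrite /sqmod /cop /= !expr2 -(Rint_tensor jr jr) -(Rint_tensor ji ji).
rewrite -RintegralD//; [|exact: (integ_tensor jr jr)|exact: (integ_tensor ji ji)].
apply: eq_Rintegral => z _; rewrite /F /A /A' !ReM !ImM /= [k * (_ - _)]mulrBr cosB sinB; ring.
Qed.

Let jF : integ (fprod nu nu2) (fun p => F (@cos R) p.1 p.2 * A p.2 + F (@sin R) p.1 p.2 * A' p.2).
Proof.
have h (c : R -> R) (a : X * X -> R) : continuous c -> (forall t, `|c t| <= 1) ->
    measurable_fun setT a -> (forall z, `|a z| <= B ^+ 2) ->
    integ (fprod nu nu2) (fun p => F c p.1 p.2 * a p.2).
  move=> cc c1 ma aB; apply: (integ_le _ _ (integrableZr measurableT (B ^+ 2) integ_kapM3)).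
    by apply: measurable_funM; [exact: measurable_corr_integrand|exact: (measurable_comp_snd ma)].
  move=> p /=; rewrite normrM ler_pM//.
  by rewrite /F !normrM !(ger0_norm (kap0 _ _)) ler_piMr ?mulr_ge0.
have jc := h _ _ (@continuous_cos R) (@cos_max R) mA A_le.
have js := h _ _ (@continuous_sin R) (@sin_max R) mA' A'_le.
exact: (integrableD measurableT jc js).
Qed.

Lemma integ_sqmod_cop : integ nu (fun x => sqmod (cop k g x)).
Proof.
rewrite (funext sqmod_cop); apply: (@integ_bounded _ _ _ _ _ ((B * (C + mass)) ^+ 2)).
  exact: (measurable_Rfubini1 jF).
move=> x; rewrite -sqmod_cop ger0_norm ?sqmod_ge0//.
have cB := cop_sup k mg gB x.
apply: (@le_trans _ _ (cabs (cop k g x) ^+ 2)).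
  rewrite /sqmod /cabs -(real_normK (num_real (Re _))) -(real_normK (num_real (Im _))).
  have := mulr_ge0 (normr_ge0 (Re (cop k g x))) (normr_ge0 (Im (cop k g x))).
  rewrite sqrrD; lra.
by rewrite ler_pXn2r// nnegrE ?cabs_ge0// (le_trans (cabs_ge0 _) cB).
Qed.

(** Integrating the double integral in x first leaves the correlations, tested
    against coefficients of size at most B^2. *)
Lemma Rint_sqmod_cop_le : \int[nu]_x sqmod (cop k g x) <=
  B ^+ 2 * \int[nu2]_z (`|corr (@cos R) k z| + `|corr (@sin R) k z|).
Proof.
have jcs : integ nu2 (fun z => `|corr (@cos R) k z| + `|corr (@sin R) k z|).
  apply: (@integ_bounded _ _ _ _ _ (C + C)).
    by apply: measurable_funD; exact: measurableT_comp.
  by move=> z; rewrite ger0_norm ?addr_ge0// lerD.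
have inner z : \int[nu]_x (F (@cos R) x z * A z + F (@sin R) x z * A' z) =
    corr (@cos R) k z * A z + corr (@sin R) k z * A' z.
  have jc c : continuous c -> (forall t, `|c t| <= 1) -> integ nu (fun x => F c x z).
    move=> cc c1; apply: (integ_le _ _ (integ_kapM z.1 z.2)).
      have mF : measurable_fun setT (fun p : X * (X * X) => F c p.1 p.2).
        exact: measurable_corr_integrand.
      exact: (measurable_sectionl z mF).
    by move=> x; rewrite /F !normrM !(ger0_norm (kap0 _ _)) ler_piMr ?mulr_ge0.
  have j1 := jc _ (@continuous_cos R) (@cos_max R).
  have j2 := jc _ (@continuous_sin R) (@sin_max R).
  rewrite RintegralD//; [|exact: (integrableZr measurableT (A z) j1)|exact: (integrableZr measurableT (A' z) j2)].
  by rewrite !RintegralZr.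
have le z : `|corr (@cos R) k z * A z + corr (@sin R) k z * A' z| <=
    B ^+ 2 * (`|corr (@cos R) k z| + `|corr (@sin R) k z|).
  rewrite (le_trans (ler_normD _ _))// !normrM mulrDr.
  by rewrite lerD// mulrC ler_wpM2r.
have mm : measurable_fun setT (fun z => corr (@cos R) k z * A z + corr (@sin R) k z * A' z).
  by rewrite -(funext inner); exact: (measurable_Rfubini2 jF).
have jB := integrableZl measurableT (B ^+ 2) jcs.
under eq_Rintegral do rewrite sqmod_cop.
rewrite (Rfubini jF) /= -RintegralZl//.
apply: (@le_trans _ _ (\int[nu2]_z (corr (@cos R) k z * A z + corr (@sin R) k z * A' z))).
  rewrite le_eqVlt; apply/predU1P; left; apply: eq_Rintegral => z _; exact: inner.
apply: (le_trans (ler_norm _)); exact: (abs_Rint_le mm le jB).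
Qed.

End quadratic_form.

(** The threshold on the energy under which the operator has size s from bounded
    functions to square integrable ones; see Rint_sqmod_cop_small. *)
Definition energy_bound (s : R) : R := (s ^+ 2 / (mass ^+ 2 + 1)) ^+ 2.

Lemma energy_bound_gt0 s : 0 < s -> 0 < energy_bound s.
Proof.
by move=> s0; rewrite exprn_gt0// divr_gt0 ?exprn_gt0// ltr_wpDl ?sqr_ge0.
Qed.

(** The Cauchy-Schwarz inequality, in the additive form
    |t| <= eta / 2 + t^2 / (2 eta). *)
Lemma Rint_abs_corr_le k s : 0 < s -> energy k <= energy_bound s ->
  \int[nu2]_z (`|corr (@cos R) k z| + `|corr (@sin R) k z|) <= s ^+ 2.
Proof.
move=> s0 Es; set eta := s ^+ 2 / (mass ^+ 2 + 1).
have m0 : 0 < mass ^+ 2 + 1 by rewrite ltr_wpDl ?sqr_ge0.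
have e0 : 0 < eta by rewrite divr_gt0 ?exprn_gt0.
have jq := integ_corr_sq k.
pose h z := eta * 1 + (corr (@cos R) k z ^+ 2 + corr (@sin R) k z ^+ 2) / (2 * eta).
have jh1 : integ nu2 (fun=> eta * 1) by exact: integ_cst.
have jh2 := integrableZr measurableT (2 * eta)^-1 jq.
have jh : integ nu2 h := integrableD measurableT jh1 jh2.
have am (t : R) : `|t| <= eta / 2 + t ^+ 2 / (2 * eta).
  rewrite -(real_normK (num_real t)) -subr_ge0.
  rewrite [leRHS](_ : _ = (eta - `|t|) ^+ 2 / (2 * eta)); last by field; rewrite gt_eqF.
  by rewrite divr_ge0 ?sqr_ge0// mulr_ge0// ltW.
have hle z : `|(`|corr (@cos R) k z| + `|corr (@sin R) k z|)| <= h z.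
  rewrite ger0_norm ?addr_ge0// /h mulrDl.
  have := am (corr (@cos R) k z); have := am (corr (@sin R) k z); lra.
have mcs : measurable_fun setT (fun z => `|corr (@cos R) k z| + `|corr (@sin R) k z|).
  by apply: measurable_funD; exact: measurableT_comp.
apply: (le_trans (ler_norm _)); apply: (le_trans (abs_Rint_le mcs hle jh)).
rewrite /h RintegralD// RintegralZr// -/(energy k).
have -> : \int[nu2]_z (eta * 1) = eta * mass ^+ 2.
  rewrite RintegralZl//; last exact: integ_cst.
  rewrite expr2 -(Rint_tensor (integ_cst nu 1) (integ_cst nu 1)).
  by congr (_ * _); apply: eq_Rintegral => z _; rewrite mulr1.
have : energy k / (2 * eta) <= eta.
  have h2 : energy k <= eta * (2 * eta).
    apply: (le_trans Es); rewrite /energy_bound -/eta expr2.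
    have := mulr_gt0 e0 e0; lra.
  have e2 : 0 < 2 * eta by lra.
  by rewrite (ler_pdivrMr _ _ e2).
have -> : s ^+ 2 = eta * mass ^+ 2 + eta by rewrite /eta; field; rewrite gt_eqF.
lra.
Qed.

Section small_energy.
Variables (k s : R).
Hypotheses (s0 : 0 < s) (Es : energy k <= energy_bound s).
Variables (g : X -> R[i]) (B : R).
Hypotheses (B0 : 0 < B) (mg : cmeas g) (gB : forall x, cabs (g x) <= B).

Lemma Rint_sqmod_cop_small : \int[nu]_x sqmod (cop k g x) <= (B * s) ^+ 2.
Proof.
apply: (le_trans (Rint_sqmod_cop_le k mg gB)).
by rewrite exprMn ler_wpM2l ?sqr_ge0// Rint_abs_corr_le.
Qed.

Let Bs0 : 0 < B * s. Proof. exact: mulr_gt0. Qed.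

Let young (a c q : R) : c ^+ 2 <= 2 * q -> 2 * a * c <= (B * s) * a ^+ 2 + 2 / (B * s) * q.
Proof.
move=> cq; set e := B * s.
have e0 : 0 < e := Bs0.
(* weighted arithmetic-geometric mean: the weight e = B s balances c^2,
   of size (B s)^2, against a^2, of size 1 *)
have h1 : 0 <= (e * a - c) ^+ 2 / e by rewrite divr_ge0 ?sqr_ge0 ?ltW.
have E : (e * a - c) ^+ 2 / e = e * a ^+ 2 - 2 * a * c + c ^+ 2 / e.
  by field; rewrite gt_eqF.
have h2 : c ^+ 2 / e <= 2 * q / e by rewrite ler_pM2r ?invr_gt0.
rewrite E in h1; rewrite mulrAC; lra.
Qed.

(** A single application of the operator is small only in the mean square; a
    second one converts this into a supremum bound, because the rows of the
    amplitude are uniformly square integrable. *)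
Lemma cop_cop_small (V : X -> R) (M : R) : measurable_fun setT V ->
  (forall x, `|V x| <= M) ->
  forall x, cabs (cop k (fun y => (V y)%:C * cop k g y) x) <= M * (B * s * (C + 2)).
Proof.
move=> mV VM x; have M0 : 0 <= M := le_trans (normr_ge0 _) (VM x).
have gs := sqinteg_bounded mg gB; have mc := cmeas_cop k gs.
have js := integ_sqmod_cop k mg gB.
have j1 := integrableZl measurableT (B * s) (integ_kap2 x).
have j2 := integrableZl measurableT (2 / (B * s)) js.
have jF := integrableZl measurableT M (integrableD measurableT j1 j2).
have mVc : cmeas (fun y => (V y)%:C * cop k g y) by apply: cmeasM => //; exact: cmeasR.
apply: (le_trans (cabs_Cint (cmeas_cker_mul k x mVc)
  (F := fun y => M * ((B * s) * kap x y ^+ 2 + 2 / (B * s) * sqmod (cop k g y))) _ jF)).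
  move=> y; apply: (le_trans (cabsM _ _)); rewrite cabsZ.
  apply: (@le_trans _ _ (2 * kap x y * (M * cabs (cop k g y)))).
    by apply: ler_pM; rewrite ?mulr_ge0 ?cabs_ge0 ?cabs_cker// ler_wpM2r ?cabs_ge0.
  rewrite mulrCA ler_wpM2l//; exact/young/sqr_cabs_le.
rewrite (RintegralZl _ measurableT (integrableD measurableT j1 j2)) ler_wpM2l//.
rewrite (RintegralD measurableT j1 j2) (RintegralZl _ measurableT (integ_kap2 x)).
rewrite (RintegralZl _ measurableT js) mulrDr lerD//.
  by rewrite ler_wpM2l ?(ltW Bs0)// Rint_kap2.
apply: (@le_trans _ _ (2 / (B * s) * (B * s) ^+ 2)).
  by rewrite ler_wpM2l ?divr_ge0 ?(ltW Bs0)//; exact: Rint_sqmod_cop_small.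
by rewrite le_eqVlt; apply/predU1P; left; field; rewrite !gt_eqF.
Qed.

Lemma Rint_cabs_cop_small : \int[nu]_x cabs (cop k g x) <= B * s * (mass + 1).
Proof.
have gs := sqinteg_bounded mg gB; have mc := cmeas_cop k gs.
have js := integ_sqmod_cop k mg gB.
have j1 : integ nu (fun=> B * s * 1 ^+ 2) by exact: integ_cst.
have j2 := integrableZl measurableT (2 / (B * s)) js.
have j3 := integrableZr measurableT 2^-1 (integrableD measurableT j1 j2).
apply: (@le_trans _ _ (\int[nu]_x ((B * s * 1 ^+ 2 + 2 / (B * s) * sqmod (cop k g x)) / 2))).
  apply: le_Rintegral => //.
    apply: (integ_le _ _ j3) => [|x /=]; first exact: measurable_cabs.
    rewrite ger0_norm ?cabs_ge0//.
    have := young 1 (sqr_cabs_le (cop k g x)); lra.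
  by move=> x _; have := young 1 (sqr_cabs_le (cop k g x)); lra.
rewrite (RintegralZr _ measurableT (integrableD measurableT j1 j2)).
rewrite (RintegralD measurableT j1 j2) (RintegralZl _ measurableT js).
have -> : \int[nu]_x (B * s * 1 ^+ 2) = B * s * mass.
  rewrite -RintegralZl//; last exact: integ_cst.
  by apply: eq_Rintegral => x _; rewrite expr1n.
have : 2 / (B * s) * \int[nu]_x sqmod (cop k g x) <= 2 / (B * s) * (B * s) ^+ 2.
  by rewrite ler_wpM2l ?divr_ge0 ?(ltW Bs0)//; exact: Rint_sqmod_cop_small.
rewrite [leRHS](_ : _ = 2 * (B * s)); last by field; rewrite !gt_eqF.
have := mulr_ge0 (ltW Bs0) mass_ge0; rewrite mulrDr mulr1; lra.
Qed.

End small_energy.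

Section fixed_point.
Variables (k s : R) (V : X -> R) (M : R).
Hypotheses (s0 : 0 < s) (Es : energy k <= energy_bound s).
Hypotheses (mV : measurable_fun setT V) (VM : forall x, `|V x| <= M) (M0 : 0 <= M).
Hypothesis sM : M * (M * (s * (C + 2))) <= 2^-1.

Definition vop (g : X -> R[i]) (x : X) : R[i] := (V x)%:C * cop k g x.

Let c1 := M * (C + mass).

Let c1_ge0 : 0 <= c1.
Proof. by rewrite mulr_ge0 ?addr_ge0 ?mass_ge0. Qed.

Definition cbdd (g : X -> R[i]) := exists B, forall x, cabs (g x) <= B.

Lemma cmeas_vop g : cmeas g -> cbdd g -> cmeas (vop g).
Proof.
move=> mg [B gB]; apply: cmeasM; first exact: cmeasR.
exact/cmeas_cop/(sqinteg_bounded mg gB).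
Qed.

Lemma vop_sup g B : cmeas g -> (forall x, cabs (g x) <= B) ->
  forall x, cabs (vop g x) <= B * c1.
Proof.
move=> mg gB x; rewrite cabsZ mulrCA; apply: ler_pM; rewrite ?cabs_ge0//.
exact: cop_sup.
Qed.

Lemma cbdd_vop g : cmeas g -> cbdd g -> cbdd (vop g).
Proof. by move=> mg [B gB]; exists (B * c1); exact: vop_sup. Qed.

(** For V bounded by M and s small, the square of V R_k contracts by 1/2, even
    though V R_k itself is only bounded. *)
Lemma vop_vop_half g B : 0 < B -> cmeas g -> (forall x, cabs (g x) <= B) ->
  forall x, cabs (vop (vop g) x) <= B / 2.
Proof.
move=> B0 mg gB x; rewrite cabsZ.
apply: (@le_trans _ _ (M * (M * (B * s * (C + 2))))).
  by apply: ler_pM; rewrite ?cabs_ge0//; exact: (cop_cop_small s0 Es B0 mg gB mV VM).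
rewrite (_ : M * _ = B * (M * (M * (s * (C + 2))))); last by ring.
by rewrite ler_wpM2l// ltW.
Qed.

Lemma vopD g h : cmeas g -> cbdd g -> cmeas h -> cbdd h ->
  forall x, vop (fun y => g y + h y) x = vop g x + vop h x.
Proof.
move=> mg [B gB] mh [B' hB'] x; rewrite /vop -mulrDr; congr (_ * _).
rewrite /cop -CintD.
- by congr Cint; apply/funext => y; rewrite mulrDr.
- exact/cinteg_cker_mul/(sqinteg_bounded mg gB).
- exact/cinteg_cker_mul/(sqinteg_bounded mh hB').
Qed.

Lemma cbddD g h : cbdd g -> cbdd h -> cbdd (fun x => g x + h x).
Proof.
move=> [B gB] [B' hB']; exists (B + B') => x.
by apply: (le_trans (cabsD _ _)); rewrite lerD.
Qed.

(** Iterating the equation once gives g = h + V R_k h + (V R_k)^2 g, and the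
    last term has at most half the size of g. Hence a bound for g in terms of h
    only, whatever bound was known before. *)
Lemma fixed_point_bound g h H : 0 < H -> cmeas h -> (forall x, cabs (h x) <= H) ->
  cmeas g -> cbdd g -> (forall x, g x = h x + vop g x) ->
  forall x, cabs (g x) <= 2 * (H * (1 + c1)).
Proof.
move=> H0 mh hH mg [B gB] gE.
have E x : g x = h x + (vop h x + vop (vop g) x).
  rewrite {1}gE; congr (_ + _); rewrite -vopD//.
  - by congr vop; apply/funext => y; rewrite -gE.
  - by exists H.
  - by apply: cmeas_vop => //; exists B.
  - by apply: cbdd_vop => //; exists B.
set H' := H * (1 + c1).
have H'0 : 0 < H' by rewrite mulr_gt0// ltr_pwDl.
have half B' : 0 < B' -> (forall x, cabs (g x) <= B') -> forall x, cabs (g x) <= H' + B' / 2.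
  move=> B'0 gB' x; rewrite E; apply: (le_trans (cabsD _ _)).
  have h1 := cabsD (vop h x) (vop (vop g) x).
  have h2 := vop_sup mh hH x; have h3 := vop_vop_half B'0 mg gB' x.
  have h4 := hH x; rewrite /H' mulrDr; lra.
(* each round halves the excess over 2 H' *)
have it n : forall x, cabs (g x) <= 2 * H' + `|B| * 2^-1 ^+ n.
  elim: n => [|n IH] x.
    by rewrite expr0 mulr1; have := gB x; have := ler_norm B; lra.
  have b0 : 0 < 2 * H' + `|B| * 2^-1 ^+ n.
    have : 0 <= `|B| * 2^-1 ^+ n by rewrite mulr_ge0 ?exprn_ge0 ?invr_ge0.
    lra.
  apply: (le_trans (half _ b0 IH x)); rewrite exprSr.
  by rewrite le_eqVlt; apply/predU1P; left; field.
move=> x; have cv : (fun n => 2 * H' + `|B| * 2^-1 ^+ n) @ \oo --> 2 * H' + `|B| * 0.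
  apply: cvgD; first exact: cvg_cst.
  by apply: cvgMr; apply: cvg_expr; rewrite ger0_norm// invf_lt1// ltr1n.
rewrite mulr0 addr0 in cv.
rewrite -(cvg_lim _ cv)//; apply: limr_ge; first by apply/cvg_ex; eexists; exact: cv.
by apply: nearW => n; exact: it.
Qed.

(** The error g - h = V R_k g is small in mean, since g is bounded
    independently of k and R_k is small from bounded functions to integrable
    ones. *)
Lemma born_error g h H : 0 < H -> cmeas h -> (forall x, cabs (h x) <= H) ->
  cmeas g -> cbdd g -> (forall x, g x = h x + vop g x) ->
  \int[nu]_x cabs (g x - h x) <= M * (2 * (H * (1 + c1)) * s * (mass + 1)).
Proof.
move=> H0 mh hH mg bg gE; have gB := fixed_point_bound H0 mh hH mg bg gE.
have B0 : 0 < 2 * (H * (1 + c1)) by rewrite !mulr_gt0// ltr_pwDl.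
have [B gB'] := bg; have mc := cmeas_cop k (sqinteg_bounded mg gB').
have jc : integ nu (fun x => cabs (cop k g x)).
  apply: (@integ_bounded _ _ _ _ _ (B * (C + mass)) (measurable_cabs mc)) => x.
  by rewrite ger0_norm ?cabs_ge0//; exact: (cop_sup _ mg gB').
apply: (@le_trans _ _ (\int[nu]_x (M * cabs (cop k g x)))); last first.
  by rewrite RintegralZl// ler_wpM2l//; exact: Rint_cabs_cop_small.
apply: (le_trans (ler_norm _)).
apply: abs_Rint_le; last exact: (integrableZl measurableT M jc).
  by apply: measurable_cabs; apply: cmeasD => //; exact: cmeasN.
move=> x; rewrite ger0_norm ?cabs_ge0// {1}gE addrAC subrr add0r cabsZ.
by rewrite ler_wpM2r ?cabs_ge0.
Qed.

Section neumann_series.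
Variables (h : X -> R[i]) (H : R).
Hypotheses (H0 : 0 < H) (mh : cmeas h) (hH : forall x, cabs (h x) <= H).

Let term n := iter n vop h.
Let psum n := iter n (fun g x => h x + vop g x) (fun=> 0).

Let term_reg n : cmeas (term n) /\ cbdd (term n).
Proof.
elim: n => [|n [IH1 IH2]]; first by split => //; exists H.
by split; [exact: cmeas_vop|exact: cbdd_vop].
Qed.

Let psum_reg n : cmeas (psum n) /\ cbdd (psum n).
Proof.
elim: n => [|n [IH1 IH2]].
  by split; [split; exact: measurable_cst|exists 0 => x; rewrite cabs0].
split; first by apply: cmeasD => //; exact: cmeas_vop.
by apply: cbddD; [exists H|exact: cbdd_vop].
Qed.

Let psumS n x : psum n.+1 x = psum n x + term n x.
Proof.
elim: n x => [|n IH] x.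
  rewrite /psum /term /= /vop /cop add0r.
  suff -> : Cint nu (fun y => cker k x y * 0) = 0 by rewrite mulr0 addr0.
  have -> : (fun y => cker k x y * 0) = fun=> 0 by apply/funext => y; rewrite mulr0.
  by apply: complex_eqP; rewrite /= Rintegral_cst// mul0r.
have [m1 b1] := psum_reg n; have [m2 b2] := term_reg n.
have e : psum n.+1 = (fun y => psum n y + term n y) by exact/funext.
transitivity (h x + vop (psum n.+1) x) => //.
by rewrite [in LHS]e vopD// addrA.
Qed.

Let K := H * (1 + c1) * (4 / 3).

Let K0 : 0 < K.
Proof. by rewrite !mulr_gt0// ltr_pwDl. Qed.

Let term_le n x : cabs (term n x) <= K * (3 / 4) ^+ n.
Proof.
suff E : (forall x, cabs (term n x) <= K * (3 / 4) ^+ n) /\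
         (forall x, cabs (term n.+1 x) <= K * (3 / 4) ^+ n.+1) by exact: E.1.
(* two steps contract by 1/2 <= (3/4)^2, so the induction runs on two
   consecutive terms; K makes both base cases hold *)
elim: n {x} => [|n [IH1 IH2]].
  have c1H := mulr_ge0 (ltW H0) c1_ge0.
  have KE : K = (H + H * c1) * (4 / 3) by rewrite /K mulrDr mulr1.
  have H0' := H0.
  split=> x; rewrite KE ?expr0 ?expr1; have c := c1H.
    by apply: le_trans (hH x) _; move: (H * c1) c => t; lra.
  by apply: le_trans (vop_sup mh hH x) _; move: (H * c1) c => t; lra.
split => // x; have [m1 _] := term_reg n.
have q0 : 0 < K * (3 / 4) ^+ n by rewrite mulr_gt0// exprn_gt0.
apply: (le_trans (vop_vop_half q0 m1 IH1 x)); rewrite !exprS; lra.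
Qed.

Let psum_le n x : cabs (psum n x) <= 4 * K * (1 - (3 / 4) ^+ n).
Proof.
elim: n => [|n IH]; first by rewrite cabs0 expr0 subrr mulr0.
rewrite psumS; apply: (le_trans (cabsD _ _)).
by have := term_le n x; rewrite exprS; lra.
Qed.

Let psum_bdd n x : cabs (psum n x) <= 4 * K.
Proof.
apply: (le_trans (psum_le n x)); have : 0 <= K * (3 / 4) ^+ n.
  by rewrite mulr_ge0 ?ltW// exprn_gt0.
lra.
Qed.

Let cvg_part (part : R[i] -> R) :
  (forall z, `|part z| <= cabs z) -> (forall z w, part (z + w) = part z + part w) ->
  part 0 = 0 -> forall x, cvgn (fun n => part (psum n x)).
Proof.
move=> pb pD p0 x.
have -> : (fun n => part (psum n x)) = series (fun i => part (term i x)).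
  apply/funext; elim=> [|n IH]; first by rewrite /series/= big_geq.
  by rewrite psumS pD IH seriesSr.
apply: normed_cvg; apply: (@series_le_cvg _ _ (geometric K (3 / 4))).
- by move=> n /=; rewrite normr_ge0.
- by move=> n /=; rewrite mulr_ge0 ?ltW// exprn_gt0.
- by move=> n /=; exact: le_trans (pb _) (term_le n x).
- apply: is_cvg_geometric_series; rewrite ger0_norm; lra.
Qed.

(** The Neumann series converges uniformly, its terms decaying like (3/4)^n, and
    the limit passes under the integral sign by dominated convergence. *)
Lemma neumann_solution :
  exists2 g, cmeas g /\ cbdd g & forall x, g x = h x + vop g x.
Proof.
have cR := cvg_part (@normRe_le R) (@ReD R) erefl.
have cI := cvg_part (@normIm_le R) (@ImD R) erefl.
pose g x := limn (fun n => Re (psum n x)) +i* limn (fun n => Im (psum n x)).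
have gR x : (fun n => Re (psum n x)) @ \oo --> Re (g x) by exact: cR.
have gI x : (fun n => Im (psum n x)) @ \oo --> Im (g x) by exact: cI.
have mg : cmeas g.
  split.
    apply: (measurable_fun_cvg (h := fun n x => Re (psum n x))) => [n|x _].
      by have [[]] := psum_reg n.
    exact: gR.
  apply: (measurable_fun_cvg (h := fun n x => Im (psum n x))) => [n|x _].
    by have [[]] := psum_reg n.
  exact: gI.
have bg : cbdd g.
  exists (4 * K + 4 * K) => x; apply: lerD.
    have cn : (fun n => `|Re (psum n x)|) @ \oo --> `|Re (g x)| by apply: cvg_norm; exact: gR.
  rewrite -(cvg_lim _ cn)//.
    apply: limr_le; first by apply/cvg_ex; eexists; exact: cn.
    by apply: nearW => n; exact: le_trans (normRe_le _) (psum_bdd n x).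
  have cn : (fun n => `|Im (psum n x)|) @ \oo --> `|Im (g x)| by apply: cvg_norm; exact: gI.
  rewrite -(cvg_lim _ cn)//.
  apply: limr_le; first by apply/cvg_ex; eexists; exact: cn.
  by apply: nearW => n; exact: le_trans (normIm_le _) (psum_bdd n x).
exists g => // x.
have jF : integ nu (fun y => kap x y ^+ 2 + (4 * K) ^+ 2).
  exact: (integrableD measurableT (integ_kap2 x) (integ_cst nu _)).
have dom n y : cabs (cker k x y * psum n y) <= kap x y ^+ 2 + (4 * K) ^+ 2.
  apply: (le_trans (cabs_cker_mul _ _ _ _)); rewrite lerD2l.
  by rewrite ler_pXn2r ?nnegrE ?cabs_ge0// (le_trans (cabs_ge0 _) (psum_bdd n y)).
have [mgR mgI] := cmeas_cker_mul k x mg.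
have mp n := cmeas_cker_mul k x (psum_reg n).1.
have copR : (fun n => Re (cop k (psum n) x)) @ \oo --> Re (cop k g x).
  apply: (Rint_dct _ mgR _ jF) => [n|| n y]; first by have [] := mp n.
    apply: nearW => y; rewrite ReM; under eq_fun do rewrite ReM.
    by apply: cvgB; apply: cvgMr; [exact: gR|exact: gI].
  exact: le_trans (normRe_le _) (dom n y).
have copI : (fun n => Im (cop k (psum n) x)) @ \oo --> Im (cop k g x).
  apply: (Rint_dct _ mgI _ jF) => [n|| n y]; first by have [] := mp n.
    apply: nearW => y; rewrite ImM; under eq_fun do rewrite ImM.
    by apply: cvgD; apply: cvgMr; [exact: gI|exact: gR].
  exact: le_trans (normIm_le _) (dom n y).
apply: complex_eqP.
  rewrite ReD /vop ReZ; apply: (@cvg_unique _ (@Rhausdorff R) ((fun n => Re (psum n.+1 x)) @ \oo)).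
    by have := gR x; rewrite -(cvg_shiftS (fun n => Re (psum n x))).
  rewrite /psum /=; under eq_fun do rewrite ReD ReZ.
  by apply: cvgD; [exact: cvg_cst|apply: cvgMr].
rewrite ImD /vop ImZ; apply: (@cvg_unique _ (@Rhausdorff R) ((fun n => Im (psum n.+1 x)) @ \oo)).
  by have := gI x; rewrite -(cvg_shiftS (fun n => Im (psum n x))).
rewrite /psum /=; under eq_fun do rewrite ImD ImZ.
by apply: cvgD; [exact: cvg_cst|apply: cvgMr].
Qed.

End neumann_series.

End fixed_point.

End oscillatory_operator.

(** * Restriction of a measure to a region *)

Section open_boxes.
Variable R : realType.

Lemma nbhs_rat_itv (x : R) (A : set R) : nbhs x A ->
  exists a b : rat, `]ratr a, ratr b[%classic x /\ `]ratr a, ratr b[%classic `<=` A.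
Proof.
move=> /nbhs_ballP[e /= e0 eA].
have /rat_in_itvoo[a] : x - e < x by rewrite gtrBl.
have /rat_in_itvoo[b] : x < x + e by rewrite ltrDl.
rewrite !in_itv/= => /andP[xb bx] /andP[xa ax].
exists a, b; split; first by rewrite /= in_itv/= ax xb.
move=> y; rewrite /= in_itv/= => /andP[ay yb]; apply: eA.
rewrite /ball/= ltr_norml; apply/andP; split; lra.
Qed.

Definition rat_box (q : (rat * rat) * (rat * rat) * (rat * rat)) : set (mR3 R) :=
  (`]ratr q.1.1.1, ratr q.1.1.2[%classic `*` `]ratr q.1.2.1, ratr q.1.2.2[%classic) `*`
  `]ratr q.2.1, ratr q.2.2[%classic.

Lemma measurable_rat_box q : measurable (rat_box q).
Proof.
by apply: measurableX; [apply: measurableX|]; exact: measurable_itv.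
Qed.

(** An open set is the union of the boxes with rational vertices that it
    contains. *)
Lemma open_measurable_R3 (D : set (R3 R)) : open D -> measurable (D : set (mR3 R)).
Proof.
move=> oD; pose Q := [set q | rat_box q `<=` D].
have -> : D = \bigcup_(q in Q) rat_box q.
  apply/seteqP; split=> [[[x1 x2] x3] Dx|x [q qD]]; last exact: qD.
  have : nbhs (x1, x2, x3) D by exact: open_nbhs_nbhs.
  move=> [[U A3] /= [[[A1 A2] /= [n1 n2] UA] n3] AD].
  have [a1 [b1 [x1I I1]]] := nbhs_rat_itv n1.
  have [a2 [b2 [x2I I2]]] := nbhs_rat_itv n2.
  have [a3 [b3 [x3I I3]]] := nbhs_rat_itv n3.
  exists ((a1, b1), (a2, b2), (a3, b3)) => //.
  move=> [[y1 y2] y3] [[/= /I1 h1 /I2 h2] /I3 h3].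
  by apply: AD; split => //; apply: UA.
rewrite bigcup_mkcond; apply: countable_bigcupT_measurable => // q.
by case: ifP => _ //; exact: measurable_rat_box.
Qed.

End open_boxes.

Section restricted_measure.
Context d (T : measurableType d) (R : realType).
Variable mu : {measure set T -> \bar R}.
Variables (D : set T) (mD : measurable D) (Doo : (mu D < +oo)%E).

Let nu := mfrestr mD Doo.

Lemma mfrestr_le (A : set T) : measurable A -> (nu A <= mu A)%E.
Proof.
move=> mA; rewrite /nu /= /mfrestr /mrestr.
by apply: (@le_measure _ _ _ mu); rewrite ?inE//; exact: measurableI.
Qed.

Lemma mfrestr_ae (Q : T -> Prop) : {ae mu, forall x, D x -> Q x} -> {ae nu, forall x, Q x}.
Proof.
move=> [N [mN N0 sN]]; exists (N `|` ~` D); split.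
- by apply: measurableU => //; exact: measurableC.
- rewrite /nu /= /mfrestr /mrestr setIUl setICl setU0.
  by apply: (@subset_measure0 _ _ _ mu _ N) => //; exact: measurableI.
- move=> x /= nQ; have [Dx|nD] := pselect (D x); [left|by right].
  by apply: sN => /= /(_ Dx).
Qed.

Lemma integral_mfrestr (f : T -> \bar R) : measurable_fun setT f ->
  (\int[nu]_x f x = \int[mu]_(x in D) f x)%E.
Proof.
move=> mf.
transitivity (\int[nu]_(x in D) f x)%E; last first.
  by apply: eq_measure_integral => A mA AD; rewrite /= /mfrestr /mrestr setIidl.
rewrite [RHS]integral_mkcond; apply: ae_eq_integral => //.
  by apply/(measurable_restrictT _ mD); exact: measurable_funTS.
apply: mfrestr_ae; apply: nearW => x Dx _; rewrite patchE mem_set//.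
Qed.

Lemma Rintegral_mfrestr (f : T -> R) : measurable_fun setT f ->
  \int[nu]_x f x = \int[mu]_(x in D) f x.
Proof. by move=> mf; rewrite /Rintegral integral_mfrestr//; exact/measurable_EFinP. Qed.

Lemma ae_mfrestr_inv (Q : T -> Prop) : {ae nu, forall x, Q x} -> {ae mu, forall x, D x -> Q x}.
Proof.
move=> [N [mN N0 sN]]; exists (N `&` D); split.
- exact: measurableI.
- exact: N0.
- move=> x /= nQ; have Dx : D x by apply: contrapT => nD; apply: nQ => /nD.
  by split => //; apply: sN => /= Qx; exact: nQ.
Qed.

Lemma Rintegral_supported (f : T -> R) : measurable_fun setT f ->
  {ae mu, forall x, ~ D x -> f x = 0} -> \int[mu]_x f x = \int[nu]_x f x.
Proof.
move=> mf f0; rewrite Rintegral_mfrestr// [RHS]Rintegral_mkcond.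
apply: (@Rint_ae _ _ _ mu f (f \_ D)) => //.
  by apply/(measurable_restrictT _ mD); exact: measurable_funTS.
apply: filterS f0 => x h; rewrite patchE; case: ifPn => // /negP xD.
by apply: h => Dx; apply: xD; rewrite inE.
Qed.

Lemma integ_mfrestr (f : T -> R) : integ mu f -> integ nu f.
Proof.
move=> jf; have mf := measurable_int _ jf; apply/integrableP; split => //.
rewrite integral_mfrestr; last exact: measurableT_comp.
by have /integrableP[] := integrableS measurableT mD (@subsetT _ D) jf.
Qed.

Lemma Lfun_infty_bound (f : T -> R) : f \in Lfun mu +oo%E ->
  measurable_fun setT f /\ exists2 M, 0 <= M & {ae mu, forall x, `|f x| <= M}.
Proof.
rewrite inE => /andP[]; rewrite inE/= => mf; rewrite inE/= /finite_norm unlock => fo.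
(* on a null space the norm is 0 by convention, and every bound holds *)
split => //; case: ifPn fo => [mu0 fo|/negP mu0 _]; last first.
  exists 0 => //; exists setT; split => //; apply/eqP; rewrite eq_le measure_ge0 andbT.
  by rewrite leNgt; apply/negP.
have h := ess_sup_ge mu (abse \o (EFin \o f)).
exists `|fine (ess_sup mu (abse \o (EFin \o f)))| => //.
apply: filterS h => x /=; case: ess_sup fo => [a| |] //= _.
by rewrite lee_fin => /le_trans; apply; exact: ler_norm.
Qed.

(** The function is set to 0 outside D and where it exceeds its essential
    bound. *)
Lemma bounded_representative (f : T -> R) : f \in Lfun mu +oo%E ->
  {ae mu, forall x, ~ D x -> f x = 0} ->
  exists (f0 : T -> R) (M : R), [/\ measurable_fun setT f0, 0 <= M, forall x, `|f0 x| <= M,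
    forall x, ~ D x -> f0 x = 0 & {ae mu, forall x, f x = f0 x}].
Proof.
move=> /Lfun_infty_bound[mf [M M0 fM]] f0.
pose A := D `&` [set x | `|f x| <= M].
have mA : measurable A.
  apply: measurableI => //; rewrite -[X in measurable X]setTI.
  rewrite (_ : [set x | _] = (fun x => `|f x|) @^-1` `]-oo, M]%classic); last first.
    by apply/seteqP; split => x /=; rewrite in_itv.
  have mn : measurable_fun setT (fun x => `|f x|) by exact: measurableT_comp.
  exact: (mn measurableT _ (measurable_itv _)).
exists (f \_ A), M; split => //.
- by apply/(measurable_restrictT _ mA); exact: measurable_funTS.
- by move=> x; rewrite patchE; case: ifPn; rewrite ?normr0// inE => -[].
- by move=> x nD; rewrite patchE memNset// => -[].
- apply: filterS2 f0 fM => x h1 h2; rewrite patchE; case: ifPn => // /negP xA.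
  by apply: h1 => Dx; apply: xA; rewrite inE.
Qed.

Lemma Lfun2_bounded_supported (f : T -> R) (B : R) : measurable_fun setT f ->
  (forall x, `|f x| <= B) -> (forall x, ~ D x -> f x = 0) -> f \in Lfun mu 2%:E.
Proof.
move=> mf fB f0; rewrite inE; apply/andP; split; rewrite inE//=.
rewrite /finite_norm unlock /=; apply: poweR_lty.
have f2 x : 0 <= `|f x| `^ 2 by exact: powR_ge0.
apply: (@le_lt_trans _ _ (\int[mu]_x ((fun=> (`|B| ^+ 2)%:E) \_ D) x)%E).
  apply: ge0_le_integral => //.
  - apply/measurable_EFinP; apply: (measurableT_comp (measurable_powR _)).
    exact: measurableT_comp.
  - by apply/(measurable_restrictT _ mD); exact: measurable_cst.
  - move=> x _; rewrite patchE; case: ifPn => [_|/negP xD] /=.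
      rewrite lee_fin powR_mulrn// ler_pXn2r// ?nnegrE//.
      exact: le_trans (fB x) (ler_norm _).
    rewrite f0; last by move=> Dx; apply: xD; rewrite inE.
    by rewrite normr0 powR0.
rewrite -integral_mkcond integral_cst// lte_mul_pinfty// ?lee_fin// sqr_ge0//.
Qed.

End restricted_measure.

(** * The modulus of the Green function *)

Section lebesgue_R3.
Variable R : realType.
Local Notation mu := (@leb3 R).
Local Notation lam := (@lebesgue_measure R).
Implicit Types x y : R3 R.

Lemma leb3_box (A B E : set R) : measurable A -> measurable B -> measurable E ->
  leb3 ((A `*` B) `*` E : set (mR3 R)) = (lam A * lam B * lam E)%E.
Proof.
move=> mA mB mE; rewrite /leb3 product_measure1E//; last exact: measurableX.
by congr (_ * _)%E; exact: product_measure1E.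
Qed.

Definition cube (c : R3 R) (r : R) : set (mR3 R) :=
  (`[c.1.1 - r, c.1.1 + r]%classic `*` `[c.1.2 - r, c.1.2 + r]%classic) `*`
  `[c.2 - r, c.2 + r]%classic.

Lemma cubeP c r y : cube c r y <->
  [/\ `|y.1.1 - c.1.1| <= r, `|y.1.2 - c.1.2| <= r & `|y.2 - c.2| <= r].
Proof.
have E (a b : R) : (b \in `[a - r, a + r]) = (`|b - a| <= r).
  by rewrite in_itv/= ler_distl.
rewrite /cube /setX/= !E; split; first by move=> [[? ?] ?].
by move=> [? ? ?].
Qed.

Lemma measurable_cube c r : measurable (cube c r).
Proof. by apply: measurableX; [apply: measurableX|]; exact: measurable_itv. Qed.

Lemma leb3_cube c r : 0 <= r -> mu (cube c r) = ((2 * r) ^+ 3)%:E.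
Proof.
move=> r0; rewrite leb3_box//.
have E (a : R) : lam `[a - r, a + r]%classic = (2 * r)%:E.
  rewrite lebesgue_measure_itv/= lte_fin.
  have [h|h] := ltP (a - r) (a + r).
    by rewrite -EFinB; congr EFin; lra.
  have -> : r = 0 by lra.
  by rewrite mulr0.
by rewrite !E -!EFinM !exprS expr0 mulr1 mulrA.
Qed.

Lemma bounded_sub_cube (D : set (R3 R)) : bounded_set D ->
  exists2 r, 0 <= r & D `<=` cube 0 r.
Proof.
move=> [M [_ HM]]; pose r := `|M| + 1.
have r0 : 0 <= r by rewrite addr_ge0.
exists r => // -[[x1 x2] x3] Dx.
have Mr : M < r by rewrite (le_lt_trans (ler_norm M))// ltrDl.
have := HM _ Mr _ Dx; rewrite /= prod_normE/= ge_max => /andP[].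
rewrite prod_normE/= ge_max => /andP[h1 h2] h3.
by apply/cubeP; rewrite /= !subr0.
Qed.

Lemma leb3_bounded_lty (D : set (R3 R)) : open D -> bounded_set D ->
  (mu (D : set (mR3 R)) < +oo)%E.
Proof.
move=> oD /bounded_sub_cube[r r0 Dr].
apply: (@le_lt_trans _ _ (mu (cube 0 r))).
  apply: le_measure => //; rewrite inE; first exact: open_measurable_R3.
  exact: measurable_cube.
by rewrite leb3_cube// ltry.
Qed.

Lemma dot_ge0 x : 0 <= dot x x.
Proof. by rewrite /dot !addr_ge0// -expr2 sqr_ge0. Qed.

Lemma sqr_enorm x : enorm x ^+ 2 = dot x x.
Proof. by rewrite sqr_sqrtr// dot_ge0. Qed.

Lemma enorm_ge0 x : 0 <= enorm x. Proof. exact: sqrtr_ge0. Qed.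

Lemma enormN x : enorm (- x) = enorm x.
Proof. by rewrite /enorm /dot /= !mulrNN. Qed.

Lemma enormBC x y : enorm (x - y) = enorm (y - x).
Proof. by rewrite -enormN opprB. Qed.

Definition green_amp (x y : R3 R) : R := (4 * pi * enorm (x - y))^-1.
Definition edist (x y : R3 R) : R := enorm (x - y).

Lemma measurable_coord1 : measurable_fun setT (fun x : mR3 R => x.1.1 : measurableTypeR R).
Proof. exact: (measurableT_comp measurable_fst measurable_fst). Qed.

Lemma measurable_coord2 : measurable_fun setT (fun x : mR3 R => x.1.2 : measurableTypeR R).
Proof. exact: (measurableT_comp measurable_snd measurable_fst). Qed.

Lemma measurable_coord3 : measurable_fun setT (fun x : mR3 R => x.2 : measurableTypeR R).
Proof. exact: measurable_snd. Qed.

Lemma measurable_enorm_comp d (T : measurableType d) (f1 f2 f3 : T -> R) :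
  measurable_fun setT f1 -> measurable_fun setT f2 -> measurable_fun setT f3 ->
  measurable_fun setT (fun t => enorm (f1 t, f2 t, f3 t)).
Proof.
move=> m1 m2 m3; rewrite /enorm /dot /=.
apply: (measurableT_comp (continuous_measurable_fun (@sqrt_continuous R))).
by apply: measurable_funD; [apply: measurable_funD|]; exact: measurable_funM.
Qed.

Lemma measurable_edist : measurable_fun setT (fun p : mR3 R * mR3 R => edist p.1 p.2).
Proof.
have h (f : mR3 R -> R) : measurable_fun setT f ->
    measurable_fun setT (fun p : mR3 R * mR3 R => f p.1 - f p.2).
  move=> mf; apply: measurable_funB.
    by apply: (measurableT_comp mf); exact: measurable_fst.
  by apply: (measurableT_comp mf); exact: measurable_snd.
exact: (measurable_enorm_comp (h _ measurable_coord1) (h _ measurable_coord2)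
  (h _ measurable_coord3)).
Qed.

Lemma measurable_green_amp : measurable_fun setT (fun p : mR3 R * mR3 R => green_amp p.1 p.2).
Proof.
have -> : (fun p : mR3 R * mR3 R => green_amp p.1 p.2) =
    (fun t => t `^ (-1)) \o (fun p => 4 * pi * edist p.1 p.2).
  by apply/funext => p /=; rewrite powR_inv1// !mulr_ge0 ?pi_ge0 ?enorm_ge0.
apply: measurableT_comp => //; apply: measurable_funM => //; exact: measurable_edist.
Qed.

Lemma green_amp_ge0 x y : 0 <= green_amp x y.
Proof. by rewrite invr_ge0 !mulr_ge0 ?pi_ge0 ?enorm_ge0. Qed.

Lemma green_ampC x y : green_amp x y = green_amp y x.
Proof. by rewrite /green_amp enormBC. Qed.

Lemma dyadic_scale (m : R) : 0 < m -> m <= 1 ->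
  exists n, 2^-1 ^+ n.+1 < m /\ m <= 2^-1 ^+ n.
Proof.
move=> m0 m1.
have ex : exists n, 2^-1 ^+ n < m.
  have : (fun n => 2^-1 ^+ n : R) @ \oo --> 0.
    by apply: cvg_expr; rewrite ger0_norm// invf_lt1// ltr1n.
  move=> /cvgrPdist_lt/(_ _ m0)[N _ HN]; exists N.
  have := HN N (leqnn N); rewrite /= sub0r normrN ger0_norm// exprn_ge0//.
have := ex_minnP ex => -[[|n] nm minn].
  by move: nm; rewrite expr0 ltNge m1.
exists n; split => //; rewrite leNgt; apply/negP => /minn; by rewrite ltnn.
Qed.

(** With m the distance of x and y in the supremum norm, the squared amplitude
    is at most 1 / m^2; it exceeds 1 only for 0 < m < 1, and then 2^-(n+1) < m <= 2^-n
    for some n, so that y lies in the cube of half side 2^-n about x. *)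
Lemma green_amp_sq_le x y : green_amp x y ^+ 2 <= 1 \/
  exists2 n, cube x (2^-1 ^+ n) y & green_amp x y ^+ 2 <= 4 ^+ n.+1.
Proof.
pose m := Num.max (Num.max `|y.1.1 - x.1.1| `|y.1.2 - x.1.2|) `|y.2 - x.2|.
have m0 : 0 <= m by rewrite /m !le_max normr_ge0.
have sq (a b : R) : 0 <= a -> 0 <= b -> a <= b -> a ^+ 2 <= b ^+ 2.
  by move=> a0 b0 ab; rewrite ler_pXn2r.
have md : m ^+ 2 <= dot (x - y) (x - y).
  have h1 := sqr_ge0 (x.1.1 - y.1.1); have h2 := sqr_ge0 (x.1.2 - y.1.2).
  have h3 := sqr_ge0 (x.2 - y.2); rewrite !expr2 in h1 h2 h3.
  rewrite /dot /=.
  have : [\/ m = `|y.1.1 - x.1.1|, m = `|y.1.2 - x.1.2| | m = `|y.2 - x.2|].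
    rewrite /m; case: (leP (Num.max _ _)) => _; first by constructor 3.
    by case: leP => _; [constructor 2|constructor 1].
  by case=> ->; rewrite real_normK ?num_real// expr2; lra.
have kd : green_amp x y ^+ 2 <= (enorm (x - y) ^+ 2)^-1.
  rewrite /green_amp invfM exprMn exprVn -[leRHS]mul1r exprVn.
  rewrite ler_wpM2r ?invr_ge0 ?sqr_ge0// invf_le1 ?exprn_gt0 ?mulr_gt0 ?pi_gt0//.
  by rewrite expr_ge1// ?mulr_ge0 ?pi_ge0//; have := pi_ge2 R; lra.
have [m00|m00] := eqVneq m 0.
  left; suff -> : green_amp x y = 0 by rewrite expr0n.
  have : [/\ `|y.1.1 - x.1.1| <= 0, `|y.1.2 - x.1.2| <= 0 & `|y.2 - x.2| <= 0].
    by move/eqP: m00; rewrite eq_le => /andP[]; rewrite /m !ge_max => /andP[/andP[]].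
  rewrite !normr_le0 !subr_eq0 => -[/eqP e1 /eqP e2 /eqP e3].
  (* at x = y the amplitude is the inverse of 0, that is 0 *)
  by rewrite /green_amp /enorm /dot /= e1 e2 e3 !subrr mulr0 !addr0 sqrtr0 mulr0 invr0.
have {m00}m_gt0 : 0 < m by rewrite lt_neqAle eq_sym m00.
have km : green_amp x y ^+ 2 <= (m ^+ 2)^-1.
  apply: (le_trans kd); rewrite sqr_enorm lef_pV2 ?posrE ?exprn_gt0//.
  by rewrite (lt_le_trans _ md)// exprn_gt0.
have [m1|/ltW m1] := leP m 1; last first.
  left; apply: (le_trans km); rewrite invf_le1 ?exprn_gt0//.
  by rewrite expr_ge1// ltW.
right; have [n [nm mn]] := dyadic_scale m_gt0 m1; exists n.
  by apply/cubeP; split; apply: le_trans mn; rewrite /m !le_max lexx ?orbT.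
apply: (le_trans km).
rewrite -[leRHS]invrK lef_pV2 ?posrE ?invr_gt0 ?exprn_gt0//.
have -> : (4 ^+ n.+1)^-1 = (2^-1 ^+ n.+1) ^+ 2 :> R.
  rewrite exprAC; have -> : 2^-1 ^+ 2 = 4^-1 :> R by rewrite exprVn -natrX.
  by rewrite exprVn.
by apply: sq; rewrite ?exprn_ge0 ?ltW.
Qed.

Section bounded_region.
Variable nu : {finite_measure set (mR3 R) -> \bar R}.
Hypothesis nu_le : forall A, measurable A -> (nu A <= mu A)%E.

(** The total mass accounts for the points where the amplitude is at most 1, and
    64 for the singularity. *)
Definition green_bound : R := fine (nu setT) + 64.

Lemma green_bound_ge0 : 0 <= green_bound.
Proof. by rewrite addr_ge0 ?fine_ge0. Qed.

(** The singularity 1 / |x - y|^2 is dominated by a sum over dyadic cubes about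
    x, whose volumes decay like 8^-n while the values grow like 4^n. Thus the
    integral is bounded independently of x. *)
Lemma green_amp_sq_integral x : (\int[nu]_y (green_amp x y ^+ 2)%:E <= green_bound%:E)%E.
Proof.
(* at the dyadic scale n the squared amplitude is at most 4^(n+1) *)
pose f n (y : mR3 R) : \bar R := (4 ^+ n.+1 * \1_(cube x (2^-1 ^+ n)) y)%:E.
have f0 n y : (0 <= f n y)%E by rewrite lee_fin mulr_ge0// exprn_ge0.
have mf n : measurable_fun setT (f n).
  apply/measurable_EFinP; apply: measurable_funM => //.
  apply: measurable_indic; exact: measurable_cube.
have pt y : ((green_amp x y ^+ 2)%:E <= 1 + \sum_(0 <= n <oo) f n y)%E.
  have s0 : (0 <= \sum_(0 <= n <oo) f n y)%E by apply: nneseries_ge0 => n _ _; exact: f0.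
  have [h|[n yn h]] := green_amp_sq_le x y.
    by rewrite (@le_trans _ _ 1%E) ?leeDl// lee_fin.
  rewrite (@le_trans _ _ (f n y))//.
    by rewrite lee_fin indicE mem_set// mulr1.
  apply: (@le_trans _ _ (\sum_(0 <= n <oo) f n y)%E); last by rewrite leeDr.
  apply: le_trans (nneseries_lim_ge n.+1 _); last by [].
  rewrite big_nat_recr//= leeDr//; exact: sume_ge0.
have mk : measurable_fun setT (fun y : mR3 R => (green_amp x y ^+ 2)%:E).
  apply/measurable_EFinP; apply: measurable_funX.
  apply: (measurableT_comp measurable_green_amp (g := fun y => (x, y))).
  by apply: measurable_fun_pair => //; exact: measurable_cst.
apply: (@le_trans _ _ (\int[nu]_y (1 + \sum_(0 <= n <oo) f n y))%E).
  apply: ge0_le_integral => //.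
  - by move=> y _; rewrite lee_fin sqr_ge0.
  - apply: emeasurable_funD => //; apply: ge0_emeasurable_sum => //.
rewrite ge0_integralD//; last 2 first.
- by move=> y _; apply: nneseries_ge0.
- by apply: ge0_emeasurable_sum.
rewrite integral_cst// mul1e /green_bound EFinD fineK ?fin_num_measure// leeD2l//.
rewrite integral_nneseries//.
apply: (@le_trans _ _ (\sum_(0 <= n <oo) (64 / (2 ^ (n + 1))%:R)%:E)%E).
  apply: lee_nneseries => [n _ _|n _]; first by apply: integral_ge0.
  have -> : (\int[nu]_y f n y = (4 ^+ n.+1)%:E * nu (cube x (2^-1 ^+ n)))%E.
    under eq_integral do rewrite /f EFinM.
    rewrite ge0_integralZl_EFin ?exprn_ge0//.
      by rewrite integral_indic ?setIT//; exact: measurable_cube.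
    by apply/measurable_EFinP; apply: measurable_indic; exact: measurable_cube.
  apply: (@le_trans _ _ ((4 ^+ n.+1)%:E * mu (cube x (2^-1 ^+ n)))%E).
    by rewrite lee_wpmul2l ?lee_fin ?exprn_ge0//; apply: nu_le; exact: measurable_cube.
  (* 4^(n+1) times the volume 8 * 8^-n of the cube is 64 / 2^(n+1) *)
  rewrite leb3_cube ?exprn_ge0// -EFinM lee_fin le_eqVlt; apply/predU1P; left.
  have t0 : (2 : R) ^+ n != 0 by rewrite expf_neq0.
  have E4 : (4 : R) ^+ n = 2 ^+ n * 2 ^+ n by rewrite -exprMn -natrM.
  by rewrite addn1 natrX ![_ ^+ n.+1]exprS E4 exprVn; field.
have h := @cvg_geometric_eseries_half R 64 0; rewrite expr0 divr1 in h.
by rewrite le_eqVlt; apply/predU1P; left; exact: (cvg_lim _ h).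
Qed.

End bounded_region.

End lebesgue_R3.

(** * Level sets of differences of distances *)

Section null_sections.
Context d1 d2 (T1 : measurableType d1) (T2 : measurableType d2) (R : realType).
Variable m1 : {measure set T1 -> \bar R}.
Variable m2 : {sigma_finite_measure set T2 -> \bar R}.

Lemma product_measure_null (A : set (T1 * T2)) : measurable A ->
  {ae m1, forall x, m2 (xsection A x) = 0%E} -> (m1 \x m2)%E A = 0%E.
Proof.
move=> mA A0; rewrite /product_measure1.
transitivity (\int[m1]_x (cst 0 x))%E; last by rewrite integral0.
apply: ae_eq_integral => //; first exact: measurable_fun_xsection.
by apply: filterS A0 => x /= -> _.
Qed.

End null_sections.

Section level_sets.
Variable R : realType.
Local Notation mu := (@leb3 R).
Local Notation lam := (@lebesgue_measure R).

(** A nontrivial quadratic equation has at most two solutions: given one of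
    them, the equation factors and leaves a linear one. *)
Lemma quadratic_negligible (a2 a1 a0 : R) : a2 != 0 \/ a1 != 0 ->
  lam.-negligible [set t | a2 * t ^+ 2 + a1 * t + a0 = 0].
Proof.
move=> a21; have pt (t : R) : lam.-negligible [set t].
  by apply/negligibleP => //; exact: lebesgue_measure_set1.
have [[t0 /= e0]|no] := pselect (exists t, a2 * t ^+ 2 + a1 * t + a0 = 0); last first.
  by apply: negligibleS (pt 0) => t /= e; exfalso; apply: no; exists t.
apply: negligibleS (negligibleU (pt t0) (pt (- a1 / a2 - t0))) => t /= e.
have : (t - t0) * (a2 * (t + t0) + a1) = 0.
  by rewrite -[RHS](subrr 0) -{1}e -e0; ring.
move=> /eqP; rewrite mulf_eq0 => /orP[|/eqP h].
  by rewrite subr_eq0 => /eqP ->; left.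
have [a20|a2n] := eqVneq a2 0.
  move: h; rewrite a20 mul0r add0r => a10.
  by case: a21 => /eqP; rewrite ?a20 ?a10.
right; have -> : t = (a2 * (t + t0) + a1 - a1 - a2 * t0) / a2 by field.
by rewrite h; field.
Qed.

(** A line parallel to the third axis meets a two-sheeted hyperboloid in at most
    two points. Here p and q are the squared distances of the foci to the line, and
    a and b the third coordinates of the foci. When a = b or p = q the polynomial
    obtained by squaring twice may vanish identically. *)
Lemma two_foci_line_negligible (a b p q c : R) : a != b -> p != q -> 0 <= p -> 0 <= q ->
  lam.-negligible [set t | Num.sqrt (p + (t - a) * (t - a)) -
                           Num.sqrt (q + (t - b) * (t - b)) = c].
Proof.
move=> ab pq p0 q0.
(* squaring sqrt A = c + sqrt B gives al t + be = 2 c sqrt B, with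
   al t + be = A - B - c^2; squaring again gives a2 t^2 + a1 t + a0 = 0 *)
pose al := - (2 * (a - b)); pose be := p + a ^+ 2 - q - b ^+ 2 - c ^+ 2.
pose a2 := al ^+ 2 - 4 * c ^+ 2; pose a1 := 2 * al * be + 8 * c ^+ 2 * b.
pose a0 := be ^+ 2 - 4 * c ^+ 2 * (q + b ^+ 2).
have n0 : a2 != 0 \/ a1 != 0.
  have [a20|] := eqVneq a2 0; [right|by left].
  (* if the leading coefficient vanishes, the next one is 2 al (p - q) *)
  have cE : 4 * c ^+ 2 = al ^+ 2 by move: a20; rewrite /a2; lra.
  have -> : a1 = 2 * al * (p - q).
    have -> : a1 = 2 * al * be + 2 * (4 * c ^+ 2) * b by rewrite /a1; ring.
    have -> : be = p + a ^+ 2 - q - b ^+ 2 - (4 * c ^+ 2) / 4 by rewrite /be; field.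
    by rewrite cE /al; field.
  by rewrite !mulf_neq0 ?oppr_eq0 ?mulf_neq0 ?subr_eq0.
apply: negligibleS (quadratic_negligible a0 n0) => t /=.
set A := p + _; set B := q + _ => e.
have B0 : 0 <= B by rewrite /B addr_ge0// -expr2 sqr_ge0.
have A0 : 0 <= A by rewrite /A addr_ge0// -expr2 sqr_ge0.
have sA := sqr_sqrtr A0; have sB := sqr_sqrtr B0.
have e1 : Num.sqrt A = c + Num.sqrt B by rewrite -e subrK.
have e2 : A - B - c ^+ 2 = 2 * c * Num.sqrt B.
  by rewrite -{1}sA -{1}sB e1; ring.
have e3 : (A - B - c ^+ 2) ^+ 2 = 4 * c ^+ 2 * B by rewrite e2 !exprMn sB -natrX.
have <- : (A - B - c ^+ 2) ^+ 2 - 4 * c ^+ 2 * B = 0 by rewrite e3 subrr.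
by rewrite /A /B /a2 /a1 /a0 /al /be; ring.
Qed.

Lemma quadric_line_negligible (y y' : R3 R) (x1 : R) : y.1.2 != y'.1.2 ->
  lam.-negligible [set x2 |
    (x1 - y.1.1) * (x1 - y.1.1) + (x2 - y.1.2) * (x2 - y.1.2) =
    (x1 - y'.1.1) * (x1 - y'.1.1) + (x2 - y'.1.2) * (x2 - y'.1.2)].
Proof.
move=> yy.
pose a1 := 2 * (y'.1.2 - y.1.2).
pose a0 := (x1 - y.1.1) ^+ 2 - (x1 - y'.1.1) ^+ 2 + y.1.2 ^+ 2 - y'.1.2 ^+ 2.
have n0 : (0 : R) != 0 \/ a1 != 0 by right; rewrite mulf_neq0// subr_eq0 eq_sym.
apply: negligibleS (quadratic_negligible a0 n0) => x2 /= e.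
rewrite mul0r add0r -[RHS](subrr (x1 - y.1.1)).
have : 0 = (x1 - y.1.1) * (x1 - y.1.1) + (x2 - y.1.2) * (x2 - y.1.2) -
  ((x1 - y'.1.1) * (x1 - y'.1.1) + (x2 - y'.1.2) * (x2 - y'.1.2)) by rewrite e subrr.
by rewrite subrr => ->; rewrite /a1 /a0; ring.
Qed.

Lemma measurable_level d (T : measurableType d) (f : T -> R) (c : R) :
  measurable_fun setT f -> measurable [set x | f x = c].
Proof. move=> mT; rewrite -[X in measurable X]setTI; exact: (mT measurableT _ (measurable_set1 c)). Qed.

Lemma measurable_edistl (y : R3 R) : measurable_fun [set: mR3 R] (fun x => edist x y).
Proof.
apply: (measurableT_comp (@measurable_edist R) (g := fun x => (x, y))).
by apply: measurable_fun_pair => //; exact: measurable_cst.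
Qed.

(** On each line parallel to the third axis the level set is negligible, except
    on lines equidistant from y and y'. Those lines cross the horizontal plane in a
    line that is not parallel to the second axis, which is null. *)
Lemma two_foci_null (y y' : R3 R) (c : R) : y.1.2 != y'.1.2 -> y.2 != y'.2 ->
  mu [set x | edist x y - edist x y' = c] = 0%E.
Proof.
move=> y2 y3; set L := [set x | _].
have mL : measurable (L : set (mR3 R)).
  exact: (measurable_level c (measurable_funB (measurable_edistl y) (measurable_edistl y'))).
apply: (product_measure_null mL).
pose p (z : R3 R) (x : R * R) :=
  (x.1 - z.1.1) * (x.1 - z.1.1) + (x.2 - z.1.2) * (x.2 - z.1.2).
pose Q : set (measurableTypeR R * measurableTypeR R) := [set x | p y x = p y' x].
have mp z : measurable_fun [set: measurableTypeR R * measurableTypeR R] (p z).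
  have h1 : measurable_fun [set: measurableTypeR R * measurableTypeR R] (fun x => x.1 - z.1.1).
    by apply: measurable_funB => //; exact: measurable_fst.
  have h2 : measurable_fun [set: measurableTypeR R * measurableTypeR R] (fun x => x.2 - z.1.2).
    by apply: measurable_funB => //; exact: measurable_snd.
  by apply: measurable_funD; exact: measurable_funM.
have mQ : measurable Q.
  have -> : Q = [set x | p y x - p y' x = 0].
    by apply/seteqP; split=> x /= => [->|/eqP]; rewrite ?subrr// subr_eq0 => /eqP.
  exact: (measurable_level 0 (measurable_funB (mp y) (mp y'))).
have Q0 : (lam \x lam)%E Q = 0%E.
  apply: (product_measure_null mQ); apply: nearW => x1.
  apply/negligibleP; first exact: measurable_xsection.
  apply: negligibleS (quadric_line_negligible x1 y2) => x2.
  by rewrite /xsection /= inE.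
(* Q is the set of the lines at equal distance from both foci *)
exists Q; split => // x /= h; apply: contrapT => nQ; apply: h.
apply/negligibleP; first exact: measurable_xsection.
have pq : p y x != p y' x by apply/eqP.
have p0 z : 0 <= p z x by rewrite addr_ge0// -expr2 sqr_ge0.
apply: negligibleS (two_foci_line_negligible c y3 pq (p0 y) (p0 y')) => t.
by rewrite /xsection /= inE.
Qed.

Variable nu : {finite_measure set (mR3 R) -> \bar R}.
Hypothesis nu_le : forall A, measurable A -> (nu A <= mu A)%E.

(** Almost all pairs of points differ in their second and third coordinates. *)
Lemma edist_levels : {ae (fprod nu nu), forall z : mR3 R * mR3 R,
  forall c, nu [set x | edist x z.1 - edist x z.2 = c] = 0%E}.
Proof.
pose E : set (mR3 R * mR3 R) := [set z | z.1.1.2 - z.2.1.2 = 0] `|` [set z | z.1.2 - z.2.2 = 0].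
have h (f : mR3 R -> R) : measurable_fun setT f ->
    measurable ([set z | f z.1 - f z.2 = 0] : set (mR3 R * mR3 R)).
  move=> mf; apply: measurable_level; apply: measurable_funB.
    by apply: (measurableT_comp mf); exact: measurable_fst.
  by apply: (measurableT_comp mf); exact: measurable_snd.
have mE : measurable E.
  by apply: measurableU; [exact: (h _ (@measurable_coord2 R))|exact: (h _ (@measurable_coord3 R))].
have E0 : fprod nu nu E = 0%E.
  apply: (product_measure_null mE); apply: nearW => y.
  apply/eqP; rewrite eq_le measure_ge0 andbT.
  apply: (le_trans (nu_le (measurable_xsection y mE))).
  have n2 : mu.-negligible ((setT `*` [set y.1.2]) `*` setT : set (mR3 R)).
    apply/negligibleP; first by apply: measurableX => //; exact: measurableX.
    have := leb3_box measurableT (measurable_set1 y.1.2) measurableT.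
    by rewrite lebesgue_measure_set1 mule0 mul0e; apply.
  have n3 : mu.-negligible ((setT `*` setT) `*` [set y.2] : set (mR3 R)).
    apply/negligibleP; first by apply: measurableX => //; exact: measurableX.
    have := leb3_box measurableT measurableT (measurable_set1 y.2).
    by rewrite lebesgue_measure_set1 mule0; apply.
  rewrite le_eqVlt; apply/predU1P; left; apply/negligibleP; first exact: measurable_xsection.
  apply: negligibleS (negligibleU n2 n3) => y'; rewrite /xsection /= inE /E /= => -[] /eqP.
    by rewrite subr_eq0 => /eqP ->; left.
  by rewrite subr_eq0 => /eqP ->; right.
exists E; split => // z /= nz; apply: contrapT => nE; apply: nz => c.
have [n1 n2] : z.1.1.2 != z.2.1.2 /\ z.1.2 != z.2.2.
  by split; apply/eqP => e; apply: nE; [left|right]; rewrite /= e subrr.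
apply/eqP; rewrite eq_le measure_ge0 andbT -(two_foci_null c n1 n2).
apply: nu_le.
exact: (measurable_level c (measurable_funB (measurable_edistl z.1) (measurable_edistl z.2))).
Qed.

End level_sets.

(** * Injectivity of the Fourier transform *)

Section sharp_step.
Variable R : realType.

(** A polynomial in u that approximates, on the unit interval, the indicator of
    u < 1/2: the inner power tends to 0 slower or faster than the outer exponent
    grows according to whether 2 u exceeds 1. *)
Definition sharp (n : nat) (u : R) : R := (1 - u ^+ n.+1) ^+ (2 ^ n.+1)%N.

Lemma sharp_itv n u : 0 <= u <= 1 -> 0 <= sharp n u <= 1.
Proof.
move=> /andP[u0 u1]; have h0 : 0 <= u ^+ n.+1 by exact: exprn_ge0.
have h1 : u ^+ n.+1 <= 1 by exact: exprn_ile1.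
by rewrite /sharp exprn_ge0 ?subr_ge0//= exprn_ile1//; lra.
Qed.

Lemma bernoulli_ge (m : nat) (t : R) : -1 <= t -> 1 + m%:R * t <= (1 + t) ^+ m.
Proof.
move=> t1; elim: m => [|m IH]; first by rewrite mul0r addr0 expr0.
have h : 0 <= 1 + t by lra.
have := ler_wpM2l h IH; rewrite -exprS; apply: le_trans.
have t2 : 0 <= m%:R * (t * t) :> R by rewrite mulr_ge0// -expr2 sqr_ge0.
rewrite -natr1 -subr_ge0 (_ : _ - _ = m%:R * (t * t))//; ring.
Qed.

(** Bernoulli's inequality gives sharp n u >= 1 - (2 u)^(n+1). *)
Lemma sharp_cvg1 (u : R) : 0 <= u < 2^-1 -> sharp ^~ u @ \oo --> (1 : R).
Proof.
move=> /andP[u0 u2]; apply: (@squeeze_cvgr _ _ _ _ (fun n => 1 - (2 * u) * (2 * u) ^+ n) (cst 1)).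
- apply: nearW => n; have u1 : u <= 1 by lra.
  have /andP[_ ->] := @sharp_itv n u (introT andP (conj u0 u1)); rewrite andbT.
  have -> : 1 - 2 * u * (2 * u) ^+ n = 1 + (2 ^ n.+1)%:R * (- u ^+ n.+1).
    by rewrite natrX mulrN -exprMn -exprS.
  by apply: bernoulli_ge; rewrite lerN2 exprn_ile1.
- have c : (fun n => (2 * u) ^+ n) @ \oo --> (0 : R).
    by apply: cvg_expr; rewrite ger0_norm; lra.
  have c2 : (fun n => 1 - 2 * u * (2 * u) ^+ n) @ \oo --> 1 - 2 * u * 0.
    by apply: cvgB; [exact: cvg_cst|apply: cvgMr].
  by rewrite mulr0 subr0 in c2.
- exact: cvg_cst.
Qed.

(** With v = u^(n+1) and N = 2^(n+1), sharp n u is at most 1 / (1 + v)^N, because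
    (1 - v) (1 + v) <= 1; Bernoulli's inequality then gives
    sharp n u <= (2 u)^-(n+1). *)
Lemma sharp_cvg0 (u : R) : 2^-1 < u <= 1 -> sharp ^~ u @ \oo --> (0 : R).
Proof.
move=> /andP[u2 u1]; have u0 : 0 < u by lra.
pose q := (2 * u)^-1.
have q1 : q < 1 by rewrite invf_lt1; lra.
have q0 : 0 < q by rewrite invr_gt0; lra.
apply: (@squeeze_cvgr _ _ _ _ (cst 0) (fun n => q * q ^+ n)).
- apply: nearW => n.
  have /andP[b0 b1] := @sharp_itv n u (introT andP (conj (ltW u0) u1)); rewrite b0/=.
  have t0 : 0 < u ^+ n.+1 by exact: exprn_gt0.
  have := @bernoulli_ge (2 ^ n.+1)%N (u ^+ n.+1) (le_trans (lerN10 R) (ltW t0)).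
  rewrite natrX -exprMn => hB.
  rewrite -exprS exprVn -[leRHS]mul1r ler_pdivlMr ?exprn_gt0//; last by lra.
  apply: (@le_trans _ _ (sharp n u * (1 + u ^+ n.+1) ^+ (2 ^ n.+1)%N)).
    by rewrite ler_wpM2l//; lra.
  rewrite /sharp -exprMn exprn_ile1//; last first.
    have := sqr_ge0 (u ^+ n.+1); rewrite expr2; lra.
  by rewrite mulr_ge0// ?subr_ge0 ?exprn_ile1//; lra.
- exact: cvg_cst.
- rewrite -[X in _ --> X](mulr0 q); apply: cvgMr; apply: cvg_expr.
  by rewrite ger0_norm// ltW.
Qed.

Lemma sharp_sin_cvg (t : R) : `|t| <= 1 -> t != 0 ->
  (fun n => sharp n ((1 + sin t) / 2)) @ \oo --> ((t < 0)%R%:R : R).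
Proof.
rewrite ler_norml => /andP[t1 t2] t0; have pi2 := pi_ge2 R.
have sp (v : R) : 0 < v -> v <= 1 -> 0 < sin v.
  by move=> v0 v1; apply: sin_gt0_pi; rewrite v0/=; lra.
have [tn|tp|t00] := ltgtP t 0; last by rewrite t00 eqxx in t0.
  have sn := sp (- t); rewrite sinN in sn.
  by apply: sharp_cvg1; have := sin_geN1 t; have := sn; lra.
by apply: sharp_cvg0; have := sin_le1 t; have := sp t tp t2; lra.
Qed.

End sharp_step.

Section fourier_transform.
Variable R : realType.
Local Notation mu := (@leb3 R).
Variable nu : {finite_measure set (mR3 R) -> \bar R}.
Hypothesis nu_le : forall A, measurable A -> (nu A <= mu A)%E.
Variable r : R.
Hypothesis r0 : 0 <= r.
Hypothesis nu_cube : {ae nu, forall x, cube 0 r x}.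
Variables (W : mR3 R -> R) (M : R).
Hypotheses (mW : measurable_fun setT W) (WM : forall x, `|W x| <= M).

Definition wave (xi : R3 R) (b : R) (x : R3 R) : R := cos (dot xi x + b).

Lemma measurable_dot (xi : R3 R) : measurable_fun setT (fun x : mR3 R => dot xi x).
Proof.
rewrite /dot; apply: measurable_funD; last first.
  by apply: measurable_funM => //; exact: measurable_coord3.
apply: measurable_funD.
  by apply: measurable_funM => //; exact: measurable_coord1.
by apply: measurable_funM => //; exact: measurable_coord2.
Qed.

Lemma measurable_wave xi b : measurable_fun setT (wave xi b : mR3 R -> R).
Proof.
by apply: measurable_cos_comp; apply: measurable_funD => //; exact: measurable_dot.
Qed.

(** The functions f such that f W has zero Fourier transform. They form a module
    over the algebra generated by the waves, which contains approximations of the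
    indicators of half-spaces. *)
Definition annihilated (f : mR3 R -> R) : Prop :=
  [/\ measurable_fun setT f, (exists B, forall x, `|f x| <= B) &
      forall xi b, \int[nu]_x (W x * (f x * wave xi b x)) = 0].

Let integWf (f : mR3 R -> R) B : measurable_fun setT f -> (forall x, `|f x| <= B) ->
  integ nu (fun x => W x * f x).
Proof.
move=> mf fB; apply: (@integ_bounded _ _ _ _ _ (M * B)); first exact: measurable_funM.
by move=> x; rewrite normrM ler_pM.
Qed.

Lemma annihilated_lin f g a b : annihilated f -> annihilated g ->
  annihilated (fun x => a * f x + b * g x).
Proof.
move=> [mf [B fB] f0] [mg [B' gB'] g0]; split.
- by apply: measurable_funD; exact: measurable_funM.
- exists (`|a| * B + `|b| * B') => x.
  by rewrite (le_trans (ler_normD _ _))// !normrM lerD// ler_wpM2l.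
- move=> xi c.
  have j (h : mR3 R -> R) B0 : measurable_fun setT h -> (forall x, `|h x| <= B0) ->
      integ nu (fun x => W x * (h x * wave xi c x)).
    move=> mh hB; apply: (@integWf _ B0); first by apply: measurable_funM => //; exact: measurable_wave.
    by move=> x; rewrite normrM (le_trans _ (hB x))// ler_piMr// cos_max.
  have jf := j _ _ mf fB; have jg := j _ _ mg gB'.
  transitivity (\int[nu]_x (a * (W x * (f x * wave xi c x)) + b * (W x * (g x * wave xi c x)))).
    by apply: eq_Rintegral => x _; ring.
  rewrite (RintegralD measurableT (integrableZl measurableT a jf) (integrableZl measurableT b jg)).
  by rewrite !RintegralZl// f0 g0 !mulr0 addr0.
Qed.

Lemma annihilated_ext f g : (forall x, f x = g x) -> annihilated f -> annihilated g.
Proof. by move=> /funext ->. Qed.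

Lemma waveM eta c xi b x : wave eta c x * wave xi b x =
  2^-1 * wave (eta + xi) (c + b) x + 2^-1 * wave (eta - xi) (c - b) x.
Proof.
rewrite /wave.
have -> : dot (eta + xi) x + (c + b) = (dot eta x + c) + (dot xi x + b).
  by rewrite /dot /=; ring.
have -> : dot (eta - xi) x + (c - b) = (dot eta x + c) - (dot xi x + b).
  by rewrite /dot /=; ring.
by move: (dot eta x + c) (dot xi x + b) => s t; rewrite cosD cosB; field.
Qed.

(** Multiplication by a wave only shifts the frequency. *)
Lemma annihilated_wave f eta c : annihilated f ->
  annihilated (fun x => f x * wave eta c x).
Proof.
move=> [mf [B fB] f0]; have mw := measurable_wave; split.
- exact: measurable_funM.
- by exists B => x; rewrite normrM (le_trans _ (fB x))// ler_piMr// cos_max.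
- move=> xi b.
  have j eta' b' : integ nu (fun x => W x * (f x * wave eta' b' x)).
    apply: (@integWf _ B); first exact: measurable_funM.
    by move=> x; rewrite normrM (le_trans _ (fB x))// ler_piMr// cos_max.
  transitivity (\int[nu]_x (2^-1 * (W x * (f x * wave (eta + xi) (c + b) x)) +
                            2^-1 * (W x * (f x * wave (eta - xi) (c - b) x)))).
    by apply: eq_Rintegral => x _; rewrite -mulrA waveM; ring.
  rewrite (RintegralD measurableT (integrableZl measurableT _ (j _ _)) (integrableZl measurableT _ (j _ _))).
  by rewrite !RintegralZl// !f0 !mulr0 addr0.
Qed.

Section sharp_multiplier.
Variables (eta : R3 R) (c : R).
Let u x := (1 + wave eta c x) / 2.

Let annihilated_pow f n : annihilated f -> annihilated (fun x => f x * u x ^+ n).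
Proof.
elim: n f => [|n IH] f Af; first by apply: annihilated_ext Af => x; rewrite expr0 mulr1.
apply: (annihilated_ext _ (IH _ (annihilated_lin 2^-1 2^-1 Af (annihilated_wave eta c Af)))) => x.
by rewrite exprS /u; field.
Qed.

Lemma annihilated_sharp f n : annihilated f -> annihilated (fun x => f x * sharp n (u x)).
Proof.
rewrite /sharp; move: (2 ^ n.+1)%N => m; elim: m f => [|m IH] f Af.
  by apply: annihilated_ext Af => x; rewrite expr0 mulr1.
apply: (annihilated_ext _ (IH _ (annihilated_lin 1 (-1) Af (annihilated_pow n.+1 Af)))) => x.
by rewrite [in RHS]exprS mul1r mulN1r; ring.
Qed.

End sharp_multiplier.

Hypothesis fourier0 : forall xi b, \int[nu]_x (W x * wave xi b x) = 0.

Let annihilated1 : annihilated (cst 1).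
Proof.
split => //; first by exists 1 => x; rewrite normr1.
by move=> xi b; rewrite -[RHS](fourier0 xi b); apply: eq_Rintegral => x _; rewrite mul1r.
Qed.

Hypothesis null_planes : forall a, [/\ nu [set x | x.1.1 = a] = 0%E,
  nu [set x | x.1.2 = a] = 0%E & nu [set x | x.2 = a] = 0%E].

Let sc (a : R) := (r + `|a| + 1)^-1.
(** The shift by pi/2 turns the cosine into a sine that changes sign at a, and
    the scale sc a keeps its argument within [-1, 1] on the cube, where the sine
    has the sign of its argument. *)
Let uwave (eta : R -> R3 R) a (x : R3 R) :=
  (1 + wave (eta (sc a)) (- (sc a * a) - pi / 2) x) / 2.

Let uwave_itv eta a x : 0 <= uwave eta a x <= 1.
Proof.
rewrite /uwave /wave; have := cos_geN1 (dot (eta (sc a)) x + (- (sc a * a) - pi / 2)).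
by have := cos_le1 (dot (eta (sc a)) x + (- (sc a * a) - pi / 2)); lra.
Qed.

Let uwave_cvg eta (p : R3 R -> R) a x : (forall s x, dot (eta s) x = s * p x) ->
  `|p x| <= r -> p x != a -> (fun n => sharp n (uwave eta a x)) @ \oo --> ((p x < a)%R%:R : R).
Proof.
move=> ep pr pa; have d0 : 0 < r + `|a| + 1 by rewrite ltr_wpDl// addr_ge0.
have s0 : 0 < sc a by rewrite invr_gt0.
have -> : (p x < a) = (sc a * (p x - a) < 0) by rewrite pmulr_rlt0// subr_lt0.
rewrite /uwave /wave ep (_ : sc a * p x + _ = sc a * (p x - a) - pi / 2); last by ring.
rewrite cosBpihalf; apply: sharp_sin_cvg; last by rewrite mulf_neq0 ?subr_eq0// gt_eqF.
rewrite normrM gtr0_norm// ler_pdivrMl// mulr1.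
rewrite (le_trans (ler_normB _ _))//; lra.
Qed.

Let e1 s : R3 R := (s, 0, 0).
Let e2 s : R3 R := (0, s, 0).
Let e3 s : R3 R := (0, 0, s).

Definition orthant (a : R3 R) : set (mR3 R) :=
  [set x | [/\ x.1.1 < a.1.1, x.1.2 < a.1.2 & x.2 < a.2]].

Lemma measurable_halfline (f : mR3 R -> R) a : measurable_fun setT f ->
  measurable [set x | f x < a].
Proof.
move=> mf; rewrite -[X in measurable X]setTI.
rewrite (_ : [set x | _] = f @^-1` `]-oo, a[%classic); last first.
  by apply/seteqP; split => x /=; rewrite in_itv.
exact: (mf measurableT _ (measurable_itv _)).
Qed.

Lemma measurable_orthant a : measurable (orthant a).
Proof.
have -> : orthant a = [set x | x.1.1 < a.1.1] `&` [set x | x.1.2 < a.1.2] `&` [set x | x.2 < a.2].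
  by apply/seteqP; split => x /=; [move=> [] | move=> [[]]].
apply: measurableI; first apply: measurableI.
- exact: (measurable_halfline _ (@measurable_coord1 R)).
- exact: (measurable_halfline _ (@measurable_coord2 R)).
- exact: (measurable_halfline _ (@measurable_coord3 R)).
Qed.

(** The products of three sharp steps, one in each coordinate, are annihilated
    and converge boundedly to the indicator of the orthant, off three null
    planes. *)
Lemma integral_orthant a : \int[nu]_(x in orthant a) W x = 0.
Proof.
pose f n x := sharp n (uwave e1 a.1.1 x) * sharp n (uwave e2 a.1.2 x) * sharp n (uwave e3 a.2 x).
have Af n : annihilated (f n).
  apply: annihilated_ext (annihilated_sharp _ _ n (annihilated_sharp _ _ n
    (annihilated_sharp _ _ n annihilated1))) => x.
  by rewrite mul1r.
have Wf n : \int[nu]_x (W x * f n x) = 0.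
  have [_ _ h] := Af n; rewrite -[RHS](h 0 0); apply: eq_Rintegral => x _.
  by rewrite /wave /dot /= !mul0r !addr0 cos0 mulr1.
pose F x : R := (x.1.1 < a.1.1)%R%:R * (x.1.2 < a.1.2)%R%:R * (x.2 < a.2)%R%:R.
have WF x : (W \_ (orthant a)) x = W x * F x.
  rewrite patchE /F; case: ifPn => [|/negP]; rewrite inE.
    by move=> [-> -> ->]; rewrite !mulr1.
  move=> h; case: (ltP x.1.1) => [h1|]; last by rewrite !mul0r mulr0.
  case: (ltP x.1.2) => [h2|]; last by rewrite mulr0 mul0r mulr0.
  by case: (ltP x.2) => [h3|]; [exfalso; exact: h|rewrite !mulr0].
rewrite Rintegral_mkcond; under eq_Rintegral do rewrite WF.
have cv : (fun n => \int[nu]_x (W x * f n x)) @ \oo --> \int[nu]_x (W x * F x).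
  apply: (Rint_dct (g := cst (M * 1))).
  - by move=> n; apply: measurable_funM => //; have [] := Af n.
  - rewrite -(funext WF); apply/(measurable_restrictT _ (measurable_orthant a)).
    exact: measurable_funTS.
  - have [z1 _ _] := null_planes a.1.1; have [_ z2 _] := null_planes a.1.2.
    have [_ _ z3] := null_planes a.2.
    have ae_ne (p : mR3 R -> R) c : measurable_fun setT p -> nu [set x | p x = c] = 0%E ->
        {ae nu, forall x, p x != c}.
      move=> mp pc; exists [set x | p x = c]; split => //; first exact: measurable_level.
      by move=> x /= /negP; rewrite negbK => /eqP.
    have n1 := ae_ne _ _ (@measurable_coord1 R) z1.
    have n2 := ae_ne _ _ (@measurable_coord2 R) z2.
    have n3 := ae_ne _ _ (@measurable_coord3 R) z3.
    apply: filterS3 n1 n2 (filterI n3 nu_cube) => x h1 h2 [h3 /cubeP[]].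
    rewrite /= !subr0 => b1 b2 b3; apply: cvgMr; apply: cvgM; [apply: cvgM|].
    + by apply: (@uwave_cvg e1 (fun x => x.1.1)) => // s y; rewrite /dot /= !mul0r !addr0.
    + by apply: (@uwave_cvg e2 (fun x => x.1.2)) => // s y; rewrite /dot /= !mul0r add0r addr0.
    + by apply: (@uwave_cvg e3 (fun x => x.2)) => // s y; rewrite /dot /= !mul0r !add0r.
  - exact: integ_cst.
  - move=> n x /=; rewrite normrM ler_pM//.
    have fi eta c : 0 <= sharp n (uwave eta c x) <= 1 by apply: sharp_itv; exact: uwave_itv.
    have /andP[p1 q1] := fi e1 a.1.1; have /andP[p2 q2] := fi e2 a.1.2.
    have /andP[p3 q3] := fi e3 a.2.
    by rewrite ger0_norm /f ?mulr_ge0// !mulr_ile1 ?mulr_ge0.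
rewrite (funext Wf) in cv.
by rewrite -(cvg_lim _ cv)//; exact: (cvg_lim _ (cvg_cst 0)).
Qed.

Lemma orthant_setI_closed : setI_closed (range orthant).
Proof.
move=> _ _ [a _ <-] [b _ <-].
exists ((Num.min a.1.1 b.1.1, Num.min a.1.2 b.1.2), Num.min a.2 b.2) => //.
apply/seteqP; split => x; rewrite /orthant /= !lt_min.
  by move=> [/andP[h1 h1'] /andP[h2 h2'] /andP[h3 h3']].
by move=> [[h1 h2 h3] [h1' h2' h3']]; rewrite h1 h2 h3 h1' h2' h3'.
Qed.

(** The identity is measurable from the generated sigma-algebra because its
    coordinates are: a half-space is the increasing union of the orthants whose
    two other bounds are natural numbers. *)
Lemma orthant_generate : @measurable _ (mR3 R) = <<s range orthant >>.
Proof.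
apply/seteqP; split; last first.
  apply: smallest_sub; first exact: sigma_algebra_measurable.
  by move=> _ [a _ <-]; exact: measurable_orthant.
pose T := g_sigma_algebraType (range orthant).
have orth a : @measurable _ T (orthant a) by apply: sub_sigma_algebra; exists a.
have ex (u v : R) : exists n : nat, u < n%:R /\ v < n%:R.
  exists (Num.truncn (Num.max u v)).+1.
  have := @truncnS_gt R (Num.max u v); rewrite gt_max => /andP[]//.
have coord (p : T -> measurableTypeR R) (o : R -> R -> R3 R) :
    (forall c y x, orthant (o c y) x -> p x < c) ->
    (forall c x, p x < c -> exists n : nat, orthant (o c n%:R) x) ->
    measurable_fun setT p.
  move=> h1 h2; apply: (measurability _ (RGenInftyO.measurableE R)) => _ [_ [c ->] <-].
  rewrite setTI (_ : p @^-1` _ = \bigcup_n orthant (o c n%:R)).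
    by apply: bigcupT_measurable => n; exact: orth.
  apply/seteqP; split=> x /=; rewrite in_itv/=.
    by move=> /h2[n xn]; exists n.
  by move=> [n _ /h1].
have mid : measurable_fun [set: T] (fun x : T => x : mR3 R).
  have m1 : measurable_fun setT (fun x : T => x.1.1 : measurableTypeR R).
    apply: (coord _ (fun c y => (c, y, y))) => [c y x []//|c x xc].
    by have [n [n1 n2]] := ex x.1.2 x.2; exists n.
  have m2 : measurable_fun setT (fun x : T => x.1.2 : measurableTypeR R).
    apply: (coord _ (fun c y => (y, c, y))) => [c y x []//|c x xc].
    by have [n [n1 n2]] := ex x.1.1 x.2; exists n.
  have m3 : measurable_fun setT (fun x : T => x.2 : measurableTypeR R).
    apply: (coord _ (fun c y => (y, y, c))) => [c y x []//|c x xc].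
    by have [n [n1 n2]] := ex x.1.1 x.1.2; exists n.
  have := measurable_fun_pair (measurable_fun_pair m1 m2) m3.
  by apply: eq_measurable_fun => -[[x1 x2] x3].
by move=> A mA; have := mid measurableT A mA; rewrite setTI.
Qed.

(** The signed measure of density W vanishes on the orthants, a system
    stable under intersection that generates the Borel sets, hence on all Borel
    sets. *)
Theorem fourier_uniqueness : {ae nu, forall x, W x = 0}.
Proof.
have jW : integ nu W by exact: (@integ_bounded _ _ _ _ _ M mW WM).
have fin A : measurable A -> (\int[nu]_(x in A) (W x)%:E = (\int[nu]_(x in A) W x)%:E)%E.
  move=> mA; rewrite /Rintegral fineK//; apply: integrable_fin_num => //.
  exact: integrableS jW.
have tot : \int[nu]_x W x = 0.
  rewrite -[RHS](fourier0 0 0); apply: eq_Rintegral => x _.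
  by rewrite /wave /dot /= !mul0r !addr0 cos0 mulr1.
have all0 : forall A, <<s range orthant >> A -> (\int[nu]_(x in A) (W x)%:E = 0)%E.
  apply: dynkin_induction orthant_generate orthant_setI_closed _ _ _ _.
  - by rewrite fin// tot.
  - move=> _ [a _ <-]; rewrite fin; last exact: measurable_orthant.
    by rewrite integral_orthant.
  - move=> A mA A0.
    have := @integral_setU _ _ _ nu A (~` A) (EFin \o W) mA (measurableC mA).
    rewrite setUv /= A0 add0e fin// tot => <- //.
      by apply/measurable_EFinP.
    by apply/disj_setPS; rewrite setICr.
  - move=> F mF tF F0; rewrite integral_bigcup//.
      by rewrite eseries0// => i _ _; exact: F0.
    by apply: integrableS jW => //; exact: bigcup_measurable.
have := @integral_ae_eq _ _ _ nu setT measurableT (cst 0%E) (EFin \o W) jW _ _.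
case.
- exact: measurable_cst.
- move=> A _ mA; rewrite integral0 all0//; first by rewrite -orthant_generate.
- move=> N [mN N0 sN]; exists N; split => // x /= nx; apply: sN => /= h; apply: nx.
  by have [] := h I.
Qed.

End fourier_transform.

(** * The volume potential on a bounded region *)

Section resolvent_equation.
Variables (R : realType) (D : set (mR3 R)).
Hypotheses (mD : measurable D) (Doo : (leb3 D < +oo)%E).
Local Notation mu := (@leb3 R).

Definition region_measure : {finite_measure set (mR3 R) -> \bar R} := mfrestr mD Doo.
Local Notation nu := region_measure.
Local Notation cop := (cop nu (@green_amp R) (@edist R)).
Local Notation cker := (cker (@green_amp R) (@edist R)).

Lemma PhiE k (x y : R3 R) : Phi k x y = cker k x y.
Proof.
rewrite /Phi /cker mulrC /edist /green_amp; congr (_ * _).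
by rewrite -[LHS]/((4 * pi * enorm (x - y))%:C^-1) -(fmorphV (real_complex R)).
Qed.

Lemma region_measure_le A : measurable A -> (nu A <= mu A)%E.
Proof. exact: mfrestr_le. Qed.

Lemma Cint_region_measure (F : R3 R -> R[i]) : cmeas (F : mR3 R -> R[i]) ->
  Cintegral D F = Cint nu F.
Proof.
by move=> [m1 m2]; apply: complex_eqP; rewrite /= Rintegral_mfrestr.
Qed.

(** Outside its support g is zero, and outside D it is zero almost everywhere, so
    integrating over the support or over D gives the same potential. *)
Lemma Rk_cop k (g : R3 R -> R[i]) x : cmeas (g : mR3 R -> R[i]) ->
  {ae mu, forall x, ~ D x -> g x = 0} -> Rk k g x = cop k g x.
Proof.
move=> mg g0.
have mm : cmeas (fun y : mR3 R => cker k x y * g y).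
  exact: (cmeas_cker_mul (@measurable_green_amp R) (@measurable_edist R) k x mg).
have gsupp y : ~ csupp g y -> g y = 0.
  by move=> h; apply: contrapT => /eqP gy; apply: h; apply: subset_closure.
have part (p : R[i] -> R) : p 0 = 0 -> measurable_fun setT (fun y : mR3 R => p (cker k x y * g y)) ->
    \int[mu]_(y in csupp g) p (Phi k x y * g y) = \int[nu]_y p (cker k x y * g y).
  move=> p0 mp; rewrite Rintegral_mkcond.
  have -> : (fun y => p (Phi k x y * g y)) \_ (csupp g) = (fun y => p (cker k x y * g y)).
    apply/funext => y; rewrite patchE PhiE; case: ifPn => // /negP h.
    by rewrite gsupp ?mulr0// => /mem_set.
  apply: Rintegral_supported => //.
  by apply: filterS g0 => y h nD; rewrite h// mulr0.
by apply: complex_eqP => /=; apply: part => //; case: mm.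
Qed.

Lemma CL2_sqinteg (g : R3 R -> R[i]) : CL2 D g ->
  sqinteg nu g /\ {ae mu, forall x, ~ D x -> g x = 0}.
Proof.
move=> [[gR sR] [gI sI]]; split; last first.
  have F : Filter (almost_everywhere mu) by exact: ae_filter_ringOfSetsType.
  apply: filterS2 sR sI => x h1 h2 nD.
  by apply: complex_eqP; [exact: h1|exact: h2].
have jR := integ_mfrestr mD Doo (Lfun2_integrable_sqr gR).
have jI := integ_mfrestr mD Doo (Lfun2_integrable_sqr gI).
have mg : cmeas (g : mR3 R -> R[i]).
  by split; [move: gR|move: gI]; rewrite inE => /andP[]; rewrite inE.
split => //.
have j := integrableZl measurableT 2 (integrableD measurableT jR jI).
apply: (integ_le _ _ j); first by apply: measurable_funX; exact: measurable_cabs.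
by move=> x; rewrite ger0_norm ?sqr_ge0//; exact: sqr_cabs_le.
Qed.

Lemma CL2_bounded (g : R3 R -> R[i]) B : cmeas (g : mR3 R -> R[i]) ->
  (forall x, cabs (g x) <= B) -> (forall x, ~ D x -> g x = 0) -> CL2 D g.
Proof.
move=> [m1 m2] gB g0; split; split.
- apply: (Lfun2_bounded_supported mD Doo (B := B)) => // [x|x nD]; last by rewrite g0.
  exact: le_trans (normRe_le _) (gB x).
- by apply: nearW => x nD; rewrite g0.
- apply: (Lfun2_bounded_supported mD Doo (B := B)) => // [x|x nD]; last by rewrite g0.
  exact: le_trans (normIm_le _) (gB x).
- by apply: nearW => x nD; rewrite g0.
Qed.

End resolvent_equation.

(** * The Born approximation *)

Section expi_facts.
Variable R : realType.
Lemma expiD (a b : R) : expi a * expi b = expi (a + b).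
Proof.
apply: complex_eqP; rewrite ?ReM ?ImM /= ?cosD ?sinD //; ring.
Qed.

Lemma expi0 : expi (0 : R) = 1.
Proof. by apply: complex_eqP; rewrite /= ?cos0 ?sin0. Qed.

Lemma dotC (x y : R3 R) : dot x y = dot y x.
Proof. by rewrite /dot; ring. Qed.
End expi_facts.

Section born_approximation.
Variables (R : realType) (D : set (mR3 R)).
Hypotheses (mD : measurable D) (Doo : (leb3 D < +oo)%E).
Local Notation mu := (@leb3 R).
Local Notation nu := (region_measure mD Doo).
Local Notation C := (green_bound nu).
Local Notation cop := (cop nu (@green_amp R) (@edist R)).
Local Notation cker := (cker (@green_amp R) (@edist R)).
Local Notation vop := (vop nu (@green_amp R) (@edist R)).
Local Notation energy := (energy nu (@green_amp R) (@edist R)).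

Let kC := green_amp_sq_integral (region_measure_le mD Doo).

Variables (k s M : R) (V V0 : R3 R -> R).
Hypotheses (s0 : 0 < s) (Es : energy k <= energy_bound nu s).
Hypothesis sM : M * (M * (s * (C + 2))) <= 2^-1.
Hypotheses (mV0 : measurable_fun [set: mR3 R] V0) (V0M : forall x, `|V0 x| <= M) (M0 : 0 <= M).
Hypotheses (V0D : forall x, ~ D x -> V0 x = 0) (VV0 : {ae mu, forall x, V x = V0 x}).

(** The Neumann solution for bounded representatives of V and h, which vanish off
    D, is an element of L^2(D) and witnesses that the resolvent is not the default
    value of the choice operator. *)
Lemma resolventP (h h0 : R3 R -> R[i]) (H : R) : cmeas (h0 : mR3 R -> R[i]) -> 0 < H ->
  (forall x, cabs (h0 x) <= H) -> (forall x, ~ D x -> h0 x = 0) ->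
  {ae mu, forall x, h x = h0 x} ->
  CL2 D (resolvent D k V h) /\
  {ae mu, forall x, D x ->
    resolvent D k V h x - (V x)%:C * Rk k (resolvent D k V h) x = h x}.
Proof.
move=> mh0 H0 h0H h0D hh0.
have [g [mg [B gB]] gE] := neumann_solution (green_bound_ge0 nu) (@measurable_green_amp R)
  (@measurable_edist R) (@green_amp_ge0 R) (@green_ampC R) kC s0 Es mV0 V0M M0 sM H0 mh0 h0H.
rewrite /resolvent; apply: (xgetPex (fun=> 0) (P := [set g | CL2 D g /\
  {ae mu, forall x : R3 R, D x -> g x - (V x)%:C * Rk k g x = h x}])).
have gD x : ~ D x -> g x = 0.
  by move=> nD; rewrite gE /vop V0D// h0D// mul0r addr0.
exists g; split; first exact: (CL2_bounded mD Doo mg gB gD).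
have F : Filter (almost_everywhere mu) by exact: ae_filter_ringOfSetsType.
apply: filterS2 VV0 hh0 => x Vx hx Dx.
rewrite (Rk_cop mD Doo k x mg); last by apply: nearW.
by rewrite Vx hx {1}gE /vop addrK.
Qed.

(** The difference of two solutions is square integrable only. By the equation it
    equals h0 + V0 R_k (G1 - G2) almost everywhere in D; this function is bounded,
    and it solves the same equation at every point. The estimates for bounded
    solutions therefore apply to the difference. *)
Lemma resolventB (h1 h2 h0 : R3 R -> R[i]) (G1 G2 : R3 R -> R[i]) (H : R) :
  cmeas (h0 : mR3 R -> R[i]) -> (forall x, cabs (h0 x) <= H) ->
  {ae mu, forall x, h1 x - h2 x = h0 x} ->
  CL2 D G1 -> {ae mu, forall x, D x -> G1 x - (V x)%:C * Rk k G1 x = h1 x} ->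
  CL2 D G2 -> {ae mu, forall x, D x -> G2 x - (V x)%:C * Rk k G2 x = h2 x} ->
  exists2 g : mR3 R -> R[i], [/\ cmeas g, cbdd g & forall x, g x = h0 x + vop k V0 g x] &
    {ae nu, forall x, G1 x - G2 x = g x}.
Proof.
move=> mh0 h0H hh CG1 E1 CG2 E2.
have [s1 z1] := CL2_sqinteg mD Doo CG1; have [s2 z2] := CL2_sqinteg mD Doo CG2.
have s12 := sqintegB s1 s2; set g' := (fun x : mR3 R => G1 x - G2 x) in s12.
have mc := cmeas_cop (@measurable_green_amp R) (@measurable_edist R) (@green_amp_ge0 R) (@green_ampC R) kC k s12.
have cs := cop_sqinteg_sup (@measurable_green_amp R) (@measurable_edist R) (@green_amp_ge0 R) kC k s12.
pose g (x : mR3 R) : R[i] := h0 x + (V0 x)%:C * cop k g' x.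
have gg' : {ae nu, forall x, g' x = g x}.
  apply: mfrestr_ae.
  have F : Filter (almost_everywhere mu) by exact: ae_filter_ringOfSetsType.
  have EE : {ae mu, forall x, D x -> G1 x - (V x)%:C * Rk k G1 x = h1 x /\
                                  G2 x - (V x)%:C * Rk k G2 x = h2 x}.
    by apply: filterS2 E1 E2 => x e1 e2 Dx; split; [exact: e1|exact: e2].
  apply: filterS3 EE VV0 hh => x e Vx hx Dx; have [e1 e2] := e Dx.
  have c12 : cop k g' x = cop k G1 x - cop k G2 x.
    exact: (copB (@measurable_green_amp R) (@measurable_edist R) (@green_amp_ge0 R) kC).
  rewrite /g c12 -hx -e1 -e2 Vx (Rk_cop mD Doo k x s1.1 z1) (Rk_cop mD Doo k x s2.1 z2) /g'.
  by rewrite mulrBr; ring.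
have mg : cmeas g by apply: cmeasD => //; apply: cmeasM => //; exact: cmeasR.
exists g => //; split => //.
  exists (H + M * (C + \int[nu]_y cabs (g' y) ^+ 2)) => x.
  rewrite /g (le_trans (cabsD _ _))// lerD// cabsZ ler_pM ?cabs_ge0//; exact: cs.
move=> x; rewrite /g /vop; congr (_ + _ * _).
apply: Cint_ae.
- exact: (cmeas_cker_mul (@measurable_green_amp R) (@measurable_edist R) k x s12.1).
- exact: (cmeas_cker_mul (@measurable_green_amp R) (@measurable_edist R) k x mg).
- by apply: filterS gg' => y ->.
Qed.

Section far_field_difference.
Variables (f f0 : R3 R -> R) (Mf : R).
Hypotheses (mf0 : measurable_fun [set: mR3 R] f0) (f0M : forall x, `|f0 x| <= Mf) (Mf0 : 0 <= Mf).
Hypotheses (f0D : forall x, ~ D x -> f0 x = 0) (ff0 : {ae mu, forall x, f x = f0 x}).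

Definition incident_source (d : sphere2 R) (x : R3 R) : R[i] :=
  true%:R * (V x)%:C * plane_wave k d x - (f x)%:C.

(** The deterministic part of the far field, up to the factor 1/(4 pi). *)
Definition radiated (xhat d : sphere2 R) : R[i] :=
  Cintegral D (fun y => far_kernel k xhat y * resolvent D k V (incident_source d) y).

Lemma cmeas_plane_wave (d : sphere2 R) : cmeas (plane_wave k d : mR3 R -> R[i]).
Proof.
apply: cmeas_expi; apply: measurable_funM => //.
by under eq_fun do rewrite dotC; exact: measurable_dot.
Qed.

Lemma cmeas_far_kernel (xhat : sphere2 R) : cmeas (far_kernel k xhat : mR3 R -> R[i]).
Proof.
by apply: cmeas_expi; apply: measurable_funN; apply: measurable_funM => //; exact: measurable_dot.
Qed.

Lemma resolvent_incident (d : sphere2 R) :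
  CL2 D (resolvent D k V (incident_source d)) /\
  {ae mu, forall x, D x ->
    resolvent D k V (incident_source d) x -
      (V x)%:C * Rk k (resolvent D k V (incident_source d)) x = incident_source d x}.
Proof.
apply: (@resolventP _ (fun x => (V0 x)%:C * plane_wave k d x - (f0 x)%:C) (M * 2 + Mf + 1)).
- apply: cmeasD; last by apply: cmeasN; exact: cmeasR.
  by apply: cmeasM; [exact: cmeasR|exact: cmeas_plane_wave].
- by rewrite ltr_wpDl// addr_ge0// mulr_ge0.
- move=> x; apply: (le_trans (cabsB _ _)).
  apply: (@le_trans _ _ (M * 2 + Mf)); last by rewrite lerDl.
  rewrite lerD//; last by rewrite /cabs /= normr0 addr0.
  by rewrite cabsZ ler_pM ?cabs_ge0//; exact: cabs_expi.
- by move=> x nD; rewrite V0D// f0D// mul0r subr0.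
- have F : Filter (almost_everywhere mu) by exact: ae_filter_ringOfSetsType.
  by apply: filterS2 VV0 ff0 => x Vx fx; rewrite /incident_source Vx fx mul1r.
Qed.

Lemma cinteg_bounded_sqinteg (a g : mR3 R -> R[i]) : cmeas a -> (forall x, cabs (a x) <= 2) ->
  sqinteg nu g -> cinteg nu (fun x => a x * g x).
Proof.
move=> ma a2 [mg jg].
have j : integ nu (fun x => 1 + cabs (g x) ^+ 2).
  exact: (integrableD measurableT (integ_cst nu 1) jg).
apply: (cinteg_le _ _ j) => [|x]; first exact: cmeasM.
apply: (le_trans (cabsM _ _)); apply: (@le_trans _ _ (2 * cabs (g x))).
  by rewrite ler_wpM2r ?cabs_ge0.
by have := sqr_ge0 (1 - cabs (g x)); rewrite !expr2; lra.
Qed.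

Definition born_constant (K : R) : R :=
  2 * (K * (2 * ((4 * K + 1) * (1 + K * (C + mass nu))) * (mass nu + 1))).

(** In the difference the source f cancels, so the right-hand side of the
    resolvent equation is V (u_d - u_xhat). Replacing the solution by this
    right-hand side costs the Born error, and
    exp(- i k xhat . y) (u_d - u_xhat) (y) = exp(- i xi . y) - 1. *)
Lemma radiated_difference (xhat d : sphere2 R) (xi : R3 R) :
  (forall y, k * dot (sval xhat) y - k * dot (sval d) y = dot xi y) ->
  cabs (radiated xhat d - radiated xhat xhat -
    Cint nu (fun y => (V0 y)%:C * (expi (- dot xi y) - 1))) <= born_constant M * s.
Proof.
move=> hxi.
have [C1 E1] := resolvent_incident d; have [C2 E2] := resolvent_incident xhat.
pose h0 (x : mR3 R) := (V0 x)%:C * (plane_wave k d x - plane_wave k xhat x).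
have mh0 : cmeas h0.
  apply: cmeasM; first exact: cmeasR.
  by apply: cmeasD; [|apply: cmeasN]; exact: cmeas_plane_wave.
have h0H x : cabs (h0 x) <= 4 * M + 1.
  rewrite cabsZ; apply: (@le_trans _ _ (M * 4)); last by lra.
  rewrite ler_pM ?cabs_ge0// (le_trans (cabsB _ _))//.
  have := cabs_expi (k * dot x (sval d)); have := cabs_expi (k * dot x (sval xhat)).
  by rewrite /plane_wave; lra.
have hh : {ae mu, forall x, incident_source d x - incident_source xhat x = h0 x}.
  have F : Filter (almost_everywhere mu) by exact: ae_filter_ringOfSetsType.
  by apply: filterS VV0 => x Vx; rewrite /incident_source /h0 -Vx !mul1r; ring.
have [g [mg bg gE] gg] := resolventB mh0 h0H hh C1 E1 C2 E2.
have H0 : 0 < 4 * M + 1 by rewrite ltr_wpDl ?mulr_ge0.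
have err := born_error (green_bound_ge0 nu) (@measurable_green_amp R)
  (@measurable_edist R) (@green_amp_ge0 R) (@green_ampC R) kC s0 Es mV0 V0M M0 sM H0 mh0 h0H mg bg gE.
have [s1 _] := CL2_sqinteg mD Doo C1; have [s2 _] := CL2_sqinteg mD Doo C2.
have mk := cmeas_far_kernel xhat.
have k2 (x : mR3 R) : cabs (far_kernel k xhat x) <= 2 by exact: cabs_expi.
have [B gB] := bg; have sg := sqinteg_bounded nu mg gB.
have sh := sqinteg_bounded nu mh0 h0H; have sd := sqintegB sg sh.
rewrite /radiated (Cint_region_measure mD Doo (cmeasM mk s1.1)) (Cint_region_measure mD Doo (cmeasM mk s2.1)).
have j1 := cinteg_bounded_sqinteg mk k2 s1; have j2 := cinteg_bounded_sqinteg mk k2 s2.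
rewrite -CintN// -CintD//; last exact: cintegN.
have -> : Cint nu (fun x => far_kernel k xhat x * resolvent D k V (incident_source d) x +
      - (far_kernel k xhat x * resolvent D k V (incident_source xhat) x)) =
    Cint nu (fun x => far_kernel k xhat x * h0 x + far_kernel k xhat x * (g x - h0 x)).
  apply: Cint_ae.
  - by apply: cmeasD; [exact: (cmeasM mk s1.1)|apply: cmeasN; exact: (cmeasM mk s2.1)].
  - by apply: cmeasD; [exact: (cmeasM mk mh0)|exact: (cmeasM mk sd.1)].
  - have F : Filter (almost_everywhere nu) by exact: ae_filter_ringOfSetsType.
    by apply: filterS gg => x gx; rewrite -mulrN -mulrDr gx -mulrDr [h0 x + _]addrC subrK.
rewrite (CintD (cinteg_bounded_sqinteg mk k2 sh) (cinteg_bounded_sqinteg mk k2 sd)).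
have -> : Cint nu (fun x => far_kernel k xhat x * h0 x) =
    Cint nu (fun y => (V0 y)%:C * (expi (- dot xi y) - 1)).
  (* the two plane waves give the two exponentials, as k (xhat - d) = xi *)
  congr Cint; apply/funext => y; rewrite /h0 mulrCA; congr (_ * _).
  rewrite mulrBr /far_kernel /plane_wave !expiD; congr (_ - _).
    by congr expi; rewrite -hxi (dotC y); ring.
  by rewrite (dotC y) addNr expi0.
rewrite addrAC subrr add0r.
have jd : integ nu (fun x => 2 * cabs (g x - h0 x)).
  have mgh : measurable_fun setT (fun x : mR3 R => 2 * cabs (g x - h0 x)).
    by apply: measurable_funM => //; exact: (measurable_cabs sd.1).
  apply: (@integ_bounded _ _ _ _ _ (2 * (B + (4 * M + 1))) mgh) => x.
  rewrite ger0_norm ?mulr_ge0 ?cabs_ge0// ler_wpM2l//.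
  by rewrite (le_trans (cabsB _ _))// lerD.
apply: (le_trans (cabs_Cint (cmeasM mk sd.1) _ jd)).
  move=> x; rewrite (le_trans (cabsM _ _))// ler_wpM2r ?cabs_ge0//.
rewrite RintegralZl//; last first.
  have := integrableZl measurableT 2^-1 jd.
  by apply: eq_integrable => // x _ /=; rewrite -EFinM mulKf.
apply: (@le_trans _ _ (2 * (M * (2 * ((4 * M + 1) * (1 + M * (C + mass nu))) * s * (mass nu + 1))))).
  by rewrite ler_wpM2l.
by rewrite /born_constant le_eqVlt; apply/predU1P; left; ring.
Qed.

End far_field_difference.

End born_approximation.

(** * Directions of measurement *)

Section directions.
Variable R : realType.

Lemma unit_orthogonal (xi : R3 R) : exists2 e : R3 R, dot e e = 1 & dot e xi = 0.
Proof.
case: xi => [[a b] c]; pose n := a ^+ 2 + b ^+ 2.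
have n0 : 0 <= n by rewrite addr_ge0 ?sqr_ge0.
have [ne|nn] := eqVneq n 0.
  exists (1, 0, 0); rewrite /dot /=; first by ring.
  have a0 : a ^+ 2 = 0 by have := sqr_ge0 b; have := sqr_ge0 a; move: ne; rewrite /n; lra.
  by move/eqP: a0; rewrite sqrf_eq0 => /eqP ->; ring.
have N0 : Num.sqrt n != 0 by rewrite sqrtr_eq0 -ltNge lt_neqAle eq_sym nn.
exists (- b / Num.sqrt n, a / Num.sqrt n, 0); rewrite /dot /=; last by ring.
transitivity ((a ^+ 2 + b ^+ 2) / Num.sqrt n ^+ 2); first by field.
by rewrite sqr_sqrtr// divff.
Qed.

Lemma dot_half_sphere (xi e : R3 R) (tau k : R) : dot e e = 1 -> dot e xi = 0 ->
  0 < k -> tau ^+ 2 + dot xi xi / 4 = k ^+ 2 ->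
  forall sg, sg ^+ 2 = 1 ->
  enorm ((sg * xi.1.1 / 2 + tau * e.1.1) / k, (sg * xi.1.2 / 2 + tau * e.1.2) / k,
         (sg * xi.2 / 2 + tau * e.2) / k) = 1.
Proof.
move=> ee ex k0 tk sg sg1; have kn : k != 0 by rewrite gt_eqF.
rewrite /enorm [X in Num.sqrt X](_ : _ = 1) ?sqrtr1//.
transitivity ((tau ^+ 2 * dot e e + sg ^+ 2 * (dot xi xi / 4) + sg * tau * dot e xi) / k ^+ 2).
  by rewrite /dot /=; field.
by rewrite ee ex sg1 mulr0 addr0 mulr1 mul1r tk divff// expf_neq0.
Qed.

(** Take xhat = (xi/2 + tau e) / k and d = (- xi/2 + tau e) / k with e a unit
    vector orthogonal to xi and tau^2 = k^2 - |xi|^2 / 4. *)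
Lemma momentum_transfer (xi : R3 R) (k : R) : 0 < k -> dot xi xi <= 4 * k ^+ 2 ->
  exists xhat d : sphere2 R,
    forall y, k * dot (sval xhat) y - k * dot (sval d) y = dot xi y.
Proof.
move=> k0 xk; have [e ee ex] := unit_orthogonal xi.
pose tau := Num.sqrt (k ^+ 2 - dot xi xi / 4).
have tk : tau ^+ 2 + dot xi xi / 4 = k ^+ 2 by rewrite sqr_sqrtr ?subrK//; lra.
have kn : k != 0 by rewrite gt_eqF.
have h := dot_half_sphere ee ex k0 tk.
have m1 : (-1 : R) ^+ 2 = 1 by rewrite sqrrN expr1n.
pose pt x (px : enorm x = 1) : sphere2 R := exist (fun x : R3 R => enorm x = 1) x px.
exists (pt _ (h 1 (expr1n _ _))), (pt _ (h (-1) m1)) => y.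
by rewrite /dot /=; field.
Qed.

End directions.

(** * Functions whose Fourier transform is constant *)

Section constant_transform.
Variable R : realType.
Local Notation mu := (@leb3 R).
Variable nu : {finite_measure set (mR3 R) -> \bar R}.
Hypothesis nu_le : forall A, measurable A -> (nu A <= mu A)%E.
Variables (r : R) (W : mR3 R -> R) (M : R).
Hypotheses (r0 : 0 <= r) (nu_cube : {ae nu, forall x, cube 0 r x}).
Hypotheses (mW : measurable_fun setT W) (WM : forall x, `|W x| <= M).
Hypothesis Wcos : forall xi, \int[nu]_x (W x * (cos (dot xi x) - 1)) = 0.
Hypothesis Wsin : forall xi, \int[nu]_x (W x * sin (dot xi x)) = 0.

Lemma null_coordinate_planes a : [/\ nu [set x | x.1.1 = a] = 0%E,
  nu [set x | x.1.2 = a] = 0%E & nu [set x | x.2 = a] = 0%E].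
Proof.
have h (A : set (mR3 R)) : measurable A -> mu A = 0%E -> nu A = 0%E.
  move=> mA A0; apply/eqP; rewrite eq_le measure_ge0 andbT.
  by rewrite -A0; exact: nu_le.
have E1 : [set x : mR3 R | x.1.1 = a] = ([set a] `*` setT) `*` setT.
  by apply/seteqP; split => x /=; [move=> -> | move=> [[]]].
have E2 : [set x : mR3 R | x.1.2 = a] = (setT `*` [set a]) `*` setT.
  by apply/seteqP; split => x /=; [move=> -> | move=> [[]]].
have E3 : [set x : mR3 R | x.2 = a] = (setT `*` setT) `*` [set a].
  by apply/seteqP; split => x /=; [move=> -> | move=> [[]]].
split.
- apply: h; first exact: (measurable_level a (@measurable_coord1 R)).
  have := leb3_box (measurable_set1 a) (@measurableT _ (measurableTypeR R)) (@measurableT _ (measurableTypeR R)).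
  by rewrite E1 lebesgue_measure_set1 !mul0e; apply.
- apply: h; first exact: (measurable_level a (@measurable_coord2 R)).
  have := leb3_box (@measurableT _ (measurableTypeR R)) (measurable_set1 a) (@measurableT _ (measurableTypeR R)).
  by rewrite E2 lebesgue_measure_set1 mule0 mul0e; apply.
- apply: h; first exact: (measurable_level a (@measurable_coord3 R)).
  have := leb3_box (@measurableT _ (measurableTypeR R)) (@measurableT _ (measurableTypeR R)) (measurable_set1 a).
  by rewrite E3 lebesgue_measure_set1 mule0; apply.
Qed.

Let jW (g : mR3 R -> R) B : measurable_fun setT g -> (forall x, `|g x| <= B) ->
  integ nu (fun x => W x * g x).
Proof.
move=> mg gB; apply: (@integ_bounded _ _ _ _ _ (M * B)); first exact: measurable_funM.
by move=> x; rewrite normrM ler_pM.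
Qed.

Let Wwave xi b : \int[nu]_x (W x * wave xi b x) = cos b * \int[nu]_x W x.
Proof.
have jw : integ nu W by exact: (@integ_bounded _ _ _ _ _ M mW WM).
have jc : integ nu (fun x => W x * (cos (dot xi x) - 1)).
  apply: (@jW _ 2).
    by apply: measurable_funB => //; apply: measurable_cos_comp; exact: measurable_dot.
  by move=> x; rewrite ler_norml; have := cos_le1 (dot xi x); have := cos_geN1 (dot xi x); lra.
have js : integ nu (fun x => W x * sin (dot xi x)).
  apply: (@jW _ 1); last by move=> x; exact: sin_max.
  by apply: measurable_sin_comp; exact: measurable_dot.
transitivity (\int[nu]_x (cos b * (W x * (cos (dot xi x) - 1)) +
    ((- sin b) * (W x * sin (dot xi x)) + cos b * W x))).
  by apply: eq_Rintegral => x _; rewrite /wave cosD; ring.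
have j1 := integrableZl measurableT (cos b) jc.
have j2 := integrableZl measurableT (- sin b) js.
have j3 := integrableZl measurableT (cos b) jw.
rewrite (RintegralD measurableT j1 (integrableD measurableT j2 j3)) (RintegralD measurableT j2 j3).
by rewrite !RintegralZl// Wcos Wsin !mulr0 !add0r.
Qed.

(** The transform of W (1 - cos (eta . x)) at xi is that of W at xi minus the
    mean of its values at xi + eta and xi - eta, which is 0. The factor
    1 - cos (eta . x) vanishes on the cube only in the plane x_1 = 0, for the
    chosen eta. *)
Lemma constant_transform_zero : {ae nu, forall x, W x = 0}.
Proof.
pose eta : R3 R := ((r + 1)^-1, 0, 0).
have mw := @measurable_wave R.
pose W' x := W x * (1 - wave eta 0 x).
have b1 x : `|1 - wave eta 0 x| <= 2.
  by rewrite ler_norml; have := cos_le1 (dot eta x + 0); have := cos_geN1 (dot eta x + 0); rewrite /wave; lra.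
have mW' : measurable_fun setT W'.
  by apply: measurable_funM => //; apply: measurable_funB.
have WM' x : `|W' x| <= M * 2 by rewrite normrM ler_pM.
have F0 xi b : \int[nu]_x (W' x * wave xi b x) = 0.
  have j xi' b' : integ nu (fun x => W x * wave xi' b' x).
    by apply: (@jW _ 1) => // x; exact: cos_max.
  transitivity (\int[nu]_x (W x * wave xi b x +
      (- 2^-1 * (W x * wave (eta + xi) (0 + b) x) + - 2^-1 * (W x * wave (eta - xi) (0 - b) x)))).
    apply: eq_Rintegral => x _.
    transitivity (W x * wave xi b x - W x * (wave eta 0 x * wave xi b x)); first by rewrite /W'; ring.
    by rewrite waveM; ring.
  have j1 := j xi b.
  have j2 := integrableZl measurableT (- 2^-1) (j (eta + xi) (0 + b)).
  have j3 := integrableZl measurableT (- 2^-1) (j (eta - xi) (0 - b)).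
  rewrite (RintegralD measurableT j1 (integrableD measurableT j2 j3)) (RintegralD measurableT j2 j3).
  by rewrite !RintegralZl// !Wwave add0r sub0r cosN; field.
have W'0 := fourier_uniqueness r0 nu_cube mW' WM' F0 null_coordinate_planes.
have [n1 _ _] := null_coordinate_planes 0.
have ne1 : {ae nu, forall x : mR3 R, x.1.1 != 0}.
  exists [set x | x.1.1 = 0]; split => //.
    exact: (measurable_level 0 (@measurable_coord1 R)).
  by move=> x /= /negP; rewrite negbK => /eqP.
have Fn : Filter (almost_everywhere nu) by exact: ae_filter_ringOfSetsType.
apply: filterS3 W'0 ne1 nu_cube => x W0 x0 /cubeP[].
rewrite /= subr0 => x1 _ _.
have r1 : 0 < r + 1 by rewrite ltr_wpDl.
pose t := (r + 1)^-1 * x.1.1.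
have t0 : t != 0 by rewrite mulf_neq0// invr_eq0 gt_eqF.
have t1 : `|t| <= 1.
  by rewrite /t normrM gtr0_norm ?invr_gt0// ler_pdivrMl// mulr1 (le_trans x1)// lerDl.
have ct : cos t != 1.
  apply/eqP => c1.
  have st : sin t = 0.
    by apply/eqP; rewrite -sqrf_eq0 sin2cos2 c1 expr1n subrr.
  have pi2 := pi_ge2 R.
  have sp (v : R) : 0 < v -> v <= 1 -> 0 < sin v.
    by move=> v0 v1; apply: sin_gt0_pi; rewrite v0/=; lra.
  move: t1; rewrite ler_norml => /andP[ta tb].
  have [tn|tp|t00] := ltgtP t 0; last by rewrite t00 eqxx in t0.
    by have : 0 < sin (- t) by [apply: sp; [rewrite oppr_gt0|rewrite lerNl]]; rewrite sinN st oppr0 ltxx.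
  by have := sp t tp tb; rewrite st ltxx.
move: W0; rewrite /W' => /eqP; rewrite mulf_eq0 => /orP[/eqP //|].
by rewrite /wave /dot /= !mul0r !addr0 -/t subr_eq0 eq_sym (negPf ct).
Qed.

End constant_transform.

(** * Uniqueness of the potential *)

Section uniqueness.
Variables (R : realType) (D : set (R3 R)).
Hypothesis hD : bounded_domain_with_origin D.
Context (dO : measure_display) (Omega : measurableType dO).
Local Notation mu := (@leb3 R).

(** The noise contribution depends on the observation direction and on the wave
    number, and not on the incident direction. *)
Lemma far_field_radiated (V f : R3 R -> R) (N : sphere2 R -> {posnum R} -> Omega -> R[i])
  xhat (k : {posnum R}) d w :
  far_field D true V f N xhat k d w - far_field D true V f N xhat k xhat w =
  ((4 * pi)^-1)%:C * (radiated D k%:num V f xhat d - radiated D k%:num V f xhat xhat).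
Proof. by rewrite /far_field -mulrBr; congr (_ * _); rewrite opprB addrA subrK. Qed.

Lemma radiated_of_data (V f V' f' : R3 R -> R)
  (N N' : sphere2 R -> {posnum R} -> Omega -> R[i]) (w w' : Omega) xhat (k : {posnum R}) d :
  (forall b, far_field D true V f N xhat k b w = far_field D true V' f' N' xhat k b w') ->
  radiated D k%:num V f xhat d - radiated D k%:num V f xhat xhat =
  radiated D k%:num V' f' xhat d - radiated D k%:num V' f' xhat xhat.
Proof.
move=> data; have p0 : ((4 * pi)^-1)%:C != 0 :> R[i].
  by rewrite (fmorph_eq0 (real_complex R)) invr_eq0 mulf_neq0// gt_eqF ?pi_gt0.
have h := far_field_radiated V f N xhat k d w; rewrite !data in h.
have h' := far_field_radiated V' f' N' xhat k d w'.
by apply: (mulfI p0); exact: etrans (esym h) h'.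
Qed.

Lemma small_parameter (A B eps : R) : 0 < eps -> exists s : R,
  [/\ 0 < s, A * s <= 2^-1 & B * s <= eps].
Proof.
move=> e0; pose c := 1 + `|A| + `|B|.
have c0 : 0 < c by rewrite /c -addrA ltr_pwDl// addr_ge0.
have cA : A <= c by rewrite /c (le_trans (ler_norm A))// addrAC lerDr addr_ge0.
have cB : B <= c by rewrite /c (le_trans (ler_norm B))// lerDr addr_ge0.
pose m := Num.min 2^-1 eps.
have m0 : 0 < m by rewrite lt_min e0 invr_gt0 ltr0n.
exists (m / c); split; first by rewrite divr_gt0.
- apply: (@le_trans _ _ (c * (m / c))); first by rewrite ler_wpM2r// ltW// divr_gt0.
  by rewrite mulrCA divff ?gt_eqF// mulr1 ge_min lexx.
- apply: (@le_trans _ _ (c * (m / c))); first by rewrite ler_wpM2r// ltW// divr_gt0.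
  by rewrite mulrCA divff ?gt_eqF// mulr1 ge_min lexx orbT.
Qed.

(** For fixed xi, the data give the same value to the two differences of
    radiated fields, and each is within an arbitrarily small distance of the
    integral of V (exp(- i xi . y) - 1), resp. of V' (exp(- i xi . y) - 1), along
    a sequence of wave numbers that serves both potentials: the energy does not
    involve them. *)
Theorem potential_determined (V f V' f' : R3 R -> R)
  (N N' : sphere2 R -> {posnum R} -> Omega -> R[i]) (w w' : Omega) :
  V \in Lfun mu +oo -> f \in Lfun mu +oo -> supported_in D V -> supported_in D f ->
  V' \in Lfun mu +oo -> f' \in Lfun mu +oo -> supported_in D V' -> supported_in D f' ->
  (fun xhat k d => far_field D true V f N xhat k d w) =
  (fun xhat k d => far_field D true V' f' N' xhat k d w') ->
  {ae mu, forall x, V x = V' x}.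
Proof.
move=> LV Lf SV Sf LV' Lf' SV' Sf' data.
have [oD _ bD _] := hD.
have mD := open_measurable_R3 oD; have Doo := leb3_bounded_lty oD bD.
pose nu := region_measure mD Doo; have nu_le := region_measure_le mD Doo.
have [r r0 Dr] := bounded_sub_cube bD.
have nu_cube : {ae nu, forall x, cube 0 r x} by apply: mfrestr_ae; exact: nearW.
have [V0 [M1 [mV0 M10 V0M V0D VV0]]] := bounded_representative mD LV SV.
have [V0' [M2 [mV0' M20 V0M' V0D' VV0']]] := bounded_representative mD LV' SV'.
have [f0 [Mf [mf0 Mf0 f0M f0D ff0]]] := bounded_representative mD Lf Sf.
have [f0' [Mf' [mf0' Mf0' f0M' f0D' ff0']]] := bounded_representative mD Lf' Sf'.
pose M := M1 + M2; have M0 : 0 <= M by rewrite addr_ge0.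
have VM x : `|V0 x| <= M by rewrite (le_trans (V0M x))// lerDl.
have VM' x : `|V0' x| <= M by rewrite (le_trans (V0M' x))// lerDr.
pose C := green_bound nu.
pose I (U : R3 R -> R) xi := Cint nu (fun y => (U y)%:C * (expi (- dot xi y) - 1)).
have close xi eps : 0 < eps -> cabs (I V0 xi - I V0' xi) <= eps.
  (* s makes the Neumann series converge and both Born errors at most eps / 2;
     the wave number j is then taken large enough for the momentum transfer
     and of energy below the threshold for s *)
  move=> e0; have [s [s0 sM sE]] := small_parameter (M * (M * (C + 2)))
    (2 * born_constant mD Doo M) e0.
  have sM' : M * (M * (s * (C + 2))) <= 2^-1.
    by rewrite (_ : M * _ = M * (M * (C + 2)) * s)//; ring.
  pose J := (Num.truncn (dot xi xi)).+1.
  have [j Jj Ej] := energy_small (green_bound_ge0 nu) (@measurable_green_amp R) (@measurable_edist R)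
    (@green_amp_ge0 R) (@green_ampC R) (green_amp_sq_integral nu_le) (edist_levels nu_le) J
    (energy_bound_gt0 nu s0).
  have j1 : 1 <= j%:R :> R by rewrite ler1n (leq_trans _ Jj).
  have j0 : 0 < j%:R :> R := lt_le_trans ltr01 j1.
  have xj : dot xi xi <= 4 * j%:R ^+ 2.
    have h1 : dot xi xi <= J%:R by rewrite ltW// truncnS_gt.
    have h2 : J%:R <= j%:R :> R by rewrite ler_nat.
    have h3 : j%:R <= j%:R ^+ 2 :> R by rewrite expr2 ler_peMl.
    by rewrite (le_trans h1)// (le_trans h2)// (le_trans h3)// ler_peMl ?sqr_ge0// ler1n.
  have [k kj] : exists k : {posnum R}, k%:num = j%:R by exists (PosNum j0).
  rewrite -kj in Ej j0 xj.
  have [xhat [d hd]] := momentum_transfer j0 xj.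
  have e1 := radiated_difference s0 Ej sM' mV0 VM M0 V0D VV0 mf0 f0M Mf0 f0D ff0 hd.
  have e2 := radiated_difference s0 Ej sM' mV0' VM' M0 V0D' VV0' mf0' f0M' Mf0' f0D' ff0' hd.
  have same : radiated D k%:num V f xhat d - radiated D k%:num V f xhat xhat =
      radiated D k%:num V' f' xhat d - radiated D k%:num V' f' xhat xhat.
    exact: (radiated_of_data d (fun b => congr1 (fun F => F xhat k b) data)).
  rewrite same in e1; set X := (X in cabs (X - _)) in e1.
  have -> : I V0 xi - I V0' xi = (X - I V0' xi) - (X - I V0 xi) by ring.
  apply: (le_trans (cabsB _ _)); apply: le_trans sE.
  rewrite -mulrA mulr_natl mulr2n; apply: lerD; [exact: e2|exact: e1].
have same xi : I V0 xi = I V0' xi.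
  apply/eqP; rewrite -subr_eq0; apply/eqP; apply: cabs_eq0.
  by apply/ler_addgt0Pl => e e0; rewrite addr0; exact: close.
pose W (x : mR3 R) := V0 x - V0' x.
have mW : measurable_fun setT W by exact: measurable_funB.
have WM x : `|W x| <= M1 + M2 by rewrite (le_trans (ler_normB _ _))// lerD.
have jV (U g : mR3 R -> R) : measurable_fun setT U -> (forall x, `|U x| <= M) ->
    measurable_fun setT g -> (forall x, `|g x| <= 2) -> integ nu (fun x => U x * g x).
  move=> mU UM mg g2; apply: (@integ_bounded _ _ _ _ _ (M * 2)); first exact: measurable_funM.
  by move=> x; rewrite normrM ler_pM.
have split_W (g : mR3 R -> R) : measurable_fun setT g -> (forall x, `|g x| <= 2) ->
    \int[nu]_x (V0 x * g x) = \int[nu]_x (V0' x * g x) -> \int[nu]_x (W x * g x) = 0.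
  move=> mg g2 e; have jg := jV _ _ mV0 VM mg g2; have jg' := jV _ _ mV0' VM' mg g2.
  rewrite -[RHS](subrr (\int[nu]_x (V0' x * g x))) -{1}e -RintegralB//.
  by apply: eq_Rintegral => x _; rewrite /W mulrBl.
have mcos xi : measurable_fun setT (fun x : mR3 R => cos (dot xi x)).
  by apply: measurable_cos_comp; exact: measurable_dot.
have msin xi : measurable_fun setT (fun x : mR3 R => sin (dot xi x)).
  by apply: measurable_sin_comp; exact: measurable_dot.
have Wcos xi : \int[nu]_x (W x * (cos (dot xi x) - 1)) = 0.
  apply: split_W; first exact: measurable_funB.
    by move=> x; rewrite ler_norml; have := cos_le1 (dot xi x); have := cos_geN1 (dot xi x); lra.
  have E (U : R3 R -> R) : \int[nu]_x (U x * (cos (dot xi x) - 1)) = Re (I U xi).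
    by apply: eq_Rintegral => x _; rewrite ReZ /= cosN.
  by rewrite !E same.
have Wsin xi : \int[nu]_x (W x * sin (dot xi x)) = 0.
  apply: split_W => //; first by move=> x; rewrite (le_trans (sin_max _))// ler1n.
  (* I is evaluated at - xi because its exponential has the phase - xi . x *)
  have E (U : R3 R -> R) : \int[nu]_x (U x * sin (dot xi x)) = Im (I U (- xi)).
    apply: eq_Rintegral => x _; rewrite ImZ /= subr0; congr (_ * sin _).
    by rewrite /dot /=; ring.
  by rewrite !E same.
have W0 := constant_transform_zero nu_le r0 nu_cube mW WM Wcos Wsin.
have F : Filter (almost_everywhere mu) by exact: ae_filter_ringOfSetsType.
have W0D := ae_mfrestr_inv W0.
apply: filterS3 VV0 VV0' W0D => x -> -> h.
have [Dx|nD] := pselect (D x); last by rewrite V0D// V0D'.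
by apply/eqP; rewrite -subr_eq0; apply/eqP; exact: h.
Qed.

End uniqueness.

Theorem theorem1p2 (R : realType) (D : set (R3 R))
    (hD : bounded_domain_with_origin D)
    (dO : measure_display) (Omega : measurableType dO)
    (P : probability Omega R) (hP : measure_is_complete P)
    (B : (R3 R -> R) -> {RV P >-> R}) (hB : white_noise D B) :
  exists T : (sphere2 R -> {posnum R} -> sphere2 R -> R[i]) -> (R3 R -> R),
    forall sigma V f : R3 R -> R, admissible D sigma V f ->
    forall N : sphere2 R -> {posnum R} -> Omega -> R[i],
      noise_contribution D B sigma V N ->
    forall w : Omega,
      {ae leb3, forall x : R3 R,
        T (fun xhat k d => far_field D true V f N xhat k d w) x = V x}.
Proof.
pose realizes (data : sphere2 R -> {posnum R} -> sphere2 R -> R[i]) (V : R3 R -> R) :=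
  exists sigma f N w, admissible D sigma V f /\
    data = (fun xhat k d => far_field D true V f N xhat k d (w : Omega)).
(* all potentials that realize the data agree almost everywhere, so any
   choice among them recovers V *)
exists (fun data => xget (fun=> 0) [set V | realizes data V]).
move=> sigma V f adm N _ w.
pose data xhat k d := far_field D true V f N xhat k d w.
have ex : exists V', realizes data V' by exists V, sigma, f, N, w.
have [sigma' [f' [N' [w' [adm' e]]]]] := xgetPex (fun=> 0) ex.
have [_ _ LV Lf [_ SV Sf]] := adm; have [_ _ LV' Lf' [_ SV' Sf']] := adm'.
exact: (potential_determined hD LV' Lf' SV' Sf' LV Lf SV Sf (esym e)).
Qed.
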